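(* The decision problem 3-DIOMEGA-ORDERING — given a tournament $T$, decide whether $\vec{\omega}(T) \leq 3$ — is NP-complete.
   Context: A tournament is an orientation of a complete graph. Given a tournament $T$ and a total order $\prec$ on $V(T)$, the backedge graph $T^{\prec}$ is the undirected graph with vertex set $V(T)$ in which $u,v$ with $u \prec v$ are adjacent if and only if $vu \in A(T)$. The clique number of the tournament is $\vec{\omega}(T) = \min_{\prec} \omega(T^{\prec})$ over all total orders $\prec$ of $V(T)$. *)

(* Defs.v *)
From HB Require Import structures.
From mathcomp Require Import all_boot all_order all_algebra.

Set Implicit Arguments.
Unset Strict Implicit.
Unset Printing Implicit Defensive.

Definition is_tournament (V : finType) (A : rel V) : Prop :=
  irreflexive A /\ forall u v, u != v -> A u v (+) A v u.

(* A relation on [V] is represented by its graph, a set of pairs, so that the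
   minimum in [diomega] ranges over a finite type. *)
Definition strict_total_order (V : finType) (r : {set V * V}) : bool :=
  [&& [forall u, (u, u) \notin r],
      [forall u, forall v, forall w,
         ((u, v) \in r) && ((v, w) \in r) ==> ((u, w) \in r)]
    & [forall u, forall v, (u != v) ==> ((u, v) \in r) || ((v, u) \in r)]].

Definition backedge (V : finType) (A : rel V) (r : {set V * V}) : rel V :=
  fun u v => ((u, v) \in r) && A v u || ((v, u) \in r) && A u v.

Definition is_clique (V : finType) (E : rel V) (S : {set V}) : bool :=
  [forall u in S, forall v in S, (u != v) ==> E u v].

Definition clique_number (V : finType) (E : rel V) : nat :=
  \max_(S : {set V} | is_clique E S) #|S|.

(* The default value #|V| bounds every clique number, and a total order always
   exists, so this is the minimum over all total orders. *)
Definition diomega (V : finType) (A : rel V) : nat :=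
  \big[minn/#|V|]_(r : {set V * V} | strict_total_order r)
    clique_number (backedge A r).

(* Row-major adjacency matrix; its length n ^ 2 determines n. *)
Definition encode_tournament (n : nat) (A : rel 'I_n) : seq bool :=
  [seq A u v | u <- enum 'I_n, v <- enum 'I_n].

Definition language := seq bool -> Prop.

Definition three_diomega_ordering : language := fun w =>
  exists (n : nat) (A : rel 'I_n),
    [/\ is_tournament A, w = encode_tournament A & diomega A <= 3].

Inductive move := MoveL | Stay | MoveR.

Definition move_to_opt (m : move) : option bool :=
  match m with MoveL => Some false | Stay => None | MoveR => Some true end.
Definition move_of_opt (o : option bool) : move :=
  match o with Some false => MoveL | None => Stay | Some true => MoveR end.
Lemma move_to_optK : cancel move_to_opt move_of_opt. Proof. by case. Qed.
HB.instance Definition _ := Finite.copy move (can_type move_to_optK).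

(* [None] is the blank, [Some (inl b)] an input symbol, [Some (inr a)] an
   auxiliary work symbol. *)
Definition tsymbol (G : finType) := option (bool + G).

(* Multitape nondeterministic Turing machines with [tm_k.+1] tapes. In state
   [q] scanning the symbols [s], the machine may enter [q'], write [(a i).1] on
   tape [i] and move its head by [(a i).2] whenever [tm_delta q s q' a]. *)
Record tm := TM {
  tm_k : nat;
  tm_state : finType;
  tm_work : finType;
  tm_start : tm_state;
  tm_accept : pred tm_state;
  tm_delta : tm_state -> {ffun 'I_tm_k.+1 -> tsymbol tm_work} ->
             tm_state -> {ffun 'I_tm_k.+1 -> tsymbol tm_work * move} -> bool
}.

(* A tape infinite in both directions: [tleft], nearest cell first, [thead] the
   scanned cell, [tright]; all cells beyond the lists are blank. *)
Record tape (G : finType) := Tape {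
  tleft : seq (tsymbol G);
  thead : tsymbol G;
  tright : seq (tsymbol G)
}.

Definition tape_act (G : finType) (t : tape G) (a : tsymbol G * move) : tape G :=
  let: Tape l _ r := t in
  match a.2 with
  | MoveL => Tape (behead l) (head None l) (a.1 :: r)
  | Stay => Tape l a.1 r
  | MoveR => Tape (a.1 :: l) (head None r) (behead r)
  end.

Definition word_symbols (G : finType) (w : seq bool) : seq (tsymbol G) :=
  [seq Some (inl b) | b <- w].

Definition input_tape (G : finType) (w : seq bool) : tape G :=
  let s := word_symbols G w in Tape [::] (head None s) (behead s).

(* The tape contains the word [w] and is blank elsewhere. *)
Definition tape_contains (G : finType) (t : tape G) (w : seq bool) : Prop :=
  exists i j, rev (tleft t) ++ thead t :: tright t =
              nseq i None ++ word_symbols G w ++ nseq j None.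

Record config (M : tm) := Config {
  cstate : tm_state M;
  ctapes : {ffun 'I_(tm_k M).+1 -> tape (tm_work M)}
}.

Definition scanned (M : tm) (c : config M) :
    {ffun 'I_(tm_k M).+1 -> tsymbol (tm_work M)} :=
  [ffun i => thead (ctapes c i)].

Definition init_config (M : tm) (w : seq bool) : config M :=
  Config (tm_start M)
    [ffun i => input_tape (tm_work M) (if i == ord0 then w else [::])].

Definition step (M : tm) (c c' : config M) : Prop :=
  exists2 a, tm_delta (cstate c) (scanned c) (cstate c') a
           & ctapes c' = [ffun i => tape_act (ctapes c i) (a i)].

Fixpoint nsteps (M : tm) (n : nat) (c c' : config M) : Prop :=
  if n is n'.+1 then exists2 d, step c d & nsteps n' d c' else c = c'.

Definition halted (M : tm) (c : config M) : Prop := forall c', ~ step c c'.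

Definition deterministic (M : tm) : Prop :=
  forall q s q1 a1 q2 a2,
    @tm_delta M q s q1 a1 -> @tm_delta M q s q2 a2 -> q1 = q2 /\ a1 = a2.

Definition runs_in_time (M : tm) (p : {poly nat}) : Prop :=
  forall w n (c : config M),
    nsteps n (init_config M w) c -> n <= p.[size w]%R.

Definition polytime (M : tm) : Prop := exists p : {poly nat}, runs_in_time M p.

Definition accepts (M : tm) (w : seq bool) : Prop :=
  exists n (c : config M),
    [/\ nsteps n (init_config M w) c, halted c & tm_accept (cstate c)].

Definition in_NP (L : language) : Prop :=
  exists M : tm, polytime M /\ forall w, L w <-> accepts M w.

(* The input is on the first tape, the output on the last one. *)
Definition computes (M : tm) (f : seq bool -> seq bool) : Prop :=
  forall w, exists n (c : config M),
    [/\ nsteps n (init_config M w) c, halted c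
      & tape_contains (ctapes c ord_max) (f w)].

Definition polytime_computable (f : seq bool -> seq bool) : Prop :=
  exists M : tm, [/\ deterministic M, polytime M & computes M f].

Definition polytime_reducible (L1 L2 : language) : Prop :=
  exists f, polytime_computable f /\ forall w, L1 w <-> L2 (f w).

Definition NP_hard (L : language) : Prop :=
  forall L', in_NP L' -> polytime_reducible L' L.

Definition NP_complete (L : language) : Prop := in_NP L /\ NP_hard L.

(* Main.v *)
From HB Require Import structures.
From mathcomp Require Import all_boot all_order all_algebra zify.
From Stdlib Require Import FunctionalExtensionality.
Require Import Defs.

Set Implicit Arguments.
Unset Strict Implicit.
Unset Printing Implicit Defensive.

(** Hardness. Let [R] be a 7-vertex tournament with an order whose backedge graph is
    triangle-free, but which is not the union of two transitive tournaments, and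
    let [R1], [R2] be copies of it. In an order with no [K4] of the tournament
    [V => R2 => R1 => V], call a vertex of [V] low if some backedge of [R1] lies
    after it. Two low vertices are not joined by a backedge. If [x] is not low,
    then some backedge of [R1] lies before [x], hence some backedge of [R2] lies
    before [x] too (a backedge of [R2] after [x] would complete a [K4]), and so
    two non-low vertices are not joined by a backedge either. Thus [V] is the union
    of two transitive tournaments; conversely, if it is, putting one part before
    [R2], [R1] and the other one after gives clique number 3. Partition into two
    transitive tournaments encodes not-all-equal satisfiability: a 3-cycle is an
    arbitrary not-all-equal constraint, and a backedge passing over a 3-cycle
    forces distinct colours on its ends. Cook-Levin tableaux are encoded by clauses
    that only force the facts true in an actual run.

    Turing machines. Adjacency in the constructed tournament is an arithmetic
    expression in the two vertex numbers, built from addition, truncated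
    subtraction, bounded sums and bits of the input; such expressions compile to
    programs on unary counters, that is, tapes marked at their origin. The same
    compiler checks a guessed order, which gives membership in NP. *)

(** * Programs on counter tapes and the machines that run them *)

(** The two properties of [R] serve the two directions. A vertex [x] splits a copy of [R] into the
    part before it and the part after it; one part contains a 3-cycle, and every 3-cycle has a
    backedge in every order, so some backedge of the copy lies wholly on one side of [x].
    Triangle-freeness is for the converse: in the order built from a partition, a clique meets a
    copy in at most two vertices. The obstacle on the machine side is that both halves ask for
    actual multitape machines with a time bound on every run. One family of machines meets both: a
    word as long as the input is guessed, then a deterministic counter program runs. That length
    suffices for membership, since an order on n vertices is an n by n bit matrix, just like the
    tournament; with guesses restricted to the letter [false] the machine is deterministic and
    computes a reduction. *)

Notation sym := (tsymbol unit).
Definition mark : sym := Some (inr tt).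

(** The list [tleft t] has length exactly [p], so cell 0 is a fixed origin and the head position
    itself can serve as the value of a counter. *)
Definition represents (G : finType) (t : tape G) (c : nat -> tsymbol G) (p : nat) :=
  [/\ tleft t = [seq c i | i <- rev (iota 0 p)], thead t = c p
    & forall j, nth None (tright t) j = c (p + j.+1)].

Lemma rev_iotaS p : rev (iota 0 p.+1) = p :: rev (iota 0 p).
Proof. by rewrite -addn1 iotaD cats1 rev_rcons. Qed.

Lemma represents_right (G : finType) (t : tape G) c c' p a :
  represents t c p -> (forall j, j != p -> c' j = c j) -> c' p = a ->
  represents (tape_act t (a, MoveR)) c' p.+1.
Proof.
case: t => l h r [/= hl hh hr] e ep; split; rewrite ?rev_iotaS /=.
- rewrite ep hl; congr cons.
  apply/eq_in_map=> i; rewrite mem_rev mem_iota => /andP[_ lt_ip].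
  by rewrite e //; lia.
- by rewrite e; [rewrite -nth0 hr; congr c; lia | lia].
- by move=> j; rewrite nth_behead hr e; [congr c; lia | lia].
Qed.

Lemma represents_stay (G : finType) (t : tape G) c c' p a :
  represents t c p -> (forall j, j != p -> c' j = c j) -> c' p = a ->
  represents (tape_act t (a, Stay)) c' p.
Proof.
case: t => l h r [/= hl hh hr] e ep; split=> //=.
- rewrite hl; apply/eq_in_map=> i; rewrite mem_rev mem_iota => /andP[_ lt_ip].
  by rewrite e //; lia.
- by move=> j; rewrite hr e //; lia.
Qed.

Lemma represents_left (G : finType) (t : tape G) c p :
  represents t c p.+1 -> represents (tape_act t (c p.+1, MoveL)) c p.
Proof.
case: t => l h r []; rewrite rev_iotaS /= => -> hh hr.
split=> //= -[|j] /=; first by congr c; lia.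
by rewrite hr; congr c; lia.
Qed.

(** The value of counter [i] is the head position on tape [i]: [Inc] and [Dec] move a head and never
    write. [Dec] stops at the mark, which makes it a truncated predecessor on marked tapes. *)
Inductive prog :=
| Inc of nat
| Dec of nat
| Out of bool
| Seq of prog & prog
| While of nat & prog
| IfEq of nat & sym & prog & prog.

Inductive act := AStay | AMove of nat & move | AOut of bool.

(** The program is its own finite control: a state is a place in the syntax tree, where [While] and
    [IfEq] add [None] for their test. *)
Fixpoint prog_state (p : prog) : finType :=
  match p with
  | Seq p q => (prog_state p + prog_state q)%type
  | While _ p => option (prog_state p)
  | IfEq _ _ p q => option (prog_state p + prog_state q)
  | _ => unit
  end.

Fixpoint prog_entry (p : prog) : prog_state p :=
  match p with
  | Seq p q => inl (prog_entry p)
  | While _ p => None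
  | IfEq _ _ p q => None
  | Inc _ => tt | Dec _ => tt | Out _ => tt
  end.

(* Next state, [None] being the exit, and action, as a function of the state
   and of the scanned symbols. *)
Fixpoint prog_trans (p : prog) :
    prog_state p -> (nat -> sym) -> option (prog_state p) * act :=
  match p return prog_state p -> (nat -> sym) -> option (prog_state p) * act with
  | Inc i => fun _ _ => (None, AMove i MoveR)
  | Dec i => fun _ s => (None, if s i == mark then AStay else AMove i MoveL)
  | Out b => fun _ _ => (None, AOut b)
  | Seq p q => fun x s =>
      match x with
      | inl x => let: (o, a) := prog_trans x s in
                 (Some (if o is Some x' then inl x' else inr (prog_entry q)), a)
      | inr y => let: (o, a) := prog_trans y s in (omap inr o, a)
      end
  | While i p => fun x s =>
      match x with
      | None => ((if s i == mark then None else Some (Some (prog_entry p))), AStay)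
      | Some x => let: (o, a) := prog_trans x s in (Some o, a)
      end
  | IfEq i v p q => fun x s =>
      match x with
      | None => (Some (Some (if s i == v then inl (prog_entry p)
                             else inr (prog_entry q))), AStay)
      | Some (inl x) => let: (o, a) := prog_trans x s in
                        (omap (fun x => Some (inl x)) o, a)
      | Some (inr y) => let: (o, a) := prog_trans y s in
                        (omap (fun y => Some (inr y)) o, a)
      end
  end.

Fixpoint width (p : prog) : nat :=
  match p with
  | Inc i => i.+1
  | Dec i => i.+1
  | Out _ => 0
  | Seq p q => maxn (width p) (width q)
  | While i p => maxn i.+1 (width p)
  | IfEq i _ p q => maxn i.+1 (maxn (width p) (width q))
  end.

Definition act_below (K : nat) (a : act) :=
  if a is AMove i _ then i < K else true.

Lemma act_below_trans K K' a : act_below K a -> K <= K' -> act_below K' a.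
Proof. by case: a => //= i _; apply: leq_trans. Qed.

Lemma prog_trans_below p x s : act_below (width p) (@prog_trans p x s).2.
Proof.
elim: p x => [i|i|b|p IHp q IHq|i p IHp|i v p IHp q IHq] //= x.
- by case: ifP => //=.
- case: x => x /=; [have := IHp x | have := IHq x];
    case: (prog_trans x s) => o a /= /act_below_trans; apply;
    by rewrite ?leq_maxl ?leq_maxr.
- case: x => [x|] //=; have := IHp x; case: (prog_trans x s) => o a /=.
  by move=> /act_below_trans; apply; rewrite leq_maxr.
- case: x => [[x|x]|] //=; [have := IHp x | have := IHq x];
    case: (prog_trans x s) => o a /= /act_below_trans; apply; lia.
Qed.

Lemma prog_trans_ext p x s s' : (forall i, i < width p -> s i = s' i) ->
  @prog_trans p x s = prog_trans x s'.
Proof.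
elim: p x => [i|i|b|p IHp q IHq|i p IHp|i v p IHp q IHq] //= x e.
- by rewrite e.
- case: x => x; rewrite ?IHp ?IHq // => j hj; apply: e; lia.
- by case: x => [x|]; [rewrite IHp // => j hj; apply: e; lia | rewrite e //; lia].
- case: x => [[x|x]|]; rewrite ?IHp ?IHq //; try by move=> j hj; apply: e; lia.
  by rewrite e //; lia.
Qed.

Notation store := ((nat -> nat) * seq bool)%type.

Definition upd (s : nat -> nat) (i v : nat) : nat -> nat :=
  fun j => if j == i then v else s j.

Definition act_store (a : act) (st : store) : store :=
  match a with
  | AStay => st
  | AMove i MoveL => (upd st.1 i (st.1 i).-1, st.2)
  | AMove i Stay => st
  | AMove i MoveR => (upd st.1 i (st.1 i).+1, st.2)
  | AOut b => (st.1, rcons st.2 b)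
  end.

(** A left move from position 0 would leave the cells described by [represents], so it is excluded
    along every execution. *)
Definition act_ok (a : act) (st : store) :=
  if a is AMove i MoveL then 0 < st.1 i else true.

Section Exec.
(* [C i] is the fixed contents of tape [i] on its nonnegative cells. *)
Variable C : nat -> nat -> sym.

Definition scan (st : store) : nat -> sym := fun i => C i (st.1 i).

Inductive exec_from (p : prog) : nat -> prog_state p -> store -> store -> Prop :=
| Exec_exit x st a : prog_trans x (scan st) = (None, a) -> act_ok a st ->
    exec_from 1 x st (act_store a st)
| Exec_step n x y st st' a : prog_trans x (scan st) = (Some y, a) ->
    act_ok a st -> exec_from n y (act_store a st) st' ->
    exec_from n.+1 x st st'.

Definition exec (p : prog) n st st' := exec_from n (prog_entry p) st st'.

Lemma exec_inc i s o : exec (Inc i) 1 (s, o) (upd s i (s i).+1, o).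
Proof. exact: (@Exec_exit (Inc i) tt (s, o) (AMove i MoveR)). Qed.

Lemma exec_dec i s o : C i (s i) != mark -> 0 < s i ->
  exec (Dec i) 1 (s, o) (upd s i (s i).-1, o).
Proof.
move=> h h0; apply: (@Exec_exit (Dec i) tt (s, o) (AMove i MoveL)) => //=.
by rewrite (negbTE h).
Qed.

Lemma exec_dec_mark i s o : C i (s i) = mark -> exec (Dec i) 1 (s, o) (s, o).
Proof.
by move=> h; apply: (@Exec_exit (Dec i) tt (s, o) AStay); rewrite //= /scan h eqxx.
Qed.

Lemma exec_out b s o : exec (Out b) 1 (s, o) (s, rcons o b).
Proof. exact: (@Exec_exit (Out b) tt (s, o) (AOut b)). Qed.

Lemma exec_seq p q n m st st1 st2 :
  exec p n st st1 -> exec q m st1 st2 -> exec (Seq p q) (n + m) st st2.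
Proof.
move=> hp hq; have {}hq : @exec_from (Seq p q) m (inr (prog_entry q)) st1 st2.
  rewrite /exec in hq; elim: hq => [x s a ht ok|k x y s s' a ht ok _ IH].
    by apply: Exec_exit => //=; rewrite ht.
  by apply: Exec_step IH => //=; rewrite ht.
suff H x : @exec_from p n x st st1 -> @exec_from (Seq p q) (n + m) (inl x) st st2.
  exact: H hp.
move=> {}hp; elim: hp hq => [{}x s a ht ok hq|k {}x y s s' a ht ok _ IH hq].
  by rewrite add1n; apply: Exec_step hq => //=; rewrite ht.
by rewrite addSn; apply: Exec_step (IH hq) => //=; rewrite ht.
Qed.

Lemma exec_while_end i p s o :
  C i (s i) = mark -> exec (While i p) 1 (s, o) (s, o).
Proof.
by move=> h; apply: (@Exec_exit (While i p) None (s, o) AStay); rewrite //= /scan h eqxx.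
Qed.

Lemma exec_while_step i p n m s o st1 st2 : C i (s i) != mark ->
  exec p n (s, o) st1 -> exec (While i p) m st1 st2 ->
  exec (While i p) (n + m).+1 (s, o) st2.
Proof.
move=> hi hp hw.
suff H x : @exec_from p n x (s, o) st1 ->
    @exec_from (While i p) (n + m) (Some x) (s, o) st2.
  apply: (@Exec_step (While i p) _ None (Some (prog_entry p)) _ _ AStay) => //=.
    by rewrite (negbTE hi).
  exact: H hp.
move: (s, o) => st {}hp; elim: hp hw => [{}x t a ht ok hq|k {}x y t t' a ht ok _ IH hq].
  by rewrite add1n; apply: Exec_step hq => //=; rewrite ht.
by rewrite addSn; apply: Exec_step (IH hq) => //=; rewrite ht.
Qed.

Lemma exec_ifeq i v p q n s o st :
  (if C i (s i) == v then exec p n (s, o) st else exec q n (s, o) st) ->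
  exec (IfEq i v p q) n.+1 (s, o) st.
Proof.
move=> h.
apply: (@Exec_step (IfEq i v p q) n None
  (Some (if C i (s i) == v then inl (prog_entry p) else inr (prog_entry q))) _ _ AStay) => //=.
case: ifP h => _ hp; rewrite /exec in hp;
  elim: hp => [{}x t a ht ok|k {}x y t t' a ht ok _ IH].
- by apply: Exec_exit => //=; rewrite ht.
- by apply: Exec_step IH => //=; rewrite ht.
- by apply: Exec_exit => //=; rewrite ht.
- by apply: Exec_step IH => //=; rewrite ht.
Qed.

End Exec.

(** Tapes 0 and 1 hold data already in cell 0, so they carry no origin mark and cannot be tested for
    zero. *)
Definition contents (w g : seq bool) (i : nat) : nat -> sym :=
  if i == 0 then nth None (word_symbols unit w)
  else if i == 1 then nth None (word_symbols unit g)
  else fun x => if x == 0 then mark else None.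

(** Tape 2 advances together with the input and the guess. When guessing ends it holds the input
    length in unary, which then drives the rewinding of the two unmarked tapes. *)
Definition start_pos (n : nat) : nat -> nat := fun i => if i <= 2 then n else 0.

(** * Machines that guess a word and then run a counter program *)

Section Machine.
Variables (p : prog) (al : pred bool) (ck : nat).

(** Tape [ntape] is the output; the 3 keeps it apart from tapes 0, 1 and 2, whatever [p] and [ck]
    are. *)
Definition ntape := maxn (width p) ck + 3.
(** The five control states: 0 writes the marks, 1 guesses, 2 tests counter [ck], 3 accepts, 4
    rejects. *)
Definition mstate := ('I_5 + prog_state p)%type.
Notation scanT := {ffun 'I_ntape.+1 -> sym}.
Notation actT := {ffun 'I_ntape.+1 -> sym * move}.

Definition ms (i : nat) : mstate := inl (inord i).

Definition stay_act (s : scanT) : actT := [ffun j => (s j, Stay)].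

Definition init_act (s : scanT) : actT :=
  [ffun j => if 1 < nat_of_ord j < ntape then (mark, Stay) else (s j, Stay)].

Definition guess_act (s : scanT) (b : bool) : actT :=
  [ffun j => if nat_of_ord j == 1 then (Some (inl b), MoveR)
             else if nat_of_ord j <= 2 then (s j, MoveR) else (s j, Stay)].

Definition prog_act (s : scanT) (a : act) : actT :=
  [ffun j => match a with
   | AStay => (s j, Stay)
   | AMove i m => if nat_of_ord j == i then (s j, m) else (s j, Stay)
   | AOut b => if nat_of_ord j == ntape then (Some (inl b), MoveR) else (s j, Stay)
   end].

(** Guessing stops at the first blank of the input, so the guess gets the length of the input. State
    1 is the only source of nondeterminism, and [al] limits the bits it may write. *)
Definition mdelta (q : mstate) (s : scanT) (q' : mstate) (a : actT) : bool :=
  match q with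
  | inl i =>
      match nat_of_ord i with
      | 0 => (q' == ms 1) && (a == init_act s)
      | 1 => if s ord0 == None
             then (q' == inr (prog_entry p)) && (a == stay_act s)
             else (q' == ms 1) && [exists b, al b && (a == guess_act s b)]
      | 2 => (q' == ms (if s (inord ck) == mark then 4 else 3)) && (a == stay_act s)
      | _ => false
      end
  | inr x => let: (o, e) := prog_trans x (fun i => s (inord i)) in
             (q' == if o is Some y then inr y else ms 2) && (a == prog_act s e)
  end.

Definition mach : tm := @TM ntape mstate unit (ms 0) (pred1 (ms 3)) mdelta.

Lemma val_ms i : i < 5 -> nat_of_ord (inord i : 'I_5) = i.
Proof. exact: inordK. Qed.

Definition crep (w g : seq bool) (c : config mach) (st : store) : Prop :=
  forall j : 'I_ntape.+1, represents (ctapes c j)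
    (if nat_of_ord j == ntape then nth None (word_symbols unit st.2) else contents w g j)
    (if nat_of_ord j == ntape then size st.2 else st.1 j).

Lemma crep_scan w g c st i : crep w g c st -> i < ntape ->
  scanned c (inord i) = scan (contents w g) st i.
Proof.
move=> h lt_i; have := h (inord i); rewrite ffunE /scan.
have -> : nat_of_ord (inord i : 'I_ntape.+1) = i by rewrite inordK //; lia.
by case: eqP => [e|_ [_ -> _]] //; exfalso; lia.
Qed.

Lemma nsteps_trans (M : tm) n m (c d e : config M) :
  nsteps n c d -> nsteps m d e -> nsteps (n + m) c e.
Proof.
elim: n c => [|n IHn] c /=; first by move=> ->.
by case=> x cx xd de; exists x => //; apply: IHn.
Qed.

Definition deterministic_at (M : tm) (q : tm_state M) : Prop :=
  forall s q1 a1 q2 a2,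
    @tm_delta M q s q1 a1 -> @tm_delta M q s q2 a2 -> q1 = q2 /\ a1 = a2.

Lemma step_unique (M : tm) (c d d' : config M) :
  deterministic_at (cstate c) -> step c d -> step c d' -> d = d'.
Proof.
case: c d d' => q t [q1 t1] [q2 t2] /= D [a1 /= h1 e1] [a2 /= h2 e2].
by have [-> e] := D _ _ _ _ _ h1 h2; rewrite e1 e2 e.
Qed.

Definition not_guess (q : mstate) := q != ms 1.

Lemma mdelta_det q : not_guess q -> deterministic_at (M := mach) q.
Proof.
move=> nq s q1 a1 q2 a2 /=; rewrite /mdelta; case: q nq => [i|x] /= nq.
  case: i nq => -[|[|[|i]]] //= hi nq.
  - by move=> /andP[/eqP-> /eqP->] /andP[/eqP-> /eqP->].
  - by case/eqP: nq; congr inl; apply: ord_inj; rewrite val_ms.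
  - by move=> /andP[/eqP-> /eqP->] /andP[/eqP-> /eqP->].
case: (prog_trans _ _) => o e.
by move=> /andP[/eqP-> /eqP->] /andP[/eqP-> /eqP->].
Qed.

Lemma step_not_guess (c d : config mach) :
  not_guess (cstate c) -> cstate c <> ms 0 -> step c d -> not_guess (cstate d).
Proof.
move=> nq n0 [a /=]; rewrite /mdelta; case: (cstate c) nq n0 => [[[|[|[|i]]] hi]|x] //= nq n0.
- by case: n0; congr inl; apply: ord_inj; rewrite val_ms.
- by case/eqP: nq; congr inl; apply: ord_inj; rewrite val_ms.
- move=> /andP[/eqP-> _] _; apply/eqP => -[] /(congr1 (@nat_of_ord _)).
  by case: ifP; rewrite !val_ms.
- case: (prog_trans _ _) => o e /andP[/eqP-> _] _.
  by case: o => [y|]; apply/eqP => // -[] /(congr1 (@nat_of_ord _)); rewrite !val_ms.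
Qed.

Lemma step_not_init (c d : config mach) : step c d -> cstate d <> ms 0.
Proof.
have ne k : 0 < k < 5 -> ms k <> ms 0 by case/andP=> ? ? [] /(congr1 (@nat_of_ord _)); rewrite !val_ms //; lia.
case=> a /= + _; rewrite /mdelta; case: (cstate c) => [[[|[|[|i]]] hi]|x] //=.
- by case/andP=> /eqP-> _; apply: ne.
- case: ifP => _ /andP[/eqP-> _] //; exact: ne.
- by case/andP=> /eqP-> _; case: ifP => _; apply: ne.
- by case: (prog_trans _ _) => -[y|] e /andP[/eqP-> _] //; apply: ne.
Qed.

(** Time bounds and rejection concern all runs. Past the guessing phase the machine is
    deterministic, so one halting run contains every other run as an initial part. *)
Lemma nsteps_unique n m (c f d : config mach) : not_guess (cstate c) ->
  cstate c <> ms 0 -> nsteps n c f -> halted f -> nsteps m c d ->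
  m <= n /\ (halted d -> d = f).
Proof.
move=> + + + hf; elim: n c m => [|n IHn] c [|m] //= ng n0.
- by move=> <- <-; split.
- by move=> e [x cx _]; case: (hf x); rewrite -e.
- by case=> x cx _ <-; split=> // hc; case: (hc x).
- case=> x cx xf [y cy yd]; have e : x = y by apply: step_unique cx cy; apply: mdelta_det.
  by subst y; have [] := IHn x m (step_not_guess ng n0 cx) (step_not_init cx) xf yd.
Qed.

Lemma crep_act w g c st a d : crep w g c st -> act_below ntape a -> act_ok a st ->
  ctapes d = [ffun j => tape_act (ctapes c j) (prog_act (scanned c) a j)] ->
  crep w g d (act_store a st).
Proof.
move=> h ab ok e j; rewrite e !ffunE; have {h} := h j.
have stay cc pp : represents (ctapes c j) cc pp ->
    represents (tape_act (ctapes c j) (thead (ctapes c j), Stay)) cc pp.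
  by move=> r; apply: (represents_stay r) => //; case: r.
case: a ab ok {e} => [|i m|b] /=.
- by move=> _ _ /stay.
- move=> lt_i ok; case: (eqVneq (nat_of_ord j) i) => [ji|nji]; last first.
    case: m ok => ok /stay //=; by rewrite /upd /= (negbTE nji).
  have -> : (nat_of_ord j == ntape) = false by apply/eqP; lia.
  rewrite -{}ji in ok *; case: m ok => ok h.
  + rewrite /= /upd eqxx; have := h; rewrite -{1}(prednK ok) => /represents_left.
    by rewrite (prednK ok); case: h => _ -> _.
  + exact: stay.
  + rewrite /= /upd eqxx; apply: (represents_right h) => //.
    by case: h.
- move=> _ _; case: eqP => [_|nj] h; last exact: stay.
  rewrite size_rcons; apply: (represents_right h) => [k nk|];
    rewrite /word_symbols map_rcons nth_rcons size_map; last by rewrite ltnn eqxx.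
  by case: ltngtP nk => // lt_k _; rewrite nth_default // size_map ltnW.
Qed.

Definition mk_next (c : config mach) (q : mstate) (a : actT) : config mach :=
  @Config mach q [ffun j => tape_act (ctapes c j) (a j)].

Lemma exec_nsteps w g n x st st' c : exec_from (contents w g) n x st st' ->
  crep w g c st -> cstate c = inr x ->
  exists d, [/\ nsteps n c d, crep w g d st' & cstate d = ms 2].
Proof.
have wK : width p <= ntape by rewrite /ntape; lia.
have tr (y : prog_state p) s (e : config mach) : crep w g e s ->
    prog_trans y (fun i => scanned e (inord i)) =
    prog_trans y (scan (contents w g) s).
  move=> r; apply: prog_trans_ext => i hi; by apply: crep_scan => //; apply: leq_trans hi wK.
move=> ex; elim: ex c => {n x st st'} [x st a ht ok|n x y st st' a ht ok _ IH] c r cx.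
  have ab := act_below_trans (prog_trans_below x (scan (contents w g) st)) wK.
  rewrite ht /= in ab.
  exists (mk_next c (ms 2) (prog_act (scanned c) a)); split=> //.
    exists (mk_next c (ms 2) (prog_act (scanned c) a)) => //.
    exists (prog_act (scanned c) a) => //=.
    by rewrite cx /= (tr _ st) // ht !eqxx.
  exact: (crep_act (d := mk_next c (ms 2) (prog_act (scanned c) a)) r ab ok).
have ab := act_below_trans (prog_trans_below x (scan (contents w g) st)) wK.
rewrite ht /= in ab.
have r' := crep_act (d := mk_next c (inr y) (prog_act (scanned c) a)) r ab ok (erefl _).
have [d [nd rd dd]] := IH _ r' (erefl _).
exists d; split=> //; exists (mk_next c (inr y) (prog_act (scanned c) a)) => //.
exists (prog_act (scanned c) a) => //=.
by rewrite cx /= (tr _ st) // ht !eqxx.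
Qed.

Lemma crep_stay w g c q st : crep w g c st ->
  crep w g (mk_next c q (stay_act (scanned c))) st.
Proof.
move=> h j; rewrite !ffunE; have r := h j.
by apply: (represents_stay r) => //; case: r.
Qed.

Definition final_state w g (st : store) : mstate :=
  ms (if contents w g ck (st.1 ck) == mark then 4 else 3).

Lemma halted_final (c : config mach) w g st : cstate c = final_state w g st -> halted c.
Proof.
move=> e d [a /=]; rewrite e /final_state /=.
by case: ifP => _; rewrite val_ms.
Qed.

Lemma exec_final w g n st st' c : exec (contents w g) p n st st' ->
  crep w g c st -> cstate c = inr (prog_entry p) ->
  exists d, [/\ nsteps n.+1 c d, crep w g d st' & cstate d = final_state w g st'].
Proof.
move=> ex r cx; have [d [nd rd dd]] := exec_nsteps ex r cx.
exists (mk_next d (final_state w g st') (stay_act (scanned d))); split=> //.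
  rewrite -addn1; apply: nsteps_trans nd _ => /=; eexists; last reflexivity.
  exists (stay_act (scanned d)) => //=; rewrite dd /mdelta /= val_ms //=.
  rewrite (crep_scan rd); last by rewrite /ntape; lia.
  by rewrite !eqxx.
exact: crep_stay.
Qed.

Definition guess_store (n : nat) : store := (start_pos n, [::]).

Lemma start_step w : exists2 c, step (init_config mach w) c &
  crep w [::] c (guess_store 0) /\ cstate c = ms 1.
Proof.
set c0 := init_config mach w.
exists (mk_next c0 (ms 1) (init_act (scanned c0))).
  by exists (init_act (scanned c0)) => //=; rewrite /mdelta /= val_ms //= !eqxx.
split=> // j; rewrite !ffunE /=.
have hn : 2 < ntape by rewrite /ntape; lia.
have r0 v : represents (input_tape unit v) (nth None (word_symbols unit v)) 0.
  by split=> //= k; rewrite ?nth_behead ?add0n // -nth0.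
have j0 : (j == ord0) = (nat_of_ord j == 0) by [].
rewrite j0; case: (eqVneq (nat_of_ord j) 0) => [e|nj0].
  rewrite e /= (_ : 0 == ntape = false); last by apply/eqP; lia.
  rewrite /contents /= /guess_store /= /start_pos /=.
  by apply: (represents_stay (r0 w)) => //; case: (r0 w).
case: (eqVneq (nat_of_ord j) ntape) => [e|njn].
  rewrite e ltnn andbF /=.
  by apply: (represents_stay (r0 [::])) => //; case: (r0 [::]).
case: (eqVneq (nat_of_ord j) 1) => [e|nj1].
  rewrite e /=.
  by apply: (represents_stay (r0 [::])) => //; case: (r0 [::]).
have -> : 1 < j < ntape by have := ltn_ord j; move: nj0 nj1 njn => /=; lia.
rewrite /contents (negbTE nj0) (negbTE nj1) /guess_store /= /start_pos if_same.
apply: (represents_stay (r0 [::])) => // k nk.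
by rewrite (negbTE nk) nth_nil.
Qed.

Lemma crep_guess w g b c :
  crep w g c (guess_store (size g)) -> size g < size w ->
  crep w (rcons g b) (mk_next c (ms 1) (guess_act (scanned c) b))
    (guess_store (size g).+1).
Proof.
move=> h lt_gw j; have := h j; rewrite !ffunE /=.
have hn : 2 < ntape by rewrite /ntape; lia.
case: (eqVneq (nat_of_ord j) ntape) => [e|njn].
  rewrite ifF; last by apply/eqP; lia.
  rewrite ifF; last by lia.
  by move=> r; apply: (represents_stay r) => //; case: r.
case: (eqVneq (nat_of_ord j) 1) => [e|nj1].
  rewrite e /= /contents /= /start_pos /= => r; apply: (represents_right r) => [k nk|];
    rewrite /word_symbols map_rcons nth_rcons size_map; last by rewrite ltnn eqxx.
  by case: ltngtP nk => // lt_k _; rewrite nth_default // size_map ltnW.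
have cE : contents w (rcons g b) j = contents w g j by rewrite /contents (negbTE nj1).
rewrite cE /start_pos; case: ifP => hj r.
  by apply: (represents_right r) => //; case: r.
by apply: (represents_stay r) => //; case: r.
Qed.

Lemma guess_scan w g c : crep w g c (guess_store (size g)) ->
  size g <= size w -> (scanned c ord0 == None) = (size g == size w).
Proof.
move=> h le_gw; have -> : ord0 = inord 0 :> 'I_ntape.+1.
  by apply: ord_inj; rewrite inordK.
rewrite (crep_scan h); last by rewrite /ntape; lia.
rewrite /scan /contents /= /start_pos /=.
case: (ltngtP (size g) (size w)) le_gw => // [lt_gw|->] _.
  by rewrite (nth_map false).
by rewrite nth_default ?size_map.
Qed.

Lemma guess_run w g1 g2 c : crep w g1 c (guess_store (size g1)) ->
  cstate c = ms 1 -> size (g1 ++ g2) = size w -> all al g2 ->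
  exists d, [/\ nsteps (size g2) c d, crep w (g1 ++ g2) d (guess_store (size w))
              & cstate d = ms 1].
Proof.
elim: g2 g1 c => [|b g2 IH] g1 c r cx sz /=.
  by move=> _; exists c; split=> //; move: r sz; rewrite cats0 => r <-.
case/andP=> ab ag; rewrite size_cat /= in sz.
have lt_gw : size g1 < size w by lia.
have r' := crep_guess b r lt_gw.
have [||||d [nd rd dd]] := IH (rcons g1 b) (mk_next c (ms 1) (guess_act (scanned c) b)) => //.
- by rewrite size_rcons.
- by rewrite size_cat size_rcons; lia.
exists d; split=> //; last by rewrite -cat_rcons.
eexists; last exact: nd.
exists (guess_act (scanned c) b) => //=.
rewrite cx /mdelta /= val_ms // (guess_scan r (ltnW lt_gw)) ltn_eqF // eqxx /=.
by apply/existsP; exists b; rewrite ab eqxx.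
Qed.

Lemma mach_run w g n st' : size g = size w -> all al g ->
  exec (contents w g) p n (guess_store (size w)) st' ->
  exists c, [/\ nsteps (size w + n + 3) (init_config mach w) c,
    crep w g c st' & cstate c = final_state w g st'].
Proof.
move=> sg ag ex; have [c0 s0 [r0 q0]] := start_step w.
have [//|//|c1 [n1 r1 q1]] := @guess_run w [::] g c0 r0 q0.
set c2 := mk_next c1 (inr (prog_entry p)) (stay_act (scanned c1)).
have r2 : crep w g c2 (guess_store (size w)) by apply: crep_stay.
have [c3 [n3 r3 q3]] := exec_final ex r2 (erefl _).
exists c3; split=> //.
have -> : size w + n + 3 = 1 + (size g + (1 + n.+1)) by lia.
apply: (nsteps_trans (d := c0)); first by exists c0.
apply: nsteps_trans n1 _; apply: (nsteps_trans (d := c2)) => //.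
exists c2 => //; exists (stay_act (scanned c1)) => //=.
by rewrite q1 /mdelta /= val_ms // -sg in r1 *; rewrite (guess_scan r1) ?sg // eqxx !eqxx.
Qed.

(** Converse of [guess_run]: a run is either still guessing or has fixed a full-length word [g], and
    its remainder is then a run of the program on [g]. *)
Lemma guess_sound w g1 c m d : crep w g1 c (guess_store (size g1)) ->
  all al g1 -> size g1 <= size w -> cstate c = ms 1 -> nsteps m c d ->
  (m <= size w - size g1 /\ cstate d = ms 1) \/
  exists g c', [/\ size g = size w, all al g, crep w g c' (guess_store (size w)),
    cstate c' = inr (prog_entry p)
    & exists2 k, nsteps k c' d & m <= (size w - size g1).+1 + k].
Proof.
elim: m g1 c => [|m IH] g1 c r ag sz cx /=; first by move=> <-; left.
case=> e [a /= +] ee ed; rewrite cx /mdelta /= val_ms // (guess_scan r sz).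
case: eqP => [e_gw|ne_gw] /andP[/eqP qe].
  move=> /eqP ea; right; exists g1, e; split=> //; last by exists m => //; lia.
  have -> : e = mk_next c (inr (prog_entry p)) (stay_act (scanned c)).
    by case: e qe ee {ed} => q t /= -> ->; rewrite /mk_next ea.
  by rewrite -e_gw; apply: crep_stay.
case/existsP=> b /andP[ab /eqP ea].
have lt_gw : size g1 < size w by lia.
have E : e = mk_next c (ms 1) (guess_act (scanned c) b).
  by case: e qe ee {ed} => q t /= -> ->; rewrite /mk_next ea.
have [|||[le_m qd]|[g [c' [sg alg rc qc [k nk le_m]]]]] // := IH (rcons g1 b) e _ _ _ qe ed.
- by rewrite E size_rcons; apply: crep_guess.
- by rewrite all_rcons ab.
- by rewrite size_rcons.
- by left; split=> //; rewrite size_rcons in le_m; lia.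
- right; exists g, c'; split=> //; exists k => //.
  by rewrite size_rcons in le_m; lia.
Qed.

Lemma mach_sound w m d : nsteps m (init_config mach w) d ->
  (m <= (size w).+1 /\ ~~ tm_accept (cstate d)) \/
  exists2 g, size g = size w /\ all al g &
    forall n st', exec (contents w g) p n (guess_store (size w)) st' ->
    m <= size w + n + 3 /\ (halted d -> cstate d = final_state w g st').
Proof.
have nacc k : k < 5 -> k != 3 -> ms k != ms 3.
  by move=> h h'; apply/eqP => -[] /(congr1 (@nat_of_ord _)); rewrite !val_ms //; apply/eqP.
case: m => [|m] /=; first by move=> <-; left; split=> //=; apply: nacc.
case=> e s0 ed.
have [c0 s1 [r0 q0]] := start_step w.
have {s0 s1} e0 : e = c0.
  by apply: step_unique s0 s1; apply: mdelta_det; apply/eqP => -[] /(congr1 (@nat_of_ord _)); rewrite !val_ms.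
rewrite e0 in ed.
have [[le_m qd]|[g [c' [sg alg rc qc [k nk le_m]]]]] := guess_sound r0 isT (leq0n _) q0 ed.
  by left; rewrite qd; split; [rewrite subn0 in le_m | apply: nacc].
right; exists g => // n st' ex.
have [f [nf rf qf]] := exec_final ex rc qc.
have ng : not_guess (cstate c') by rewrite qc.
have n0 : cstate c' <> ms 0 by rewrite qc.
have [le_k un] := nsteps_unique ng n0 nf (halted_final qf) nk.
by rewrite subn0 in le_m; split=> [|/un ->//]; lia.
Qed.

Lemma crep_output w g c st : crep w g c st ->
  tape_contains (ctapes c ord_max) st.2.
Proof.
move=> /(_ ord_max) /=; rewrite eqxx => -[hl hh hr].
(* The head stands on the blank after the output, so this cell and all of [tright] are the trailing
   blanks. *)
exists 0, (size (tright (ctapes c ord_max))).+1 => /=.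
rewrite hl hh -map_rev revK nth_default ?size_map //.
congr (_ ++ _); first last.
  congr cons; apply: (@eq_from_nth _ None); rewrite ?size_nseq // => i lt_i.
  by rewrite hr nth_nseq lt_i nth_default // size_map; lia.
apply: (@eq_from_nth _ None); rewrite ?size_map ?size_iota // => i lt_i.
by rewrite (nth_map 0) ?size_iota // nth_iota.
Qed.

Lemma mach_deterministic : (forall b b', al b -> al b' -> b = b') ->
  deterministic mach.
Proof.
move=> hal q; case: (eqVneq q (ms 1)) => [->|/mdelta_det//].
move=> s q1 a1 q2 a2 /=; rewrite /mdelta /= val_ms //.
case: ifP => _ /andP[/eqP-> h1] /andP[/eqP-> h2]; first by rewrite (eqP h1) (eqP h2).
have [b1 /andP[B1 /eqP->]] := existsP h1; have [b2 /andP[B2 /eqP->]] := existsP h2.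
by rewrite (hal _ _ B1 B2).
Qed.

End Machine.

(** * Primitive counter programs *)

(** The base is at least 2, so raising the exponent by one absorbs a factor 2; a single exponent
    then suffices for sums, products and compositions. *)
Definition poly_bounded (f : nat -> nat) := exists c, forall n, f n <= (n + 2) ^ c.

Lemma poly_bounded_const k : poly_bounded (fun=> k).
Proof. by exists k => n; case: k => // k; apply: leq_trans (ltnW (ltn_expl k.+1 (isT : 1 < 2))) _; rewrite leq_exp2r //; lia. Qed.

Lemma poly_bounded_id : poly_bounded id.
Proof. by exists 1 => n; lia. Qed.

Lemma poly_bounded_add f h :
  poly_bounded f -> poly_bounded h -> poly_bounded (fun n => f n + h n).
Proof.
move=> [a ha] [b hb]; exists (maxn a b).+1 => n.
have ea : (n + 2) ^ a <= (n + 2) ^ maxn a b by rewrite leq_exp2l ?leq_maxl //; lia.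
have eb : (n + 2) ^ b <= (n + 2) ^ maxn a b by rewrite leq_exp2l ?leq_maxr //; lia.
have := ha n; have := hb n; rewrite expnS; nia.
Qed.

Lemma poly_bounded_mul f h :
  poly_bounded f -> poly_bounded h -> poly_bounded (fun n => f n * h n).
Proof. by move=> [a ha] [b hb]; exists (a + b) => n; rewrite expnD leq_mul. Qed.

Lemma poly_bounded_comp f h :
  poly_bounded f -> poly_bounded h -> poly_bounded (fun n => f (h n)).
Proof.
move=> [a ha] [b hb]; exists (b.+2 * a) => n; apply: leq_trans (ha _) _.
rewrite expnM; case: a {ha} => // a; rewrite leq_exp2r //.
have := hb n; rewrite !expnS; have : 0 < (n + 2) ^ b by rewrite expn_gt0; lia.
nia.
Qed.

Ltac poly_bound := repeat first
  [ assumption | exact: poly_bounded_id | exact: poly_bounded_const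
  | apply: poly_bounded_add | apply: poly_bounded_mul
  | match goal with H : poly_bounded ?f |- poly_bounded (fun n => ?f _) =>
      apply: (poly_bounded_comp H) end ].

Lemma poly_bounded_poly f : poly_bounded f ->
  exists p : {poly nat}, forall n, f n <= p.[n]%R.
Proof.
case=> c hc; exists (('X + 2%:P) ^+ c)%R => n; apply: leq_trans (hc n) _.
by rewrite horner_exp hornerD hornerX hornerC natrXE natrDE.
Qed.

(** A loop is described by its stores [S k] after [k] rounds; only the loop counter is tied to [k],
    so the body may change everything else. *)
Lemma exec_loop C i p (S : nat -> store) n B :
  (forall x, (C i x == mark) = (x == 0)) ->
  (forall k, k <= n -> (S k).1 i = n - k) ->
  (forall k, k < n -> exists2 t, t <= B & exec C p t (S k) (S k.+1)) ->
  exists2 t, t <= n * B.+1 + 1 & exec C (While i p) t (S 0) (S n).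
Proof.
move=> hC hi hp.
suff H m : forall k, k + m = n ->
    exists2 t, t <= m * B.+1 + 1 & exec C (While i p) t (S k) (S n) by exact: (H n).
elim: m => [|m IH] k; rewrite ?addn0.
  move=> ->; exists 1 => //; have := hi n (leqnn n); case: (S n) => s o /= e.
  by apply: exec_while_end; apply/eqP; rewrite hC e subnn.
move=> e; have lt_kn : k < n by lia.
have [t1 le1 ex1] := hp k lt_kn; have [|t2 le2 ex2] := IH k.+1; first by lia.
exists (t1 + t2).+1; first by nia.
have := hi k (ltnW lt_kn); case: (S k) ex1 => s o ex1 /= es.
by apply: exec_while_step ex1 ex2; rewrite hC es; lia.
Qed.

Lemma contents_mark w g i x : 1 < i -> (contents w g i x == mark) = (x == 0).
Proof. by case: i => [|[|i]] //= _; rewrite /contents /=; case: (x == 0). Qed.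

Lemma contents_data w g (b : bool) x : contents w g b x != mark.
Proof.
have H v : nth None (word_symbols unit v) x != mark.
  by elim: v x => [|c v IH] [|x] //=; apply: IH.
by case: b; apply: H.
Qed.

Lemma exec_eq C p n st st1 st2 : exec C p n st st1 -> st1 = st2 -> exec C p n st st2.
Proof. by move=> ? <-. Qed.

Ltac upd_eq :=
  (lazymatch goal with |- (_, _) = _ => congr (_, _) | _ => idtac end);
  apply: functional_extensionality => j; rewrite /upd /=;
  repeat match goal with |- context [?a == ?b] => case: (@eqP _ a b) => ? end;
  subst; try lia.

Ltac upd_simp := rewrite /upd /=;
  repeat match goal with |- context [?a == ?b] => case: (@eqP _ a b) => ? end;
  try lia.

Section Primitives.
Variables w g : seq bool.
Notation C := (contents w g).

Definition move_to i d := While i (Seq (Dec i) (Inc d)).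

Lemma exec_dec_counter i s o : 1 < i -> 0 < s i ->
  exec C (Dec i) 1 (s, o) (upd s i (s i).-1, o).
Proof. by move=> hi h; apply: exec_dec => //; rewrite contents_mark //; lia. Qed.

Lemma exec_move_to i d s o : 1 < i -> i <> d ->
  exists2 t, t <= s i * 3 + 1 &
    exec C (move_to i d) t (s, o) (upd (upd s i 0) d (s d + s i), o).
Proof.
move=> hi hd.
have [||k lt_k|t le_t ex] := @exec_loop C i (Seq (Dec i) (Inc d))
  (fun k => (upd (upd s i (s i - k)) d (s d + k), o)) (s i) 2.
- by move=> x; apply: contents_mark.
- by move=> k _; upd_simp.
- exists 2 => //; apply: (exec_eq (exec_seq (exec_dec_counter _ hi _) (exec_inc _ _ _ _))).
    by upd_simp.
  by upd_eq.
exists t => //; move: ex; rewrite subnn addn0 subn0.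
by have -> : upd (upd s i (s i)) d (s d) = s by upd_eq.
Qed.

Definition copy v t d := Seq (While v (Seq (Dec v) (Seq (Inc d) (Inc t)))) (move_to t v).

Lemma exec_copy v t d s o : 1 < v < d -> d < t -> s d = 0 -> s t = 0 ->
  exists2 n, n <= s v * 7 + 2 & exec C (copy v t d) n (s, o) (upd s d (s v), o).
Proof.
move=> /andP[hv hd] ht sd st.
have [||k lt_k|t1 le1 ex1] := @exec_loop C v (Seq (Dec v) (Seq (Inc d) (Inc t)))
  (fun k => (upd (upd (upd s v (s v - k)) d k) t k, o)) (s v) 3.
- by move=> x; apply: contents_mark.
- by move=> k _; upd_simp.
- exists 3 => //; apply: (exec_eq (exec_seq (exec_dec_counter _ hv _)
    (exec_seq (exec_inc _ _ _ _) (exec_inc _ _ _ _)))); first by upd_simp.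
  by upd_eq.
have e0 : upd (upd (upd s v (s v - 0)) d 0) t 0 = s by upd_eq.
rewrite {}e0 subnn in ex1.
have [||t2 le2 ex2] := @exec_move_to t v (upd (upd (upd s v 0) d (s v)) t (s v)) o; [lia|lia|].
exists (t1 + t2); first by move: le2; upd_simp; lia.
by apply: exec_eq (exec_seq ex1 ex2) _; upd_eq.
Qed.

Definition clear i := While i (Dec i).

Lemma exec_clear i s o : 1 < i ->
  exists2 n, n <= s i * 2 + 1 & exec C (clear i) n (s, o) (upd s i 0, o).
Proof.
move=> hi.
have [||k lt_k|t le_t ex] := @exec_loop C i (Dec i) (fun k => (upd s i (s i - k), o)) (s i) 1.
- by move=> x; apply: contents_mark.
- by move=> k _; upd_simp.
- exists 1 => //; apply: (exec_eq (exec_dec_counter _ hi _)); first by upd_simp.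
  by upd_eq.
exists t => //; move: ex; rewrite subnn subn0.
by have -> : upd s i (s i) = s by upd_eq.
Qed.

Definition sub_from i d := While i (Seq (Dec i) (Dec d)).

Lemma exec_sub_from i d s o : 1 < i -> 1 < d -> i <> d ->
  exists2 t, t <= s i * 3 + 1 &
    exec C (sub_from i d) t (s, o) (upd (upd s i 0) d (s d - s i), o).
Proof.
move=> hi hd nid.
have [||k lt_k|t le_t ex] := @exec_loop C i (Seq (Dec i) (Dec d))
  (fun k => (upd (upd s i (s i - k)) d (s d - k), o)) (s i) 2.
- by move=> x; apply: contents_mark.
- by move=> k _; upd_simp.
- exists 2 => //; case: (posnP (s d - k)) => sd.
    apply: (exec_eq (exec_seq (exec_dec_counter _ hi _) (exec_dec_mark _ _))).
    + by upd_simp.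
    + by apply/eqP; rewrite contents_mark //; apply/eqP; upd_simp.
    by upd_eq.
  apply: (exec_eq (exec_seq (exec_dec_counter _ hi _) (exec_dec_counter _ hd _))).
  + by upd_simp.
  + by upd_simp.
  by upd_eq.
exists t => //; move: ex; rewrite subnn !subn0.
by have -> : upd (upd s i (s i)) d (s d) = s by upd_eq.
Qed.

(** Tape 3 keeps the input length for [ESize], and tape 2 is left at zero. *)
Definition prelude := While 2 (Seq (Dec 0) (Seq (Dec 1) (Seq (Dec 2) (Inc 3)))).

Definition clean_pos : nat -> nat := fun i => if i == 3 then size w else 0.

Lemma exec_prelude : exists2 t, t <= size w * 5 + 1 &
  exec C prelude t (guess_store (size w)) (clean_pos, [::]).
Proof.
have hd (b : bool) (s : nat -> nat) o : 0 < s b -> exec C (Dec b) 1 (s, o) (upd s b (s b).-1, o).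
  by move=> h; apply: exec_dec => //; apply: contents_data.
have [||k lt_k|t le_t ex] := @exec_loop C 2 (Seq (Dec 0) (Seq (Dec 1) (Seq (Dec 2) (Inc 3))))
  (fun k => (fun i => if i <= 2 then size w - k else if i == 3 then k else 0, [::])) (size w) 4.
- by move=> x; apply: contents_mark.
- by [].
- exists 4 => //; apply: (exec_eq (exec_seq (hd false _ _ _) (exec_seq (hd true _ _ _)
    (exec_seq (@exec_dec_counter 2 _ _ _ _) (exec_inc _ _ _ _))))) => //=; rewrite ?subn_gt0 //.
  f_equal; apply: functional_extensionality => -[|[|[|[|j]]]] //; rewrite /upd /=; lia.
exists t => //; apply: (exec_eq (st1 := (fun i : nat => if i <= 2 then size w - size w
    else if i == 3 then size w else 0, [::]))).
  suff <- : (fun i : nat => if i <= 2 then size w - 0 else if i == 3 then 0 else 0, [::]) =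
    guess_store (size w) by [].
  by congr (_, _); apply: functional_extensionality => i; rewrite /start_pos /= subn0 if_same.
by congr (_, _); apply: functional_extensionality => -[|[|[|[|j]]]] //=; rewrite /clean_pos /= subnn.
Qed.

End Primitives.

(** * Compilation of arithmetic expressions *)

Definition scons (x : nat) (f : nat -> nat) : nat -> nat :=
  fun k => if k is k'.+1 then f k' else x.

(** Bounded sums are the only iteration, so values stay polynomial in the input length and the
    variables. Products, quotients, bounded quantifiers and table lookup are nevertheless
    expressible. *)
Inductive expr :=
| EVar of nat
| EOne
| ESize
| EAdd of expr & expr
| ESub of expr & expr
| ESum of expr & expr
| ERead of bool & expr.

(* Variables are de Bruijn indices; [ESum a b] binds one variable in [b]. *)
Fixpoint eval (w g : seq bool) (env : nat -> nat) (e : expr) : nat :=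
  match e with
  | EVar k => env k
  | EOne => 1
  | ESize => size w
  | EAdd a b => eval w g env a + eval w g env b
  | ESub a b => eval w g env a - eval w g env b
  | ESum a b => \sum_(0 <= x < eval w g env a) eval w g (scons x env) b
  | ERead b a => nth false (if b then g else w) (eval w g env a)
  end.

(* [sg] maps variables to tapes; the value is left on tape [d], and the tapes
   above [d] are scratch. *)
Fixpoint compile (sg : nat -> nat) (d : nat) (e : expr) : prog :=
  match e with
  | EVar k => copy (sg k) d.+1 d
  | EOne => Inc d
  | ESize => copy 3 d.+1 d
  | EAdd a b => Seq (compile sg d a) (Seq (compile sg d.+1 b) (move_to d.+1 d))
  | ESub a b => Seq (compile sg d a) (Seq (compile sg d.+1 b) (sub_from d.+1 d))
  | ESum a b =>
      Seq (compile sg d.+1 a)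
     (Seq (While d.+1 (Seq (Dec d.+1) (Seq (compile (scons d.+2 sg) d.+3 b)
                      (Seq (move_to d.+3 d) (Inc d.+2)))))
          (clear d.+2))
  | ERead b a =>
      Seq (compile sg d.+1 a)
     (Seq (While d.+1 (Seq (Dec d.+1) (Seq (Inc d.+2) (Inc b))))
     (Seq (IfEq b (Some (inl true)) (Inc d) (Dec d.+1))
          (While d.+2 (Seq (Dec d.+2) (Dec b)))))
  end.

Definition ready (w : seq bool) (sg : nat -> nat) (d : nat) (s : nat -> nat) :=
  [/\ forall i, 1 < sg i < d, 3 < d, forall i, d <= i -> s i = 0,
      s 0 = 0 /\ s 1 = 0 & s 3 = size w].

(** One number [M] bounds the input length and all variables. Under [ESum a b] the index ranges
    below the value of [a], so [b] is used with [M] enlarged by the bound on [a]; for this reason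
    [V] is tracked along with [T]. *)
Definition compile_spec (e : expr) (T V : nat -> nat) :=
  forall w g M s o sg d, ready w sg d s -> size w <= M ->
  (forall i, s (sg i) <= M) ->
  eval w g (fun i => s (sg i)) e <= V M /\
  exists2 n, n <= T M & exec (contents w g) (compile sg d e) n (s, o)
                             (upd s d (eval w g (fun i => s (sg i)) e), o).

Lemma ready_upd w sg d s x : ready w sg d s -> ready w sg d.+1 (upd s d x).
Proof.
case=> h1 h2 h3 [h4 h5] h6; split; rewrite /upd //.
- by move=> i; have := h1 i; lia.
- by lia.
- by move=> i hi; rewrite ifF; [apply: h3; lia | lia].
- by rewrite !ifF //; lia.
- by rewrite ifF //; lia.
Qed.

Lemma upd_env (sg : nat -> nat) d d' s x : (forall i, 1 < sg i < d) -> d <= d' ->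
  (fun i => upd s d' x (sg i)) = (fun i => s (sg i)).
Proof.
move=> hsg dd; apply: functional_extensionality => i; rewrite /upd ifF //.
by have := hsg i; lia.
Qed.

Lemma sum_le (f : nat -> nat) c n : (forall x, x < n -> f x <= c) ->
  \sum_(0 <= x < n) f x <= n * c.
Proof.
elim: n => [|n IH] h; first by rewrite big_geq.
rewrite big_nat_recr //= mulSnr leq_add ?h //.
by apply: IH => x hx; apply: h; lia.
Qed.

Lemma contents_read w g (b : bool) x :
  (contents w g b x == Some (inl true)) = nth false (if b then g else w) x.
Proof.
have H v : (nth None (word_symbols unit v) x == Some (inl true)) = nth false v x.
  by elim: v x => [|c v IH] [|x] //=; case: c.
by case: b; apply: H.
Qed.

Lemma compile_spec_binop (e1 e2 : expr) (T1 V1 T2 V2 : nat -> nat) P (op : nat -> nat -> nat) :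
  compile_spec e1 T1 V1 -> compile_spec e2 T2 V2 ->
  (forall w g d s o, 1 < d -> exists2 t, t <= s d.+1 * 3 + 1 &
     exec (contents w g) (P d) t (s, o) (upd (upd s d.+1 0) d (op (s d) (s d.+1)), o)) ->
  forall w g M s o sg d, ready w sg d s -> size w <= M -> (forall i, s (sg i) <= M) ->
  exists2 n, n <= T1 M + (T2 M + (V2 M * 3 + 1)) &
    exec (contents w g) (Seq (compile sg d e1) (Seq (compile sg d.+1 e2) (P d))) n (s, o)
      (upd s d (op (eval w g (fun i => s (sg i)) e1) (eval w g (fun i => s (sg i)) e2)), o).
Proof.
move=> H1 H2 HP w g M s o sg d rd le_w le_s; have [hsg h3 h0 _ _] := rd.
have [v1 [n1 le1 ex1]] := H1 w g M s o sg d rd le_w le_s.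
set x1 := eval w g _ e1 in v1 ex1 *.
have [|v2 [n2 le2 ex2]] := H2 w g M (upd s d x1) o sg d.+1 (ready_upd _ rd) le_w.
  by move=> i; rewrite /upd; case: eqP => // e; have := hsg i; lia.
rewrite (upd_env _ _ hsg) // in v2 ex2; set x2 := eval w g _ e2 in v2 ex2 *.
have [|t let_ ext] := HP w g d (upd (upd s d x1) d.+1 x2) o; first by lia.
exists (n1 + (n2 + t)); first by move: let_; upd_simp; lia.
apply: exec_eq (exec_seq ex1 (exec_seq ex2 ext)) _.
have ? := h0 d.+1 (leqnSn d); by upd_eq.
Qed.

Lemma compileP e : exists T V, [/\ poly_bounded T, poly_bounded V & compile_spec e T V].
Proof.
have copy_spec w g M s o sg d v : ready w sg d s -> 1 < v < d -> s v <= M ->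
    exists2 n, n <= M * 7 + 2 & exec (contents w g) (copy v d.+1 d) n (s, o) (upd s d (s v), o).
  case=> _ _ h0 _ _ hv le_v; have [||||n le_n ex] // := @exec_copy w g v d.+1 d s o.
  - by apply: h0.
  - by apply: h0.
  by exists n => //; lia.
elim: e => [k|||a [Ta [Va [pTa pVa IHa]]] b [Tb [Vb [pTb pVb IHb]]]
               |a [Ta [Va [pTa pVa IHa]]] b [Tb [Vb [pTb pVb IHb]]]
               |a [Ta [Va [pTa pVa IHa]]] b [Tb [Vb [pTb pVb IHb]]]
               |b a [Ta [Va [pTa pVa IHa]]]].
- exists (fun M => M * 7 + 2), id; split; [by poly_bound | by poly_bound |].
  move=> w g M s o sg d rd le_w le_s /=; split=> //.
  by apply: copy_spec; [exact: rd | case: rd | ].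
- exists (fun=> 1), (fun=> 1); split; [by poly_bound | by poly_bound |].
  move=> w g M s o sg d [_ _ h0 _ _] le_w le_s /=; split=> //.
  by exists 1 => //; apply: exec_eq (exec_inc _ _ _ _) _; rewrite h0.
- exists (fun M => M * 7 + 2), id; split; [by poly_bound | by poly_bound |].
  move=> w g M s o sg d rd le_w le_s /=; split=> //.
  have [_ h3 _ _ <-] := rd; apply: copy_spec; [exact: rd | lia | ].
  by case: rd => _ _ _ _ ->.
- exists (fun M => Ta M + (Tb M + (Vb M * 3 + 1))), (fun M => Va M + Vb M).
  split; [by poly_bound | by poly_bound |].
  move=> w g M s o sg d rd le_w le_s /=; split.
    by apply: leq_add; [have [] := IHa w g M s o sg d | have [] := IHb w g M s o sg d].
  apply: (compile_spec_binop (op := addn) (P := fun d => move_to d.+1 d) IHa IHb) => //.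
  by move=> w0 g0 d0 s0 o0 hd; apply: (@exec_move_to w0 g0 d0.+1 d0 s0 o0); lia.
- exists (fun M => Ta M + (Tb M + (Vb M * 3 + 1))), Va.
  split; [by poly_bound | by poly_bound |].
  move=> w g M s o sg d rd le_w le_s /=; split.
    by apply: leq_trans (leq_subr _ _) _; have [] := IHa w g M s o sg d.
  apply: (compile_spec_binop (op := subn) (P := fun d => sub_from d.+1 d) IHa IHb) => //.
  by move=> w0 g0 d0 s0 o0 hd; apply: (@exec_sub_from w0 g0 d0.+1 d0 s0 o0); lia.
- exists (fun M => Ta M + (Va M * ((1 + (Tb (M + Va M) + ((Vb (M + Va M) * 3 + 1) + 1))) + 1) + 1
      + (Va M * 2 + 1))), (fun M => Va M * Vb (M + Va M)).
  split; [by poly_bound | by poly_bound |].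
  move=> w g M s o sg d rd le_w le_s /=; have [hsg h3 h0 h1 h4] := rd.
  have rd1 : ready w sg d.+1 s.
    by split=> // [i||i hi]; [have := hsg i; lia | lia | apply: h0; lia].
  have [va [n1 le1 ex1]] := IHa w g M s o sg d.+1 rd1 le_w le_s.
  set n := eval w g _ a in va ex1 *.
  set f := fun x => eval w g (scons x (fun i => s (sg i))) b.
  have env k y z : (fun i => upd (upd (upd s d.+1 y) d.+2 k) d z (scons d.+2 sg i)) =
      scons k (fun i => s (sg i)).
    apply: functional_extensionality => -[|i] /=; first by upd_simp.
    by have := hsg i; upd_simp.
  pose S k : store := (upd (upd (upd s d.+1 (n - k)) d.+2 k) d (\sum_(0 <= x < k) f x), o).
  have body k : k < n -> f k <= Vb (M + Va M) /\ exists2 t,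
     t <= 1 + (Tb (M + Va M) + ((Vb (M + Va M) * 3 + 1) + 1)) &
     exec (contents w g) (Seq (Dec d.+1) (Seq (compile (scons d.+2 sg) d.+3 b)
                      (Seq (move_to d.+3 d) (Inc d.+2)))) t (S k) (S k.+1).
    move=> lt_k; rewrite /S; set G := \sum_(0 <= x < k) f x.
    have -> : \sum_(0 <= x < k.+1) f x = G + f k by rewrite big_nat_recr.
    pose s2 := upd (upd (upd s d.+1 (n - k.+1)) d.+2 k) d G.
    have rd2 : ready w (scons d.+2 sg) d.+3 s2.
      rewrite /s2; split.
      - by case=> [|i] /=; [lia | have := hsg i; lia].
      - by lia.
      - by move=> i hi; have ? := h0 i ltac:(lia); upd_simp.
      - by case: h1 => ? ?; split; upd_simp.
      - by upd_simp.
    have bd2 i : s2 (scons d.+2 sg i) <= M + Va M.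
      have := congr1 (fun h => h i) (env k (n - k.+1) G); rewrite -/s2 => ->.
      by case: i => [|i] /=; [lia | have := le_s i; lia].
    have le_w2 : size w <= M + Va M by lia.
    have [vb [n2 le2 ex2]] := IHb w g (M + Va M) s2 o (scons d.+2 sg) d.+3 rd2 le_w2 bd2.
    rewrite (env k (n - k.+1) G) -/(f k) in vb ex2.
    split=> //.
    have [||n3 le3 ex3] := @exec_move_to w g d.+3 d (upd s2 d.+3 (f k)) o; [lia | lia |].
    exists (1 + (n2 + (n3 + 1))).
      by move: le3; rewrite /s2; upd_simp.
    have ex0 : exec (contents w g) (Dec d.+1) 1
        (upd (upd (upd s d.+1 (n - k)) d.+2 k) d G, o) (s2, o).
      apply: (exec_eq (@exec_dec_counter w g d.+1 _ o _ _)) ; [by lia | by upd_simp |].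
      by rewrite /s2; upd_eq.
    apply: (exec_eq (exec_seq ex0 (exec_seq ex2 (exec_seq ex3 (exec_inc _ _ _ _))))).
    by have ? := h0 d.+3 ltac:(lia); rewrite /s2; upd_eq.
  split.
    apply: leq_trans (sum_le (c := Vb (M + Va M)) _) _; last by rewrite leq_mul2r va orbT.
    by move=> x lt_x; case: (body x lt_x).
  have [||k lt_k|t2 le2 ex2] := @exec_loop (contents w g) d.+1 (Seq (Dec d.+1)
    (Seq (compile (scons d.+2 sg) d.+3 b) (Seq (move_to d.+3 d) (Inc d.+2)))) S n
    (1 + (Tb (M + Va M) + ((Vb (M + Va M) * 3 + 1) + 1))).
  - by move=> x; apply: contents_mark; lia.
  - by move=> k _; rewrite /S; upd_simp.
  - by case: (body k lt_k).
  have [|t3 le3 ex3] := @exec_clear w g d.+2 (S n).1 o; first by lia.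
  exists (n1 + (t2 + t3)).
    have e : (S n).1 d.+2 = n by rewrite /S; upd_simp.
    rewrite e in le3; nia.
  have e0 : S 0 = (upd s d.+1 n, o).
    by rewrite /S big_geq // subn0; have ? := h0 d (leqnn d); have ? := h0 d.+2 ltac:(lia); upd_eq.
  rewrite e0 in ex2; apply: (exec_eq (exec_seq ex1 (exec_seq ex2 ex3))).
  rewrite /S subnn; have ? := h0 d.+1 ltac:(lia); have ? := h0 d.+2 ltac:(lia); by upd_eq.
- exists (fun M => Ta M + ((Va M * 4 + 1) + (2 + (Va M * 3 + 1)))), (fun=> 1).
  split; [by poly_bound | by poly_bound |].
  move=> w g M s o sg d rd le_w le_s /=; have [hsg h3 h0 h1 h4] := rd.
  split; first by case: nth.
  have rd1 : ready w sg d.+1 s.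
    by split=> // [i||i hi]; [have := hsg i; lia | lia | apply: h0; lia].
  have [va [n1 le1 ex1]] := IHa w g M s o sg d.+1 rd1 le_w le_s.
  set n := eval w g _ a in va ex1 *.
  have sb : s b = 0 by case: h1 => ? ?; case: (b).
  have hb : b < 2 by case: (b).
  set B : nat := b in sb hb *.
  have [||k lt_k|t2 le2 ex2] := @exec_loop (contents w g) d.+1
    (Seq (Dec d.+1) (Seq (Inc d.+2) (Inc B)))
    (fun k => (upd (upd (upd s d.+1 (n - k)) d.+2 k) B k, o)) n 3.
  - by move=> x; apply: contents_mark; lia.
  - by move=> k _; upd_simp.
  - exists 3 => //; apply: (exec_eq (exec_seq (@exec_dec_counter w g d.+1 _ o _ _)
      (exec_seq (exec_inc _ _ _ _) (exec_inc _ _ _ _)))) ; [by lia | by upd_simp |].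
    by upd_eq.
  rewrite subnn subn0 in ex2.
  have e0 : upd (upd (upd s d.+1 n) d.+2 0) B 0 = upd s d.+1 n.
    have ? := h0 d.+2 ltac:(lia); by upd_eq.
  rewrite {}e0 in ex2.
  set s2 := upd _ B n in ex2.
  set v := nth false _ _.
  have ex3 : exec (contents w g) (IfEq B (Some (inl true)) (Inc d) (Dec d.+1)) 2 (s2, o)
      (upd s2 d v, o).
    apply: exec_ifeq; have -> : s2 B = n by rewrite /s2; upd_simp.
    rewrite contents_read -/v; have s2d : s2 d = 0 by rewrite /s2; have ? := h0 d (leqnn d); upd_simp.
    case: (v) => /=; first by apply: exec_eq (exec_inc _ _ _ _) _; rewrite s2d.
    (* For a zero bit nothing is to be done: the loop has already brought tape [d.+1] to its mark,
       so [Dec d.+1] acts as a skip. *)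
    apply: (exec_eq (exec_dec_mark _ _)).
      by apply/eqP; rewrite contents_mark; [apply/eqP; rewrite /s2; upd_simp | lia].
    congr (_, _); apply: functional_extensionality => j; rewrite [RHS]/upd.
    by case: eqP => // ->.
  have [||k lt_k|t4 le4 ex4] := @exec_loop (contents w g) d.+2
    (Seq (Dec d.+2) (Dec B))
    (fun k => (upd (upd (upd s d v) d.+2 (n - k)) B (n - k), o)) n 2.
  - by move=> x; apply: contents_mark; lia.
  - by move=> k _; upd_simp.
  - exists 2 => //; apply: (exec_eq (exec_seq (@exec_dec_counter w g d.+2 _ o _ _)
      (exec_dec _ _ _))).
    + by lia.
    + by upd_simp.
    + exact: contents_data.
    + by upd_simp.
    by upd_eq.
  exists (n1 + (t2 + (2 + t4))); first by nia.
  have e1 : upd (upd (upd s d v) d.+2 (n - 0)) B (n - 0) = upd s2 d v.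
    by rewrite /s2 subn0; have ? := h0 d.+1 ltac:(lia); upd_eq.
  rewrite e1 subnn in ex4.
  apply: (exec_eq (exec_seq ex1 (exec_seq ex2 (exec_seq ex3 ex4)))).
  by have ? := h0 d.+2 ltac:(lia); upd_eq.
Qed.

(** * Definable functions, nondeterministic verifiers and matrix reductions *)

Definition numeric (F : seq bool -> seq bool -> (nat -> nat) -> nat) :=
  exists e, forall w g env, eval w g env e = F w g env.
Definition definable (P : seq bool -> seq bool -> (nat -> nat) -> bool) :=
  numeric (fun w g e => P w g e).

(** Under the binder of [ESum] the old variables move up by one; renaming lets a function already
    known to be [numeric] be used there. *)
Definition up_ren (rho : nat -> nat) : nat -> nat :=
  fun k => if k is k'.+1 then (rho k').+1 else 0.

Fixpoint ren (rho : nat -> nat) (e : expr) : expr :=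
  match e with
  | EVar k => EVar (rho k)
  | EOne => EOne
  | ESize => ESize
  | EAdd a b => EAdd (ren rho a) (ren rho b)
  | ESub a b => ESub (ren rho a) (ren rho b)
  | ESum a b => ESum (ren rho a) (ren (up_ren rho) b)
  | ERead b a => ERead b (ren rho a)
  end.

Lemma eval_ren w g rho env e :
  eval w g env (ren rho e) = eval w g (fun k => env (rho k)) e.
Proof.
elim: e rho env => [k|||a IHa b IHb|a IHa b IHb|a IHa b IHb|b a IHa] rho env //=;
  rewrite ?IHa ?IHb //.
apply: eq_bigr => x _; rewrite IHb; congr eval.
by apply: functional_extensionality => -[|k].
Qed.

Lemma iota_rcons n : iota 0 n.+1 = rcons (iota 0 n) n.
Proof. by rewrite -cats1 -addn1 iotaD. Qed.

(** * Closure properties of definable functions *)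

Section Closure.
Implicit Types (F G : seq bool -> seq bool -> (nat -> nat) -> nat).
Implicit Types (P Q : seq bool -> seq bool -> (nat -> nat) -> bool).

Lemma numeric_ext F G : numeric F -> (forall w g e, F w g e = G w g e) -> numeric G.
Proof. by case=> x hx e; exists x => w g env; rewrite hx e. Qed.

Lemma numeric_ren F rho : numeric F -> numeric (fun w g e => F w g (fun k => e (rho k))).
Proof. by case=> x hx; exists (ren rho x) => w g env; rewrite eval_ren hx. Qed.

Lemma numeric_var k : numeric (fun _ _ e => e k).
Proof. by exists (EVar k). Qed.

Lemma numeric_size : numeric (fun w _ _ => size w).
Proof. by exists ESize. Qed.

Lemma numeric_add F G : numeric F -> numeric G -> numeric (fun w g e => F w g e + G w g e).
Proof. by move=> [a ha] [b hb]; exists (EAdd a b) => w g env /=; rewrite ha hb. Qed.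

Lemma numeric_sub F G : numeric F -> numeric G -> numeric (fun w g e => F w g e - G w g e).
Proof. by move=> [a ha] [b hb]; exists (ESub a b) => w g env /=; rewrite ha hb. Qed.

Lemma numeric_const c : numeric (fun _ _ _ => c).
Proof.
elim: c => [|c IH]; first by exists (ESub EOne EOne).
have h1 : numeric (fun _ _ _ => 1) by exists EOne.
by apply: numeric_ext (numeric_add IH h1) _ => w g e; rewrite addn1.
Qed.

Lemma numeric_sum F (B : seq bool -> seq bool -> nat -> (nat -> nat) -> nat) :
  numeric F -> numeric (fun w g e => B w g (e 0) (fun k => e k.+1)) ->
  numeric (fun w g e => \sum_(0 <= x < F w g e) B w g x e).
Proof.
move=> [a ha] [b hb]; exists (ESum a b) => w g env /=; rewrite ha.
by apply: eq_bigr => x _; rewrite hb.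
Qed.

Lemma numeric_mul F G : numeric F -> numeric G -> numeric (fun w g e => F w g e * G w g e).
Proof.
move=> hF hG; apply: numeric_ext (numeric_sum (B := fun w g _ e => G w g e) hF _) _.
  exact: (numeric_ren succn hG).
by move=> w g e; rewrite sum_nat_const_nat subn0.
Qed.

Lemma numeric_succ F : numeric F -> numeric (fun w g e => (F w g e).+1).
Proof.
move=> hF; apply: numeric_ext (numeric_add hF (numeric_const 1)) _ => w g e.
by rewrite addn1.
Qed.

Lemma definable_input F : numeric F -> definable (fun w g e => nth false w (F w g e)).
Proof. by case=> a ha; exists (ERead false a) => w g env /=; rewrite ha. Qed.

Lemma definable_guess F : numeric F -> definable (fun w g e => nth false g (F w g e)).
Proof. by case=> a ha; exists (ERead true a) => w g env /=; rewrite ha. Qed.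

Lemma definable_const b : definable (fun _ _ _ => b).
Proof. exact: numeric_const. Qed.

Lemma definable_not P : definable P -> definable (fun w g e => ~~ P w g e).
Proof.
move=> hP; apply: numeric_ext (numeric_sub (numeric_const 1) hP) _ => w g e.
by case: (P w g e).
Qed.

Lemma definable_and P Q : definable P -> definable Q ->
  definable (fun w g e => P w g e && Q w g e).
Proof. by move=> hP hQ; apply: numeric_ext (numeric_mul hP hQ) _ => w g e; rewrite mulnb. Qed.

Lemma definable_or P Q : definable P -> definable Q ->
  definable (fun w g e => P w g e || Q w g e).
Proof.
move=> hP hQ; apply: numeric_ext (definable_not (definable_and (definable_not hP) (definable_not hQ))) _.
by move=> w g e; rewrite negb_and !negbK.
Qed.

Lemma definable_imp P Q : definable P -> definable Q ->
  definable (fun w g e => P w g e ==> Q w g e).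
Proof.
move=> hP hQ; apply: numeric_ext (definable_or (definable_not hP) hQ) _.
by move=> w g e; rewrite implybE.
Qed.

Lemma definable_leq F G : numeric F -> numeric G -> definable (fun w g e => F w g e <= G w g e).
Proof.
move=> hF hG; apply: numeric_ext (numeric_sub (numeric_const 1) (numeric_sub hF hG)) _.
by move=> w g e; case: leqP; lia.
Qed.

Lemma definable_eq F G : numeric F -> numeric G -> definable (fun w g e => F w g e == G w g e).
Proof.
move=> hF hG; apply: numeric_ext (definable_and (definable_leq hF hG) (definable_leq hG hF)) _.
by move=> w g e; rewrite eqn_leq.
Qed.

Lemma definable_eqb P Q : definable P -> definable Q ->
  definable (fun w g e => P w g e == Q w g e).
Proof.
move=> hP hQ; apply: numeric_ext (definable_eq hP hQ) _ => w g e.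
by case: (P w g e); case: (Q w g e).
Qed.

Lemma numeric_if P F G : definable P -> numeric F -> numeric G ->
  numeric (fun w g e => if P w g e then F w g e else G w g e).
Proof.
move=> hP hF hG.
apply: numeric_ext (numeric_add (numeric_mul hP hF) (numeric_mul (definable_not hP) hG)) _.
by move=> w g e; case: (P w g e); rewrite /= mul1n mul0n ?addn0.
Qed.

Lemma definable_if P Q R : definable P -> definable Q -> definable R ->
  definable (fun w g e => if P w g e then Q w g e else R w g e).
Proof.
by move=> hP hQ hR; apply: numeric_ext (numeric_if hP hQ hR) _ => w g e; case: (P w g e).
Qed.

Lemma definable_all F (B : seq bool -> seq bool -> nat -> (nat -> nat) -> bool) :
  numeric F -> definable (fun w g e => B w g (e 0) (fun k => e k.+1)) ->
  definable (fun w g e => all (fun x => B w g x e) (iota 0 (F w g e))).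
Proof.
move=> hF hB.
apply: numeric_ext (numeric_sub (numeric_const 1)
  (numeric_sum (B := fun w g x e => ~~ B w g x e) hF (definable_not hB))) _.
move=> w g e; elim: (F w g e) => [|n IH]; first by rewrite big_geq.
rewrite big_nat_recr // iota_rcons all_rcons /=; move: IH.
by case: (B w g n e) => /=; case: all => /=; lia.
Qed.

Lemma definable_has F (B : seq bool -> seq bool -> nat -> (nat -> nat) -> bool) :
  numeric F -> definable (fun w g e => B w g (e 0) (fun k => e k.+1)) ->
  definable (fun w g e => has (fun x => B w g x e) (iota 0 (F w g e))).
Proof.
move=> hF hB; apply: numeric_ext (definable_not (definable_all
  (B := fun w g x e => ~~ B w g x e) hF (definable_not hB))) _ => w g e.
by rewrite -has_predC; congr nat_of_bool; apply: eq_has => x /=; rewrite negbK.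
Qed.

Lemma sum_ltn q m : q <= m -> \sum_(0 <= x < m) (x < q) = q.
Proof.
elim: m q => [|m IH] q; first by rewrite big_geq; lia.
rewrite big_nat_recr //= leq_eqVlt => /orP[/eqP->|].
  rewrite ltnSn (eq_big_nat _ _ (F2 := fun=> 1)).
    by rewrite sum_nat_const_nat subn0 muln1 addn1.
  by move=> i /andP[_ hi]; rewrite ltnS ltnW.
by rewrite ltnS => h; rewrite IH //; lia.
Qed.

(** The quotient counts the positive multiples of [d] that do not exceed [m]. *)
Lemma divn_sum m d : 0 < d -> m %/ d = \sum_(0 <= x < m) (x.+1 * d <= m).
Proof.
move=> d0; rewrite -[LHS](sum_ltn (leq_div m d)).
by apply: eq_bigr => x _; rewrite leq_divRL.
Qed.

Lemma numeric_div F G : numeric F -> numeric G -> numeric (fun w g e => F w g e %/ G w g e).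
Proof.
move=> hF hG.
have h : numeric (fun w g e => \sum_(0 <= x < F w g e) (x.+1 * G w g e <= F w g e)).
  apply: (numeric_sum (B := fun w g x e => nat_of_bool (x.+1 * G w g e <= F w g e))) => //.
  apply: definable_leq; last exact: (numeric_ren succn hF).
  by apply: numeric_mul; [apply/numeric_succ/numeric_var | apply: (numeric_ren succn hG)].
apply: numeric_ext (numeric_if (definable_leq hG (numeric_const 0)) (numeric_const 0) h) _.
by move=> w g e; case: leqP => [|/divn_sum ->//]; rewrite leqn0 => /eqP->; rewrite divn0.
Qed.

Lemma numeric_mod F G : numeric F -> numeric G -> numeric (fun w g e => F w g e %% G w g e).
Proof.
move=> hF hG; apply: numeric_ext (numeric_sub hF (numeric_mul (numeric_div hF hG) hG)) _.
by move=> w g e; have := divn_eq (F w g e) (G w g e); lia.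
Qed.

(** Data of a fixed machine enter the formulas this way: [f] may be arbitrary, since only its
    finitely many values below the constant [c] are built into the expression. *)
Lemma numeric_table (f : nat -> nat) c F :
  numeric F -> numeric (fun w g e => if F w g e < c then f (F w g e) else 0).
Proof.
move=> hF; elim: c => [|c IH]; first exact: numeric_const.
apply: numeric_ext (numeric_if (definable_eq hF (numeric_const c)) (numeric_const (f c)) IH) _.
by move=> w g e; rewrite ltnS; case: (ltngtP (F w g e) c) => // ->.
Qed.

Lemma definable_table (f : pred nat) c F :
  numeric F -> definable (fun w g e => (F w g e < c) && f (F w g e)).
Proof.
by move=> hF; apply: numeric_ext (numeric_table f c hF) _ => w g e; case: ltnP.
Qed.

Lemma numeric_horner (p : {poly nat}) F : numeric F -> numeric (fun w g e => p.[F w g e]%R).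
Proof.
move=> hF; elim/poly_ind: p => [|p c IH].
  by apply: numeric_ext (numeric_const 0) _ => w g e; rewrite horner0.
apply: numeric_ext (numeric_add (numeric_mul IH hF) (numeric_const c)) _ => w g e.
by rewrite hornerMXaddC.
Qed.

End Closure.

Lemma numeric_exec e : exists2 T, poly_bounded T & forall w g, exists2 n, n <= T (size w) &
  exec (contents w g) (Seq prelude (compile (fun=> 2) 4 e)) n (guess_store (size w))
    (upd (clean_pos w) 4 (eval w g (fun=> 0) e), [::]).
Proof.
have [T [V [pT pV sp]]] := compileP e.
exists (fun n => (n * 5 + 1) + T n); first by poly_bound.
move=> w g; have [n1 le1 ex1] := exec_prelude w g.
have [|//|//|_ [n2 le2 ex2]] := sp w g (size w) (clean_pos w) [::] (fun=> 2) 4.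
  by split=> // i; rewrite /clean_pos; case: eqP => // ->.
exists (n1 + n2); first by rewrite leq_add.
exact: exec_seq ex1 ex2.
Qed.

Lemma runs_in_time_bound p al ck (T : nat -> nat) : poly_bounded T ->
  (forall w g, size g = size w -> all al g -> exists n st, n <= T (size w) /\
     exec (contents w g) p n (guess_store (size w)) st) ->
  polytime (mach p al ck).
Proof.
move=> pT H; have [|q hq] := @poly_bounded_poly (fun n => n + T n + 3); first by poly_bound.
exists q => w m c /mach_sound [[le_m _]|[g [sg ag] Hg]]; apply: leq_trans (hq _).
  by lia.
have [n [st [le_n ex]]] := H w g sg ag.
by have [le_m _] := Hg _ _ ex; lia.
Qed.

Lemma final_accept p al ck w g st :
  tm_accept (t := mach p al ck) (final_state p ck w g st) =
  (contents w g ck (st.1 ck) != mark).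
Proof.
rewrite /= /final_state; case: (contents w g ck (st.1 ck) == mark); last exact: eqxx.
by apply/eqP => -[] /(congr1 (@nat_of_ord _)); rewrite !val_ms.
Qed.

(** The truth value of [P] is left as 0 or 1 on counter 4, and the final test of that counter
    decides acceptance. *)
Theorem in_NP_definable (P : seq bool -> seq bool -> bool) :
  definable (fun w g _ => P w g) ->
  in_NP (fun w => exists2 g, size g = size w & P w g).
Proof.
case=> e he; have [T pT ex] := numeric_exec e.
exists (mach (Seq prelude (compile (fun=> 2) 4 e)) predT 4); split.
  apply: runs_in_time_bound pT _ => w g _ _; have [n le_n exn] := ex w g.
  by exists n; eexists; split; last exact: exn.
move=> w; have acc g : tm_accept (t := mach (Seq prelude (compile (fun=> 2) 4 e)) predT 4)
   (final_state (Seq prelude (compile (fun=> 2) 4 e)) 4 w g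
     (upd (clean_pos w) 4 (eval w g (fun=> 0) e), [::])) = P w g.
  by rewrite final_accept contents_mark //= he /upd eqxx eqb0 negbK.
split=> [[g sg Pg]|[m [c [nc hc ac]]]].
  have [n le_n exn] := ex w g.
  have [|c [nc rc qc]] := @mach_run _ predT 4 w g n _ sg _ exn; first by apply/allP.
  exists (size w + n + 3), c; split=> //; first exact: halted_final qc.
  by rewrite qc acc.
have [[_]|[g [sg _] Hg]] := mach_sound nc; first by rewrite ac.
have [n le_n exn] := ex w g; have [_ /(_ hc) qc] := Hg _ _ exn.
by exists g => //; rewrite -acc -qc.
Qed.

Definition matrix_word (n : nat) (a : nat -> nat -> bool) : seq bool :=
  [seq a u v | u <- iota 0 n, v <- iota 0 n].

Lemma matrix_rows (a : nat -> nat -> bool) k n :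
  [seq a u v | u <- iota 0 k.+1, v <- iota 0 n] =
  [seq a u v | u <- iota 0 k, v <- iota 0 n] ++ [seq a k v | v <- iota 0 n].
Proof. by rewrite iota_rcons -cats1 map_cat flatten_cat /= cats0. Qed.

(** * Printing a matrix row by row *)

Section MatrixProgram.
Variables (eT eA : expr) (TT VT TA VA : nat -> nat).
Hypotheses (specT : compile_spec eT TT VT) (specA : compile_spec eA TA VA).

(** Tape 2 is at zero after the prelude and stands for every absent variable. Tapes 4 and 6 count
    the remaining rows and columns, 5 and 7 hold the row and column numbers, 8 receives the
    entry. *)
Let no_vars : nat -> nat := fun=> 2.
Let vars : nat -> nat := scons 7 (scons 5 no_vars).

Definition entry_prog := Seq (Dec 6) (Seq (compile vars 8 eA)
  (Seq (IfEq 8 mark (Out false) (Seq (clear 8) (Out true))) (Inc 7))).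
(** The dimension is evaluated anew for every row, because the column loop uses up its counter. *)
Definition row_prog := Seq (Dec 4) (Seq (compile no_vars 6 eT)
  (Seq (While 6 entry_prog) (Seq (clear 7) (Inc 5)))).
Definition matrix_prog :=
  Seq (Seq prelude (compile no_vars 4 eT)) (While 4 row_prog).

Variables (w g : seq bool) (n : nat) (a : nat -> nat -> bool).
Hypothesis evalT : forall env, eval w g env eT = n.
Hypothesis evalA : forall u v, eval w g (scons v (scons u (fun=> 0))) eA = a u v.

Let pos x4 x5 x6 x7 := upd (upd (upd (upd (clean_pos w) 4 x4) 5 x5) 6 x6) 7 x7.
Let N := size w.
Let bA := size w + VT (size w).

Lemma dimension_bound : n <= VT N.
Proof.
have [||//|] := specT (w := w) g (M := N) (s := clean_pos w) (sg := fun=> 2) (d := 4) [::].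
- by split=> // i; rewrite /clean_pos; case: eqP => // ->.
- by [].
by rewrite evalT.
Qed.

Lemma exec_entry x4 u k o : u < n -> k < n ->
  exists2 t, t <= 1 + (TA bA + (6 + 1)) & exec (contents w g) entry_prog t
    (pos x4 u (n - k) k, o) (pos x4 u (n - k.+1) k.+1, rcons o (a u k)).
Proof.
move=> lt_u lt_k; have le_n := dimension_bound.
have ex1 : exec (contents w g) (Dec 6) 1 (pos x4 u (n - k) k, o) (pos x4 u (n - k.+1) k, o).
  apply: (exec_eq (@exec_dec_counter w g 6 _ o _ _)); rewrite /pos => //; first by upd_simp.
  by upd_eq.
set s := pos _ _ (n - k.+1) k in ex1.
have envE : (fun i => s (vars i)) = scons k (scons u (fun=> 0)).
  by apply: functional_extensionality => -[|[|i]].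
have [|||_ [t2 le2 ex2]] := specA (w := w) g (M := bA) (s := s) (sg := vars) (d := 8) o.
- split=> //; first by case=> [|[|i]].
  move=> i hi; rewrite /s /pos /upd /clean_pos !ifF //; lia.
- by rewrite /bA leq_addr.
- move=> i; have -> : s (vars i) = scons k (scons u (fun=> 0)) i by rewrite -envE.
  by case: i => [|[|i]] //=; rewrite /bA -/N; lia.
rewrite envE evalA in ex2.
have s8 : s 8 = 0 by [].
have [t3 le3 ex3] : exists2 t, t <= 6 & exec (contents w g)
    (IfEq 8 mark (Out false) (Seq (clear 8) (Out true))) t
    (upd s 8 (a u k), o) (s, rcons o (a u k)).
  have eqs : upd s 8 0 = s.
    by apply: functional_extensionality => j; rewrite /upd; case: eqP => // ->.
  case: (a u k) => /=.
    have [//|t3 le3 ex3] := @exec_clear w g 8 (upd s 8 1) o.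
    exists (t3 + 1).+1; first by move: le3; rewrite /upd eqxx; lia.
    apply: exec_ifeq; rewrite contents_mark //=.
    apply: exec_seq (exec_eq ex3 _) (exec_out _ _ _ _).
    congr (_, _); rewrite -[RHS]eqs.
    by apply: functional_extensionality => j; rewrite /upd; case: eqP.
  exists 2 => //; apply: exec_ifeq; rewrite contents_mark //= eqs.
  exact: exec_out.
exists (1 + (t2 + (t3 + 1))); first by lia.
apply: (exec_eq (exec_seq ex1 (exec_seq ex2 (exec_seq ex3 (exec_inc _ _ _ _))))).
by rewrite /s /pos; upd_eq.
Qed.

Lemma exec_row k o : k < n ->
  exists2 t, t <= 1 + (TT N + ((VT N * (1 + (TA bA + (6 + 1))).+1 + 1) + (VT N * 2 + 1 + 1))) &
    exec (contents w g) row_prog t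
    (pos (n - k) k 0 0, o) (pos (n - k.+1) k.+1 0 0, o ++ [seq a k v | v <- iota 0 n]).
Proof.
move=> lt_k; have le_n := dimension_bound.
have ex1 : exec (contents w g) (Dec 4) 1 (pos (n - k) k 0 0, o) (pos (n - k.+1) k 0 0, o).
  apply: (exec_eq (@exec_dec_counter w g 4 _ o _ _)); rewrite /pos => //; first by upd_simp.
  by upd_eq.
have [|//|//|_ [t2 le2 ex2]] := specT (w := w) g (M := N) (s := pos (n - k.+1) k 0 0)
  (sg := no_vars) (d := 6) o.
  split=> // i hi; rewrite /pos /upd /clean_pos.
  by case: eqP => // _; case: eqP => // _; rewrite !ifF //; lia.
rewrite evalT in ex2.
have [||i lt_i|t3 le3 ex3] := @exec_loop (contents w g) 6 entry_prog
  (fun i => (pos (n - k.+1) k (n - i) i, o ++ [seq a k v | v <- iota 0 i])) n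
  (1 + (TA bA + (6 + 1))).
- by move=> x; apply: contents_mark.
- by [].
- have [t le_t ex] := exec_entry (n - k.+1) (o ++ [seq a k v | v <- iota 0 i]) lt_k lt_i.
  by exists t => //; rewrite iota_rcons map_rcons -rcons_cat.
rewrite subn0 subnn cats0 in ex3.
have [//|t4 le4 ex4] := @exec_clear w g 7 (pos (n - k.+1) k 0 n)
  (o ++ [seq a k v | v <- iota 0 n]).
exists (1 + (t2 + (t3 + (t4 + 1)))).
  have : t4 <= n * 2 + 1 by [].
  have : n * (1 + (TA bA + (6 + 1))).+1 <= VT N * (1 + (TA bA + (6 + 1))).+1.
    by rewrite leq_mul2r le_n orbT.
  by lia.
have e2 : upd (pos (n - k.+1) k 0 0) 6 n = pos (n - k.+1) k n 0 by rewrite /pos; upd_eq.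
rewrite e2 in ex2.
apply: (exec_eq (exec_seq ex1 (exec_seq ex2 (exec_seq ex3 (exec_seq ex4 (exec_inc _ _ _ _)))))).
by rewrite /pos; upd_eq.
Qed.

Lemma exec_matrix : exists2 t,
  t <= (N * 5 + 1 + TT N) + (VT N * (1 + (TT N + ((VT N * (1 + (TA bA + (6 + 1))).+1 + 1)
         + (VT N * 2 + 1 + 1)))).+1 + 1) &
  exists st, st.2 = matrix_word n a /\
    exec (contents w g) matrix_prog t (guess_store (size w)) st.
Proof.
have le_n := dimension_bound.
have [n1 le1 ex1] := exec_prelude w g.
have [|//|//|_ [n2 le2 ex2]] := specT (w := w) g (M := N) (s := clean_pos w) (sg := no_vars)
  (d := 4) [::].
  by split=> // i; rewrite /clean_pos; case: eqP => // ->.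
rewrite evalT in ex2.
have [||k lt_k|t3 le3 ex3] := @exec_loop (contents w g) 4 row_prog
  (fun k => (pos (n - k) k 0 0, [seq a u v | u <- iota 0 k, v <- iota 0 n])) n
  (1 + (TT N + ((VT N * (1 + (TA bA + (6 + 1))).+1 + 1) + (VT N * 2 + 1 + 1)))).
- by move=> x; apply: contents_mark.
- by [].
- by rewrite matrix_rows; apply: exec_row.
rewrite subn0 in ex3.
have e2 : upd (clean_pos w) 4 n = pos n 0 0 0.
  by rewrite /pos; upd_eq.
rewrite e2 in ex2.
exists ((n1 + n2) + t3); last first.
  by eexists; split; last exact: exec_seq (exec_seq ex1 ex2) ex3.
rewrite !leq_add // ?(leq_trans le3) // leq_add2r leq_mul2r le_n orbT //.
Qed.

End MatrixProgram.

Theorem polytime_matrix (T : seq bool -> nat) (A : seq bool -> nat -> nat -> bool) :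
  numeric (fun w _ _ => T w) -> definable (fun w _ e => A w (e 1) (e 0)) ->
  polytime_computable (fun w => matrix_word (T w) (A w)).
Proof.
move=> [eT hT] [eA hA].
have [TT [VT [pTT pVT sT]]] := compileP eT; have [TA [VA [pTA pVA sA]]] := compileP eA.
have ex w g := @exec_matrix eT eA _ _ _ _ sT sA w g (T w) (A w) (hT w g) (fun u v => hA w g _).
exists (mach (matrix_prog eT eA) (pred1 false) 4); split.
- by apply: mach_deterministic => b b' /eqP-> /eqP->.
- pose B N := (N * 5 + 1 + TT N) + (VT N * ((1 + (TT N + ((VT N * (1 + (TA (N + VT N) + (6 + 1)) + 1) + 1)
         + (VT N * 2 + 1 + 1)))) + 1) + 1).
  apply: (@runs_in_time_bound _ _ _ B); first by rewrite /B; poly_bound.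
  move=> w g _ _; have [t le_t [st [_ ext]]] := ex w g; exists t, st; split=> //.
  by apply: leq_trans le_t _; rewrite /B; lia.
- move=> w; pose g := nseq (size w) false; have [t _ [st [<- ext]]] := ex w g.
  have [||c [nc rc qc]] := @mach_run _ (pred1 false) 4 w g t _ _ _ ext.
  + by rewrite size_nseq.
  + by apply/allP => b; rewrite mem_nseq => /andP[_].
  exists (size w + t + 3), c; split=> //; first exact: halted_final qc.
  exact: crep_output rc.
Qed.

(** * Membership in NP *)

Definition k4 (V : finType) (E : rel V) (a b c d : V) :=
  [&& a != b, a != c, a != d, b != c, b != d, c != d,
      E a b, E a c, E a d, E b c, E b d & E c d].

Lemma backedge_sym (V : finType) (A : rel V) r : symmetric (backedge A r).
Proof. by move=> u v; rewrite /backedge orbC. Qed.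

Lemma clique_number_le3 (V : finType) (E : rel V) : symmetric E ->
  (clique_number E <= 3) <-> forall a b c d, ~~ k4 E a b c d.
Proof.
move=> sE; split=> [h a b c d|h].
  apply/negP; rewrite /k4 => /and5P[ab ac ad bc /and5P[bd cd Eab Eac /and4P[Ead Ebc Ebd Ecd]]].
  have : #|a |: (b |: (c |: [set d]))| <= 3.
    apply: leq_trans h; apply: (@leq_bigmax_cond _ (is_clique E) (fun S : {set V} => #|S|)).
    apply/forall_inP => u; rewrite !inE => hu; apply/forall_inP => v; rewrite !inE => hv.
    apply/implyP => nuv; move: hu hv nuv.
    by case/or4P=> /eqP->; case/or4P=> /eqP->; rewrite ?eqxx // => _; rewrite // sE.
  by rewrite !cardsU1 !cards1 !inE !negb_or ab ac ad bc bd cd.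
apply/bigmax_leqP => S /forall_inP cS; rewrite leqNgt; apply/negP.
rewrite cardE; case e : (enum S) => [|a [|b [|c [|d s]]]] //= _.
have mS x : x \in [:: a, b, c, d & s] -> x \in S by rewrite -e mem_enum.
have := enum_uniq S; rewrite e /= !inE !negb_or -!andbA.
case/and5P=> ab ac ad _ /and5P[bc bd _ cd _].
have cE x y : x \in [:: a, b, c, d & s] -> y \in [:: a, b, c, d & s] -> x != y -> E x y.
  by move=> /mS hx /mS hy; apply/implyP; move/forall_inP: (cS x hx); apply.
move/negP: (h a b c d); apply; rewrite /k4 ab ac ad bc bd cd /= !cE // !inE eqxx ?orbT //.
Qed.

Definition order_of (V : finType) (f : V -> nat) : {set V * V} := [set p | f p.1 < f p.2].

Lemma order_ofP (V : finType) (f : V -> nat) : injective f -> strict_total_order (order_of f).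
Proof.
move=> inj; apply/and3P; split.
- by apply/forallP => u; rewrite inE ltnn.
- apply/forallP => u; apply/forallP => v; apply/forallP => x; rewrite !inE /=.
  by apply/implyP => /andP[]; apply: ltn_trans.
- apply/forallP => u; apply/forallP => v; rewrite !inE /=; apply/implyP => nuv.
  by rewrite -neq_ltn; apply: contra nuv => /eqP/inj->.
Qed.

Lemma bigmin_le (I : eqType) (P : pred I) (F : I -> nat) x0 s r : r \in s -> P r ->
  \big[minn/x0]_(i <- s | P i) F i <= F r.
Proof.
elim: s => // i s IH; rewrite inE big_cons => /orP[/eqP<- ->|rs Pr]; first exact: geq_minl.
by case: ifP => _; [apply: leq_trans (geq_minr _ _) _ |]; apply: IH.
Qed.

Lemma diomega_le3 (V : finType) (A : rel V) : diomega A <= 3 <->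
  exists2 r, strict_total_order r & forall a b c d, ~~ k4 (backedge A r) a b c d.
Proof.
have kP r := clique_number_le3 (backedge_sym A r).
split=> [|[r sr /kP hr]]; last first.
  by apply: leq_trans hr; apply: bigmin_le sr; apply: mem_index_enum.
have : diomega A <= 3 -> #|V| <= 3 \/ exists2 r, strict_total_order r &
    clique_number (backedge A r) <= 3.
  rewrite /diomega; elim/big_rec: _ => [|r x sr IH]; first by left.
  by rewrite geq_min => /orP[h|/IH//]; right; exists r.
move=> H /H {H} [cV|[r sr /kP hr]]; last by exists r.
(* If the bound comes from the default value [#|V|], there are at most three vertices and any order
   works; enumeration rank supplies one. *)
exists (order_of (fun x : V => enum_rank x : nat)).
  by apply: order_ofP => x y /ord_inj/enum_rank_inj.
apply/kP; apply/bigmax_leqP => S _; apply: leq_trans cV; exact: max_card.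
Qed.

Lemma matrix_word_size n a : size (matrix_word n a) = n * n.
Proof. by rewrite size_allpairs !size_iota. Qed.

Lemma matrix_word_nth n a u v : u < n -> v < n ->
  nth false (matrix_word n a) (u * n + v) = a u v.
Proof.
move=> + lt_v; rewrite /matrix_word; move: {1 3}n; elim=> // k IH lt_u.
rewrite matrix_rows nth_cat size_allpairs !size_iota.
case: (ltnP u k) => hu; first by rewrite ifT; [exact: IH | nia].
have -> : u = k by lia.
by rewrite ifF ?addKn ?(nth_map 0) ?size_iota ?nth_iota //; lia.
Qed.

Definition nat_rel (n : nat) (A : rel 'I_n) (u v : nat) : bool :=
  match insub u, insub v with Some x, Some y => A x y | _, _ => false end.

Lemma nat_relE n (A : rel 'I_n) (u v : 'I_n) : nat_rel A u v = A u v.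
Proof. by rewrite /nat_rel !valK. Qed.

Lemma encode_matrix n (A : rel 'I_n) : encode_tournament A = matrix_word n (nat_rel A).
Proof.
rewrite /matrix_word -val_enum_ord allpairs_mapl allpairs_mapr.
by apply: eq_allpairs => u v; rewrite nat_relE.
Qed.

Lemma encode_nth n (A : rel 'I_n) (u v : 'I_n) :
  nth false (encode_tournament A) (u * n + v) = A u v.
Proof. by rewrite encode_matrix matrix_word_nth // nat_relE. Qed.

Section Verifier.
Variables (w g : seq bool) (n : nat).
Let W u v := nth false w (u * n + v).
Let G u v := nth false g (u * n + v).
Let E u v := G u v && W v u || G v u && W u v.

Definition verify_at : bool :=
  (n * n == size w) &&
  all (fun u => ~~ W u u && ~~ G u u &&
    all (fun v => ((u == v) || ~~ (W u v == W v u) && (G u v || G v u)) &&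
      all (fun x => (G u v && G v x ==> G u x) &&
        all (fun y => ~~ (~~ (u == v) && ~~ (u == x) && ~~ (u == y) &&
                          ~~ (v == x) && ~~ (v == y) && ~~ (x == y) &&
                          E u v && E u x && E u y && E v x && E v y && E x y))
      (iota 0 n)) (iota 0 n)) (iota 0 n)) (iota 0 n).

Lemma verify_atP : reflect
  [/\ n * n = size w,
      forall u, u < n -> ~~ W u u /\ ~~ G u u,
      forall u v, u < n -> v < n -> u != v -> (W u v (+) W v u) /\ (G u v || G v u),
      forall u v x, u < n -> v < n -> x < n -> G u v -> G v x -> G u x &
      forall u v x y, u < n -> v < n -> x < n -> y < n ->
        ~~ [&& u != v, u != x, u != y, v != x, v != y, x != y,
               E u v, E u x, E u y, E v x, E v y & E x y]]
  verify_at.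
Proof.
have allI (P : pred nat) : reflect (forall u, u < n -> P u) (all P (iota 0 n)).
  apply: (iffP allP) => h u; first by move=> hu; apply: h; rewrite mem_iota.
  by rewrite mem_iota => hu; apply: h.
apply: (iffP andP) => [[/eqP e0 /allI h]|[e0 h1 h2 h3 h4]].
  split=> //.
  - by move=> u /h/andP[/andP[]].
  - move=> u v /h/andP[_ /allI hu] /hu/andP[+ _] /negbTE nuv; rewrite nuv /=.
    by case/andP=> hW ->; split=> //; move: hW; case: (W u v); case: (W v u).
  - move=> u v x /h/andP[_ /allI hu] /hu/andP[_ /allI hv] /hv/andP[/implyP+ _] Guv Gvx.
    by apply; rewrite Guv.
  - move=> u v x y /h/andP[_ /allI hu] /hu/andP[_ /allI hv] /hv/andP[_ /allI hx] /hx.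
    by rewrite -!andbA.
split; first by apply/eqP.
apply/allI => u hu; case: (h1 u hu) => -> -> /=; apply/allI => v hv; apply/andP; split.
  case: (eqVneq u v) => //= nuv; have [+ ->] := h2 u v hu hv nuv; rewrite andbT.
  by case: (W u v); case: (W v u).
apply/allI => x hx; apply/andP; split; first by apply/implyP => /andP[]; apply: h3.
by apply/allI => y hy; rewrite -!andbA; apply: h4.
Qed.
End Verifier.

(** The number of vertices is found by search; [n * n = size w] forces [n <= size w]. *)
Definition verify (w g : seq bool) : bool :=
  has (fun n => verify_at w g n) (iota 0 (size w).+1).

Ltac numeric_step :=
  lazymatch goal with
  | |- definable (fun w g e => all (fun x => @?B w g x e) (iota 0 (@?F w g e))) =>
      apply: (@definable_all F B)
  | |- definable (fun w g e => has (fun x => @?B w g x e) (iota 0 (@?F w g e))) =>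
      apply: (@definable_has F B)
  | |- definable (fun w g e => (@?P w g e) && (@?Q w g e)) => apply: (@definable_and P Q)
  | |- definable (fun w g e => (@?P w g e) || (@?Q w g e)) => apply: (@definable_or P Q)
  | |- definable (fun w g e => (@?P w g e) ==> (@?Q w g e)) => apply: (@definable_imp P Q)
  | |- definable (fun w g e => ~~ (@?P w g e)) => apply: (@definable_not P)
  | |- definable (fun w g e => nth false w (@?F w g e)) => apply: (@definable_input F)
  | |- definable (fun w g e => nth false g (@?F w g e)) => apply: (@definable_guess F)
  | |- definable (fun w g e => leq (@?F w g e) (@?G w g e)) => apply: (@definable_leq F G)
  | |- definable (fun w g e => @eq_op bool (@?F w g e) (@?G w g e)) => apply: (@definable_eqb F G)
  | |- definable (fun w g e => @eq_op _ (@?F w g e) (@?G w g e)) =>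
      first [apply: (@definable_eq F G) | apply: (@definable_eqb F G)]
  | |- numeric (fun w g e => size w) => exact: numeric_size
  | |- numeric (fun w g e => e ?k) => exact: (numeric_var k)
  | |- numeric (fun w g e => (@?F w g e) + (@?G w g e)) => apply: (@numeric_add F G)
  | |- numeric (fun w g e => (@?F w g e) * (@?G w g e)) => apply: (@numeric_mul F G)
  | |- numeric (fun w g e => (@?F w g e) - (@?G w g e)) => apply: (@numeric_sub F G)
  | |- numeric (fun w g e => (@?F w g e) %/ (@?G w g e)) => apply: (@numeric_div F G)
  | |- numeric (fun w g e => (@?F w g e) %% (@?G w g e)) => apply: (@numeric_mod F G)
  | |- numeric (fun w g e => (@?F w g e).+1) => apply: (@numeric_succ F)
  | |- numeric (fun w g e => nat_of_bool (@?P w g e)) => change (definable P)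
  | |- numeric _ => first [exact: numeric_const | apply: numeric_if]
  | |- definable _ => first [exact: definable_const | apply: definable_if]
  end; cbv beta.

Ltac numeric := repeat first [assumption | numeric_step].

Lemma definable_verify : definable (fun w g _ => verify w g).
Proof. rewrite /verify /verify_at; numeric. Qed.

Lemma three_diomega_verify w :
  three_diomega_ordering w <-> exists2 g, size g = size w & verify w g.
Proof.
split=> [[n [A [[irA tA] -> /diomega_le3[r sr hr]]]]|[g sg /hasP[n _ /verify_atP[e0 h1 h2 h3 h4]]]].
  pose R : rel 'I_n := fun u v => (u, v) \in r.
  exists (encode_tournament R); first by rewrite !encode_matrix !matrix_word_size.
  have [/forallP ir /forallP tr /forallP tot] := and3P sr.
  apply/hasP; exists n; first by rewrite mem_iota encode_matrix matrix_word_size; nia.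
  apply/verify_atP; split.
  - by rewrite encode_matrix matrix_word_size.
  - by move=> u hu; rewrite !(encode_nth _ (Ordinal hu) (Ordinal hu)) irA ir.
  - move=> u v hu hv nuv; rewrite !(encode_nth _ (Ordinal hu) (Ordinal hv)).
    rewrite !(encode_nth _ (Ordinal hv) (Ordinal hu)).
    split; first exact: tA.
    by move/forallP: (tot (Ordinal hu)) => /(_ (Ordinal hv))/implyP; apply.
  - move=> u v x hu hv hx; rewrite !(encode_nth _ (Ordinal hu) (Ordinal hv)).
    rewrite (encode_nth _ (Ordinal hv) (Ordinal hx)) (encode_nth _ (Ordinal hu) (Ordinal hx)).
    move/forallP: (tr (Ordinal hu)) => /(_ (Ordinal hv))/forallP/(_ (Ordinal hx))/implyP t a b.
    by apply: t; apply/andP.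
  - move=> u v x y hu hv hx hy; have := hr (Ordinal hu) (Ordinal hv) (Ordinal hx) (Ordinal hy).
    have E a b (ha : a < n) (hb : b < n) : backedge A r (Ordinal ha) (Ordinal hb) =
      nth false (encode_tournament R) (a * n + b) && nth false (encode_tournament A) (b * n + a)
      || nth false (encode_tournament R) (b * n + a) && nth false (encode_tournament A) (a * n + b).
      rewrite !(encode_nth _ (Ordinal ha) (Ordinal hb)).
      by rewrite !(encode_nth _ (Ordinal hb) (Ordinal ha)).
    by rewrite /k4 !E.
pose A : rel 'I_n := fun u v => nth false w (u * n + v).
exists n, A; split.
- split; first by move=> u; apply: negbTE; case: (h1 u (ltn_ord u)).
  by move=> u v nuv; case: (h2 u v).
- rewrite encode_matrix; apply: (@eq_from_nth _ false); rewrite ?matrix_word_size // => i lt_i.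
  have n0 : 0 < n by rewrite -e0 in lt_i; case: (n) lt_i.
  have hq : i %/ n < n by rewrite ltn_divLR // e0.
  have hr : i %% n < n by rewrite ltn_mod.
  rewrite (divn_eq i n) matrix_word_nth //.
  by rewrite (nat_relE A (Ordinal hq) (Ordinal hr)).
apply/diomega_le3; exists [set p : 'I_n * 'I_n | nth false g (p.1 * n + p.2)].
  apply/and3P; split.
  - by apply/forallP => u; rewrite inE; case: (h1 u).
  - do 3 apply/forallP => ?; rewrite !inE /=; apply/implyP => /andP[]; exact: h3.
  - do 2 apply/forallP => ?; rewrite !inE /=; apply/implyP => nuv.
    by case: (h2 _ _ (ltn_ord _) (ltn_ord _) nuv).
move=> u v x y; have := h4 u v x y (ltn_ord _) (ltn_ord _) (ltn_ord _) (ltn_ord _).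
by rewrite /k4 /backedge !inE.
Qed.

Lemma in_NP_ext L L' : (forall w, L w <-> L' w) -> in_NP L -> in_NP L'.
Proof. by move=> e [M [pM hM]]; exists M; split=> // w; rewrite -e. Qed.

Lemma three_diomega_in_NP : in_NP three_diomega_ordering.
Proof.
apply: in_NP_ext (in_NP_definable definable_verify) => w.
by rewrite three_diomega_verify.
Qed.

(** * From tournament orders to acyclic 2-colourings *)

Definition good_order (n : nat) (a lt : nat -> nat -> bool) :=
  let E u v := lt u v && a v u || lt v u && a u v in
  [/\ forall u, u < n -> ~~ lt u u,
      forall u v, u < n -> v < n -> u != v -> lt u v || lt v u,
      forall u v x, u < n -> v < n -> x < n -> lt u v -> lt v x -> lt u x &
      forall u v x y, u < n -> v < n -> x < n -> y < n ->
        ~~ [&& u != v, u != x, u != y, v != x, v != y, x != y,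
               E u v, E u x, E u y, E v x, E v y & E x y]].

Lemma three_diomega_matrix n a : (forall u, u < n -> ~~ a u u) ->
  (forall u v, u < n -> v < n -> u != v -> a u v (+) a v u) ->
  three_diomega_ordering (matrix_word n a) <-> exists lt, good_order n a lt.
Proof.
move=> ir tour; rewrite three_diomega_verify; split.
  move=> [g sg /hasP[m _ /verify_atP[e0 h1 h2 h3 h4]]].
  rewrite matrix_word_size in e0; have em : m = n by nia.
  subst m; exists (fun u v => nth false g (u * n + v)); split.
  - by move=> u /h1[].
  - by move=> u v hu hv /(h2 u v hu hv)[].
  - exact: h3.
  - move=> u v x y hu hv hx hy; have := h4 u v x y hu hv hx hy.
    by rewrite !matrix_word_nth.
move=> [lt [h1 h2 h3 h4]]; exists (matrix_word n lt); rewrite ?matrix_word_size //.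
apply/hasP; exists n; first by rewrite mem_iota matrix_word_size; nia.
apply/verify_atP; split; rewrite ?matrix_word_size //.
- by move=> u hu; rewrite !matrix_word_nth //; split; [apply: ir | apply: h1].
- by move=> u v hu hv nuv; rewrite !matrix_word_nth //; split; [apply: tour | apply: h2].
- by move=> u v x hu hv hx; rewrite !matrix_word_nth //; apply: h3.
- by move=> u v x y hu hv hx hy; rewrite !matrix_word_nth //; apply: h4.
Qed.

(** A tournament is described by its backedges in the natural order. Only [bk u v] with [u < v] is
    consulted, so every [bk] gives a tournament. *)
Definition arc_of (bk : nat -> nat -> bool) (u v : nat) : bool :=
  if u < v then ~~ bk u v else (v < u) && bk v u.

Lemma arc_of_irr bk u : ~~ arc_of bk u u.
Proof. by rewrite /arc_of ltnn. Qed.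

Lemma arc_of_tour bk u v : u != v -> arc_of bk u v (+) arc_of bk v u.
Proof. by rewrite /arc_of; case: ltngtP => // _ _; case: bk. Qed.

(* A tournament on 7 vertices whose backedges in the natural order form a
   triangle-free graph but which is not the union of two transitive tournaments;
   it was found by computer search. *)
Definition r7_back (u v : nat) : bool :=
  v \in nth [::] [:: [:: 2; 3; 5]; [:: 3; 6]; [:: 4; 6]; [:: 4]; [:: 5]; [:: 6]; [::]] u.

Lemma r7_triangle_free : all (fun u => all (fun v => all (fun x =>
    ~~ [&& u < v, v < x, r7_back u v, r7_back u x & r7_back v x])
  (iota 0 7)) (iota 0 7)) (iota 0 7).
Proof. by vm_compute. Qed.

(** Transitive tournaments are those without a directed 3-cycle, so this is the failure of every
    partition into two transitive parts. *)
Lemma r7_mono (f : nat -> bool) : exists i j k b, [/\ i < 7, j < 7 & k < 7] /\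
  [/\ arc_of r7_back i j, arc_of r7_back j k & arc_of r7_back k i] /\
  [/\ f i = b, f j = b & f k = b].
Proof.
pose mono s := has (fun i => has (fun j => has (fun k =>
    [&& arc_of r7_back i j, arc_of r7_back j k, arc_of r7_back k i,
        nth false s i == nth false s j & nth false s j == nth false s k])
  (iota 0 7)) (iota 0 7)) (iota 0 7).
(* Only seven values of [f] matter; all 128 possibilities are checked by evaluation. *)
have : mono (mkseq f 7).
  rewrite /mkseq /=; move: (f 0) (f 1) (f 2) (f 3) (f 4) (f 5) (f 6).
  by do 7!case; vm_compute.
case/hasP=> i hi /hasP[j hj /hasP[k hk]]; rewrite !mem_iota /= add0n in hi hj hk.
rewrite !nth_mkseq // => /and5P[ij jk ki /eqP e1 /eqP e2].
by exists i, j, k, (f k); rewrite e1 e2.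
Qed.

Section Gadget.
(* [bkV] gives the backedges of a tournament [V] on [nV] vertices. The vertices
   [0..6] and [7..13] form two copies [R2 => R1] of the 7-vertex tournament, and
   [V], shifted by 14, satisfies [R1 => V => R2]. *)
Variables (nV : nat) (bkV : nat -> nat -> bool).

Definition gadget_back (u v : nat) : bool :=
  if v < 7 then r7_back u v
  else if u < 7 then 14 <= v
  else if v < 14 then r7_back (u - 7) (v - 7)
  else if u < 14 then false
  else bkV (u - 14) (v - 14).

Notation A := (arc_of gadget_back).
Notation n := (14 + nV).

Lemma arc_R2 u v : u < 7 -> v < 7 -> A u v = arc_of r7_back u v.
Proof. by move=> hu hv; rewrite /arc_of /gadget_back hu hv. Qed.

Lemma arc_R1 u v : u < 7 -> v < 7 -> A (7 + u) (7 + v) = arc_of r7_back u v.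
Proof.
move=> hu hv; rewrite /arc_of /gadget_back !addKn.
rewrite (ltn_add2l 7 u v) (ltn_add2l 7 v u).
have lo x : (7 + x < 7) = false by lia.
have up x : x < 7 -> 7 + x < 14 by lia.
by rewrite !lo !up.
Qed.

Lemma arc_R2_R1 u v : u < 7 -> v < 7 -> A u (7 + v).
Proof.
move=> hu hv; rewrite /arc_of /gadget_back hu.
have -> : u < 7 + v by lia.
have -> : (7 + v < 7) = false by lia.
lia.
Qed.

Lemma arc_R1_V u v : u < 7 -> A (7 + u) (14 + v).
Proof.
move=> hu; rewrite /arc_of /gadget_back.
have -> : 7 + u < 14 + v by lia.
have -> : (14 + v < 7) = false by lia.
have -> : (7 + u < 7) = false by lia.
have -> : (14 + v < 14) = false by lia.
by have -> : 7 + u < 14 by lia.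
Qed.

Lemma arc_V_R2 u v : v < 7 -> A (14 + u) v.
Proof.
move=> hv; rewrite /arc_of /gadget_back.
have -> : (14 + u < v) = false by lia.
have -> : (14 + u < 7) = false by lia.
by rewrite hv; lia.
Qed.

Lemma arc_V u v : A (14 + u) (14 + v) = arc_of bkV u v.
Proof.
rewrite /arc_of /gadget_back !addKn (ltn_add2l 14 u v) (ltn_add2l 14 v u).
have lo x k : k <= 14 -> (14 + x < k) = false by lia.
by rewrite !lo.
Qed.

(** * From an order without [K4] to a 2-colouring *)

Section FromOrder.
Variable lt : nat -> nat -> bool.
Hypothesis good : good_order n A lt.
Let E u v := lt u v && A v u || lt v u && A u v.

Lemma not_edge_lt u v : u < n -> v < n -> A u v -> ~~ E u v -> lt u v.
Proof.
case: good => _ tot _ _ hu hv auv; rewrite /E negb_or auv andbT => /andP[_].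
have nuv : u != v by apply/eqP => e; move: auv; rewrite e; apply/negP; apply: arc_of_irr.
by case/orP: (tot u v hu hv nuv) => // ->.
Qed.

(** Without a backedge among the three arcs, the order would increase all the way round the
    cycle. *)
Lemma cycle_edge u v x : u < n -> v < n -> x < n -> A u v -> A v x -> A x u ->
  E u v \/ E v x \/ E x u.
Proof.
case: (good) => ir _ tr _ hu hv hx uv vx xu.
case euv: (E u v); [by left | right]; case evx: (E v x); [by left | right].
case exu: (E x u) => //.
have l1 := not_edge_lt hu hv uv (negbT euv).
have l2 := not_edge_lt hv hx vx (negbT evx).
have l3 := not_edge_lt hx hu xu (negbT exu).
by have := ir u hu; rewrite (tr u x u) // (tr u v x).
Qed.

Lemma edge_irr u : u < n -> ~~ E u u.
Proof. by case: good => ir _ _ _ /ir h; rewrite /E (negbTE h). Qed.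

(** The 3-cycle that is monochromatic under [f] contains a backedge. Later [f] records on which side
    of a vertex of [V] a vertex of the copy lies. *)
Lemma copy_edge o (f : nat -> bool) : o = 0 \/ o = 7 -> exists i j b,
  [/\ i < 7, j < 7, E (o + i) (o + j), f (o + i) = b & f (o + j) = b].
Proof.
move=> ho; have [i [j [k [b [[hi hj hk] [[ij jk ki] [fi fj fk]]]]]]] := r7_mono (fun i => f (o + i)).
have arcE u v : u < 7 -> v < 7 -> A (o + u) (o + v) = arc_of r7_back u v.
  by case: ho => -> hu hv; [apply: arc_R2 | apply: arc_R1].
have ho' : o <= 7 by case: ho => ->.
have : E (o + i) (o + j) \/ E (o + j) (o + k) \/ E (o + k) (o + i).
  by apply: cycle_edge; rewrite ?arcE //; lia.
by case=> [|[]] h; [exists i, j, b | exists j, k, b | exists k, i, b].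
Qed.

Lemma edge_neq u v : u < n -> E u v -> u != v.
Proof. by move=> hu; apply: contraTneq => <-; apply: edge_irr. Qed.

Lemma no_k4 u v x y : u < n -> v < n -> x < n -> y < n ->
  E u v -> E u x -> E u y -> E v x -> E v y -> E x y -> False.
Proof.
case: (good) => _ _ _ h hu hv hx hy e1 e2 e3 e4 e5 e6.
move/negP: (h u v x y hu hv hx hy); apply.
by rewrite -!/(E _ _) e1 e2 e3 e4 e5 e6 !edge_neq.
Qed.

Definition low (x : nat) : bool :=
  has (fun i => has (fun j =>
    [&& lt (14 + x) (7 + i), lt (14 + x) (7 + j) & E (7 + i) (7 + j)])
  (iota 0 7)) (iota 0 7).

Lemma lowP x : reflect (exists i j, [/\ i < 7, j < 7, lt (14 + x) (7 + i),
  lt (14 + x) (7 + j) & E (7 + i) (7 + j)]) (low x).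
Proof.
apply: (iffP hasP) => [[i + /hasP[j + /and3P[h1 h2 h3]]]|[i [j [hi hj h1 h2 h3]]]].
  by rewrite !mem_iota => hi hj; exists i, j.
by exists i; rewrite ?mem_iota //; apply/hasP; exists j; rewrite ?mem_iota // h1 h2.
Qed.

Lemma not_low_high x : x < nV -> ~~ low x -> exists i j,
  [/\ i < 7, j < 7, lt i (14 + x), lt j (14 + x) & E i j].
Proof.
case: (good) => _ tot tr _ hx nlow.
have hx' : 14 + x < n by lia.
have [i [j [b [hi hj eij fi fj]]]] := @copy_edge 7 (fun a => lt (14 + x) a) (or_intror erefl).
case: b fi fj => fi fj; first by case/lowP: nlow; exists i, j.
have before a : a < 14 -> lt (14 + x) a = false -> lt a (14 + x).
  move=> ha h; have := tot a (14 + x); rewrite h orbF; apply; lia.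
have li : lt (7 + i) (14 + x) by apply: before; [lia|].
have lj : lt (7 + j) (14 + x) by apply: before; [lia|].
have [k [l [b [hk hl ekl fk fl]]]] := @copy_edge 0 (fun a => lt (14 + x) a) (or_introl erefl).
rewrite !add0n in ekl fk fl.
case: b fk fl => fk fl; last first.
  by exists k, l; split=> //; apply: before => //; apply: leq_trans (isT : 7 <= 14).
(* The edge of [R1] lies before [x] and that of [R2] after it, against the arcs [R2 => R1], so all
   four cross pairs are backedges. *)
have up a c : a < 7 -> c < 7 -> lt (7 + a) (14 + x) -> lt (14 + x) c -> E (7 + a) c.
  by move=> ha hc l1 l2; rewrite /E (tr _ (14 + x)) ?arc_R2_R1 //; clear - ha hc; lia.
exfalso; apply: (@no_k4 (7 + i) (7 + j) k l) => //; solve [exact: up | clear - hi hj hk hl; lia].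
Qed.

Lemma mono_class_no_edge x y : x < nV -> y < nV -> low x = low y ->
  E (14 + x) (14 + y) = false.
Proof.
case: (good) => _ _ tr _.
suff {x y} H x y : x < nV -> y < nV -> low x = low y -> lt (14 + x) (14 + y) ->
    E (14 + x) (14 + y) = false.
  move=> hx hy e; apply/negP => h; case/orP: (h) => /andP[l _].
    by rewrite H in h.
  by move: h; rewrite /E orbC -/(E (14 + y) (14 + x)) H.
(* The edge of [R1] is taken after the later vertex [y] in the low case, the edge of [R2] before the
   earlier vertex [x] in the other; by transitivity it lies on the same side of both. *)
move=> hx hy e l; apply/negP => h; case lx: (low x).
  move: (lx); rewrite e => /lowP[i [j [hi hj li lj eij]]].
  have up a b : b < 7 -> a < nV -> lt (14 + a) (7 + b) -> E (14 + a) (7 + b).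
    by move=> hb ha lab; rewrite /E lab arc_R1_V.
  have tr' k : k < 7 -> lt (14 + y) (7 + k) -> lt (14 + x) (7 + k).
    by move=> hk; apply: tr => //; clear - hk hx hy; lia.
  apply: (@no_k4 (14 + x) (14 + y) (7 + i) (7 + j)) => //;
    solve [by apply: up => //; apply: tr' | clear - hi hj hx hy; lia].
have [i [j [hi hj li lj eij]]] := not_low_high hx (negbT lx).
have up a b : b < 7 -> a < nV -> lt b (14 + a) -> E (14 + a) b.
  by move=> hb ha lab; rewrite /E lab arc_V_R2 // orbT.
have tr' k : k < 7 -> lt k (14 + x) -> lt k (14 + y).
  by move=> hk lk; apply: tr lk l => //; clear - hk hx hy; lia.
apply: (@no_k4 (14 + x) (14 + y) i j) => //;
  solve [by apply: up => //; apply: tr' | clear - hi hj hx hy; lia].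
Qed.

Lemma low_no_mono x y z : x < nV -> y < nV -> z < nV ->
  arc_of bkV x y -> arc_of bkV y z -> arc_of bkV z x ->
  low x = low y -> low y = low z -> False.
Proof.
move=> hx hy hz; rewrite -!arc_V => xy yz zx exy eyz.
have : E (14 + x) (14 + y) \/ E (14 + y) (14 + z) \/ E (14 + z) (14 + x).
  by apply: cycle_edge xy yz zx; lia.
by rewrite !mono_class_no_edge -?eyz -?exy // => -[//|[]].
Qed.

End FromOrder.

Lemma order_two_coloring lt : good_order n A lt -> exists c : nat -> bool,
  forall x y z, x < nV -> y < nV -> z < nV ->
  arc_of bkV x y -> arc_of bkV y z -> arc_of bkV z x ->
  c x = c y -> c y = c z -> False.
Proof. move=> g; exists (low lt) => x y z; exact: (low_no_mono g). Qed.

(** * From a 2-colouring to an order without [K4] *)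

Section FromColoring.
Variables (c : nat -> bool) (key : nat -> nat) (B : nat).
Hypothesis keyB : forall x, x < nV -> key x < B.
Hypothesis key_inj : forall x y, x < nV -> y < nV -> key x = key y -> x = y.
Hypothesis key_arc : forall x y, x < nV -> y < nV -> c x = c y -> key x < key y ->
  arc_of bkV x y.

(** By [key_arc], the keys order each colour class topologically, so no backedge arises inside a
    class; the offsets keep the regions apart. *)
Definition rank (u : nat) : nat :=
  if u < 14 then B + u else if c (u - 14) then key (u - 14) else B + 14 + key (u - 14).

Let lt u v := rank u < rank v.
Let E u v := lt u v && A v u || lt v u && A u v.
(* In increasing order of rank the vertices fall into four regions: colour
   [true], [R2], [R1], colour [false]. They are told apart by [inR] and [hi]. *)
Let inR u := u < 14.
Let hi u := if u < 14 then 7 <= u else ~~ c (u - 14).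

Lemma rank_inj u v : u < n -> v < n -> rank u = rank v -> u = v.
Proof.
move=> hu hv; rewrite /rank.
have ku : 14 <= u -> key (u - 14) < B by move=> h; apply: keyB; lia.
have kv : 14 <= v -> key (v - 14) < B by move=> h; apply: keyB; lia.
case: (ltnP u 14) => u14; case: (ltnP v 14) => v14; first by lia.
- by have := kv v14; case: (c _); lia.
- by have := ku u14; case: (c _); lia.
have inj : key (u - 14) = key (v - 14) -> u = v.
  by move=> /key_inj h; have := h ltac:(lia) ltac:(lia); lia.
have := ku u14; have := kv v14.
by case: (c (u - 14)); case: (c (v - 14)) => h1 h2 e; try (apply: inj; lia); lia.
Qed.

Lemma edge_sym u v : E u v = E v u.
Proof. by rewrite /E orbC. Qed.

(** Let T and F be the regions of colours [true] and [false]. The arcs T => R2 => R1 => F point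
    forward in the order, and T and F are sorted by [key]. Hence adjacent regions form the path R1,
    T, F, R2, and only its two end regions have inner edges. *)
Lemma edge_region u v : u < n -> v < n -> E u v ->
  if inR u && inR v then hi u == hi v else hi u != hi v.
Proof.
suff {u v} H u v : u < n -> v < n -> lt u v -> A v u ->
    if inR u && inR v then hi u == hi v else hi u != hi v.
  move=> hu hv /orP[/andP[]|/andP[]]; first exact: H.
  by move=> l a; have := H v u hv hu l a; rewrite andbC; case: ifP => _; rewrite eq_sym.
move=> hu hv l a; rewrite /inR /hi.
have ku : 14 <= u -> key (u - 14) < B by move=> h; apply: keyB; lia.
have kv : 14 <= v -> key (v - 14) < B by move=> h; apply: keyB; lia.
have anti x y : A x y -> A y x -> False.
  move=> h1 h2; have : x != y by apply: contraTneq h1 => ->; apply: arc_of_irr.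
  by move/(arc_of_tour gadget_back); rewrite h1 h2.
move: l; rewrite /lt /rank; case: (ltnP u 14) => u14; case: (ltnP v 14) => v14 /=.
- move=> l; apply/eqP; case: (leqP 7 u) => u7; first by lia.
  case: (leqP 7 v) => // v7; exfalso; apply: anti a _.
  by rewrite -(subnKC v7); apply: arc_R2_R1; lia.
- have := kv v14; case: (c _) => /=; first by lia.
  move=> _ _.
  case: (leqP 7 u) => // u7; exfalso; apply: anti a _.
  by rewrite -(subnKC u7) -(subnKC v14); apply: arc_R1_V; lia.
- have := ku u14; case: (c _) => /=; last by lia.
  move=> _ _; case: (leqP 7 v) => // v7; exfalso; apply: anti a _.
  by rewrite -(subnKC u14); apply: arc_V_R2.
- have := ku u14; have := kv v14.
  have same : c (u - 14) = c (v - 14) -> key (u - 14) < key (v - 14) -> False.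
    move=> e l; apply: (anti _ _ a); rewrite -{1}(subnKC u14) -{1}(subnKC v14) arc_V.
    by apply: key_arc => //; lia.
  case cu: (c (u - 14)); case cv: (c (v - 14)) => //= _ _ l; exfalso; apply: same;
    rewrite ?cu ?cv //; lia.
Qed.

Lemma edge_R2 u v : u < v -> v < 7 -> E u v -> r7_back u v.
Proof.
move=> uv v7; rewrite /E /lt /rank !ifT ?ltn_add2l; try lia.
by rewrite (ltnNge v u) (ltnW uv) /= orbF uv arc_R2 /arc_of ?ltnNge ?(ltnW uv) ?uv //=; lia.
Qed.

Lemma edge_R1 u v : u < v -> v < 7 -> E (7 + u) (7 + v) -> r7_back u v.
Proof.
move=> uv v7; rewrite /E /lt /rank !ifT ?ltn_add2l; try lia.
by rewrite (ltnNge v u) (ltnW uv) /= orbF uv arc_R1 /arc_of ?ltnNge ?(ltnW uv) ?uv //=; lia.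
Qed.

Lemma copy_no_triangle u v x : inR u -> inR v -> inR x -> hi u = hi v -> hi v = hi x ->
  u != v -> u != x -> v != x -> E u v -> E u x -> E v x -> False.
Proof.
suff {u v x} H u v x : inR x -> hi u = hi v -> hi v = hi x -> u < v -> v < x ->
    E u v -> E u x -> E v x -> False.
  move=> Ru Rv Rx euv evx nuv nux nvx e1 e2 e3.
  have e1' := e1; have e2' := e2; have e3' := e3.
  rewrite edge_sym in e1'; rewrite edge_sym in e2'; rewrite edge_sym in e3'.
  have euv' := esym euv; have evx' := esym evx.
  have eux := etrans euv evx; have eux' := esym eux.
  case: (ltngtP u v) nuv => // luv _; case: (ltngtP v x) nvx => // lvx _;
    case: (ltngtP u x) nux => // lux _; try by (exfalso; clear - luv lvx lux; lia).
  - exact: (H u v x).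
  - exact: (H u x v).
  - exact: (H x u v).
  - exact: (H v u x).
  - exact: (H v x u).
  - exact: (H x v u).
rewrite /inR /hi => Rx + + uv vx.
rewrite !ifT; try lia.
case: (leqP 7 u) => u7 euv evx e1 e2 e3.
  have v7 : 7 <= v by lia.
  have x7 : 7 <= x by lia.
  rewrite -(subnKC u7) -(subnKC v7) in e1; rewrite -(subnKC u7) -(subnKC x7) in e2.
  rewrite -(subnKC v7) -(subnKC x7) in e3.
  have /allP/(_ (u - 7)) := r7_triangle_free; rewrite mem_iota => /(_ ltac:(lia)).
  move=> /allP/(_ (v - 7)); rewrite mem_iota => /(_ ltac:(lia)).
  move=> /allP/(_ (x - 7)); rewrite mem_iota => /(_ ltac:(lia)).
  rewrite (edge_R1 _ _ e1) ?(edge_R1 _ _ e2) ?(edge_R1 _ _ e3); lia.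
have v7 : v < 7 by lia.
have x7 : x < 7 by lia.
have /allP/(_ u) := r7_triangle_free; rewrite mem_iota => /(_ ltac:(lia)).
move=> /allP/(_ v); rewrite mem_iota => /(_ ltac:(lia)).
move=> /allP/(_ x); rewrite mem_iota => /(_ ltac:(lia)).
rewrite (edge_R2 _ _ e1) ?(edge_R2 _ _ e2) ?(edge_R2 _ _ e3); lia.
Qed.

Lemma coloring_order : good_order n A lt.
Proof.
split.
- by move=> u _; rewrite /lt ltnn.
- by move=> u v hu hv; apply: contraR; rewrite negb_or -!leqNgt -eqn_leq => /eqP/rank_inj->.
- by move=> u v x _ _ _; apply: ltn_trans.
move=> u v x y hu hv hx hy; apply/negP; rewrite -!/(E _ _).
case/and5P=> uv ux uy vx /and5P[vy xy e1 e2 /and4P[e3 e4 e5 e6]].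
have r1 := edge_region hu hv e1; have r2 := edge_region hu hx e2.
have r3 := edge_region hu hy e3; have r4 := edge_region hv hx e4.
have r5 := edge_region hv hy e5; have r6 := edge_region hx hy e6.
(* A clique lies in two neighbouring regions of the path and has at most one vertex of each colour
   class, so four vertices would put three into one copy. *)
have : [|| [&& inR u, inR v, inR x, hi u == hi v & hi v == hi x],
           [&& inR u, inR v, inR y, hi u == hi v & hi v == hi y],
           [&& inR u, inR x, inR y, hi u == hi x & hi x == hi y] |
           [&& inR v, inR x, inR y, hi v == hi x & hi x == hi y]].
  move: r1 r2 r3 r4 r5 r6; case: (inR u); case: (inR v); case: (inR x); case: (inR y);
  by case: (hi u); case: (hi v); case: (hi x); case: (hi y).
case/or4P=> /and5P[R1 R2 R3 /eqP h1 /eqP h2].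
- exact: (@copy_no_triangle u v x).
- exact: (@copy_no_triangle u v y).
- exact: (@copy_no_triangle u x y).
- exact: (@copy_no_triangle v x y).
Qed.

End FromColoring.

End Gadget.

(** * From satisfiability to acyclic 2-colourings *)

Section Sat.
(* Literal [i < 3] of clause [j < J] is the variable [cv j i < V] with sign
   [cp j i]. *)
Variables (V J : nat) (cp : nat -> nat -> bool) (cv : nat -> nat -> nat).

Definition satisfiable :=
  exists al : nat -> bool, forall j, j < J -> exists2 i, i < 3 & al (cv j i) = cp j i.

(* Clause [j] becomes the not-all-equal constraints on its first two literals
   and [z_j], and on the negation of [z_j], its third literal and the constant
   [F]; here [z_j] is variable [V + j] and [F] is variable [V + J]. *)
Definition nvar := V + J + 1.
Definition opol (j r : nat) : bool :=
  if r == 0 then cp j 0 else if r == 1 then cp j 1 else if r == 4 then cp j 2 else ~~ (r == 3).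
Definition ovar (j r : nat) : nat :=
  if r == 0 then cv j 0 else if r == 1 then cv j 1 else if r == 4 then cv j 2
  else if r == 5 then V + J else V + j.

(* In increasing order: the positive literals, a 3-cycle, the negative literals,
   a 3-cycle, and two 3-cycles of literal occurrences per clause. *)
Definition sat_size := 2 * nvar + 6 + J * 6.
Definition sat_back (u v : nat) : bool :=
  if v < nvar then false
  else if v < nvar + 3 then (u == nvar) && (v == nvar + 2)
  else if v < 2 * nvar + 3 then v == u + (nvar + 3)
  else if v < 2 * nvar + 6 then (u == 2 * nvar + 3) && (v == 2 * nvar + 5)
  else
    let j := (v - (2 * nvar + 6)) %/ 6 in
    let r := (v - (2 * nvar + 6)) %% 6 in
    if u < nvar then opol j r && (ovar j r == u)
    else if u < nvar + 3 then false
    else if u < 2 * nvar + 3 then ~~ opol j r && (ovar j r == u - (nvar + 3))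
    else (v == u + 2) && ((r == 2) || (r == 5)).

Hypothesis cv_lt : forall j i, j < J -> i < 3 -> cv j i < V.

Definition occ (j r : nat) := 2 * nvar + 6 + (j * 6 + r).

Lemma occ_div j r : r < 6 -> (occ j r - (2 * nvar + 6)) %/ 6 = j.
Proof. by move=> hr; rewrite /occ addKn divnMDl // divn_small // addn0. Qed.

Lemma occ_mod j r : r < 6 -> (occ j r - (2 * nvar + 6)) %% 6 = r.
Proof. by move=> hr; rewrite /occ addKn modnMDl modn_small. Qed.

Lemma occP v : 2 * nvar + 6 <= v -> v < sat_size ->
  exists j r, [/\ j < J, r < 6 & v = occ j r].
Proof.
move=> h1 h2; exists ((v - (2 * nvar + 6)) %/ 6), ((v - (2 * nvar + 6)) %% 6).
rewrite ltn_mod ltn_divLR // /occ -divn_eq; split=> //; last by lia.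
by move: h2; rewrite /sat_size; lia.
Qed.

Lemma occ_lt j r : j < J -> r < 6 -> occ j r < sat_size.
Proof. by rewrite /occ /sat_size; nia. Qed.

Lemma ovar_lt j r : j < J -> ovar j r < nvar.
Proof.
move=> hj; rewrite /ovar /nvar; have h := cv_lt hj.
by have := h 0 isT; have := h 1 isT; have := h 2 isT; do !case: ifP => _; lia.
Qed.

Lemma sat_back_occ u j r : r < 6 -> sat_back u (occ j r) =
  if u < nvar then opol j r && (ovar j r == u)
  else if u < nvar + 3 then false
  else if u < 2 * nvar + 3 then ~~ opol j r && (ovar j r == u - (nvar + 3))
  else (occ j r == u + 2) && ((r == 2) || (r == 5)).
Proof.
move=> hr; rewrite /sat_back occ_div // occ_mod //.
have hb k : k <= 2 * nvar + 6 -> (occ j r < k) = false by rewrite /occ; lia.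
by rewrite !hb //; lia.
Qed.

Section FromColoring.
Variable c : nat -> bool.
Notation arc := (arc_of sat_back).
Hypothesis hc : forall x y z, x < sat_size -> y < sat_size -> z < sat_size ->
  arc x y -> arc y z -> arc z x -> c x = c y -> c y = c z -> False.

Lemma arc_fwd u v : u < v -> sat_back u v = false -> arc u v.
Proof. by move=> h e; rewrite /arc_of h e. Qed.

Lemma arc_bwd u v : u < v -> sat_back u v -> arc v u.
Proof. by move=> h e; rewrite /arc_of h ltnNge (ltnW h). Qed.

Definition is_cycle b := [/\ b + 2 < sat_size, sat_back b (b + 1) = false,
  sat_back (b + 1) (b + 2) = false & sat_back b (b + 2)].

Lemma cycle_colors b : is_cycle b -> ~ (c b = c (b + 1) /\ c (b + 1) = c (b + 2)).
Proof.
case=> h1 h2 h3 h4 [e1 e2]; apply: (hc (x := b) (y := b + 1) (z := b + 2)) => //; try lia.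
- by apply: arc_fwd => //; lia.
- by apply: arc_fwd => //; lia.
- by apply: arc_bwd => //; lia.
Qed.

(** Each vertex [s] of the 3-cycle at [b] closes another 3-cycle [x], [s], [y]. If [x] and [y] had
    the same colour, no such [s] could have it, and the 3-cycle at [b] would be monochromatic. *)
Lemma separated x y b : is_cycle b -> x < b -> b + 2 < y -> y < sat_size ->
  (forall s, b <= s < b + 3 -> sat_back x s = false /\ sat_back s y = false) ->
  sat_back x y -> c y = ~~ c x.
Proof.
move=> hb xb byy hy hs hxy.
suff : c x <> c y by case: (c x); case: (c y).
move=> e.
have nm s : b <= s < b + 3 -> c s <> c x.
  move=> hs' es; have [f1 f2] := hs s hs'; case: hb => hb _ _ _.
  apply: (hc (x := x) (y := s) (z := y)); rewrite ?es //; try lia.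
  - by apply: arc_fwd => //; lia.
  - by apply: arc_fwd => //; lia.
  - by apply: arc_bwd => //; lia.
have h0 := nm b ltac:(lia); have h1 := nm (b + 1) ltac:(lia); have h2 := nm (b + 2) ltac:(lia).
apply: (cycle_colors hb); move: h0 h1 h2.
by case: (c b); case: (c (b + 1)); case: (c (b + 2)); case: (c x).
Qed.

Lemma cycle_S1 : is_cycle nvar.
Proof.
split; rewrite /sat_size /sat_back; try lia.
- by rewrite ifF ?ifT; lia.
- by rewrite ifF ?ifT; lia.
- by rewrite ifF ?ifT ?eqxx; lia.
Qed.

Lemma cycle_S2 : is_cycle (2 * nvar + 3).
Proof.
have h : 0 < nvar by rewrite /nvar; lia.
split; rewrite /sat_size /sat_back; try lia; repeat (case: ifP => ?); lia.
Qed.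

Lemma cycle_occ j r : j < J -> (r == 0) || (r == 3) -> is_cycle (occ j r).
Proof.
move=> hj hr; have h5 : r + 2 < 6 by lia.
have e k : occ j r + k = occ j (r + k) by rewrite /occ; lia.
split; rewrite !e.
- exact: occ_lt.
- by rewrite sat_back_occ /occ; [repeat (case: ifP => ?); lia | lia].
- by rewrite sat_back_occ /occ; [repeat (case: ifP => ?); lia | lia].
- by rewrite sat_back_occ /occ; [repeat (case: ifP => ?); lia | lia].
Qed.

Lemma color_neg x : x < nvar -> c (nvar + 3 + x) = ~~ c x.
Proof.
move=> hx; apply: (separated cycle_S1); rewrite /sat_size; try lia.
- by move=> s hs; rewrite /sat_back; split; repeat (case: ifP => ?); lia.
- by rewrite /sat_back; repeat (case: ifP => ?); lia.
Qed.

(** A positive occurrence is joined to its variable and a negative one to the negated variable, so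
    an occurrence gets the colour opposite to its literal. A not-all-equal constraint is invariant
    under complementing all its colours. *)
Lemma color_occ j r : j < J -> r < 6 -> c (occ j r) = c (ovar j r) (+) opol j r.
Proof.
move=> hj hr; have hv := ovar_lt r hj; have ho := occ_lt hj hr.
have far s : s < 2 * nvar + 6 -> s < occ j r by rewrite /occ; lia.
have S2occ s : 2 * nvar + 3 <= s < 2 * nvar + 3 + 3 -> sat_back s (occ j r) = false.
  move=> hs; rewrite sat_back_occ // !ifF; try lia.
  by rewrite /occ; case: (ltnP r 2) => h; lia.
case p: (opol j r); rewrite ?addbT ?addbF.
  apply: (separated cycle_S2) => //; rewrite ?far //; try lia.
  - move=> s hs; rewrite S2occ //; split=> //.
    by rewrite /sat_back; repeat (case: ifP => ?); lia.
  - by rewrite sat_back_occ // hv p eqxx.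
rewrite -[RHS]negbK -color_neg //.
apply: (separated cycle_S2) => //; rewrite ?far //; try lia.
- move=> s hs; rewrite S2occ //; split=> //.
  by rewrite /sat_back; repeat (case: ifP => ?); lia.
- by rewrite sat_back_occ // p addKn eqxx; repeat (case: ifP => ?); lia.
Qed.

Lemma coloring_sat : satisfiable.
Proof.
(* The variable [F] has to count as false, so colours are compared with that of [F]. *)
exists (fun x => c x (+) c (V + J)) => j hj.
have b0 := cycle_colors (cycle_occ (r := 0) hj isT).
have b1 := cycle_colors (cycle_occ (r := 3) hj isT).
have e k l : occ j k + l = occ j (k + l) by rewrite /occ; lia.
rewrite !e !color_occ //= in b0 b1.
rewrite /opol /ovar /= in b0 b1.
case E0: (c (cv j 0) (+) c (V + J) == cp j 0); first by exists 0 => //; apply/eqP.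
case E1: (c (cv j 1) (+) c (V + J) == cp j 1); first by exists 1 => //; apply/eqP.
exists 2 => //; move: E0 E1 b0 b1.
case: (c (cv j 0)); case: (c (cv j 1)); case: (c (cv j 2)); case: (c (V + J)); case: (c (V + j));
case: (cp j 0); case: (cp j 1); case: (cp j 2) => //= _ _ h0 h1; exfalso; by [apply: h0 | apply: h1].
Qed.

End FromColoring.

Section FromAssignment.
Variable al : nat -> bool.
Hypothesis sat_al : forall j, j < J -> exists2 i, i < 3 & al (cv j i) = cp j i.

Definition lit_true j i := al (cv j i) == cp j i.
(** [z_j] is true exactly when the first two literals are false, so the first constraint of a clause
    always holds; as [F] is false, the second one then says that some literal is true. *)
Definition ext_al x : bool :=
  if x < V then al x else if x < V + J then ~~ (lit_true (x - V) 0 || lit_true (x - V) 1)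
  else false.

Definition col (u : nat) : bool :=
  if u < nvar then ext_al u
  else if u < nvar + 3 then u != nvar + 2
  else if u < 2 * nvar + 3 then ~~ ext_al (u - (nvar + 3))
  else if u < 2 * nvar + 6 then u != 2 * nvar + 5
  else ext_al (ovar ((u - (2 * nvar + 6)) %/ 6) ((u - (2 * nvar + 6)) %% 6)) (+)
       opol ((u - (2 * nvar + 6)) %/ 6) ((u - (2 * nvar + 6)) %% 6).

(* Within a 3-cycle of occurrences the third vertex is moved before the first
   one when they have the same colour. *)
Definition moved (u : nat) : bool :=
  [&& 2 * nvar + 6 <= u,
      ((u - (2 * nvar + 6)) %% 6 == 2) || ((u - (2 * nvar + 6)) %% 6 == 5)
    & col u == col (u - 2)].
(** Odd keys keep the natural order and leave the even slot just before vertex [u - 2] free for a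
    moved vertex [u]. *)
Definition vkey (u : nat) : nat := if moved u then (u - 2) * 2 else u * 2 + 1.

Lemma col_occ j r : r < 6 -> col (occ j r) = ext_al (ovar j r) (+) opol j r.
Proof.
move=> hr; rewrite /col occ_div // occ_mod //.
have hb k : k <= 2 * nvar + 6 -> (occ j r < k) = false by rewrite /occ; lia.
by rewrite !hb //; lia.
Qed.

Lemma block_colors j r : j < J -> (r == 0) || (r == 3) ->
  ~ (col (occ j r) = col (occ j (r + 1)) /\ col (occ j (r + 1)) = col (occ j (r + 2))).
Proof.
move=> hj hr; have [i hi sat] := sat_al hj.
have e i' : i' < 3 -> ext_al (cv j i') = al (cv j i').
  by move=> hi'; rewrite /ext_al cv_lt.
have ez : ext_al (V + j) = ~~ (lit_true j 0 || lit_true j 1).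
  by rewrite /ext_al ltnNge leq_addr /= ltn_add2l hj addKn.
have eF : ext_al (V + J) = false by rewrite /ext_al ltnNge leq_addr /= ltnn.
rewrite !col_occ; try lia.
case/orP: hr => /eqP-> /=; rewrite /opol /ovar /= ?e // ?ez ?eF /lit_true.
  by case: (al (cv j 0)); case: (cp j 0); case: (al (cv j 1)); case: (cp j 1) => -[].
move: i hi sat => [|[|[|//]]] _ ->.
- by rewrite eqxx /=; case: (_ (+) _) => -[].
- by rewrite eqxx orbT /=; case: (_ (+) _) => -[].
- by rewrite addbb; case: (~~ _) => -[].
Qed.

Lemma movedP u : u < sat_size -> moved u -> exists j r,
  [/\ j < J, (r == 0) || (r == 3), u = occ j (r + 2) & col (occ j (r + 2)) = col (occ j r)].
Proof.
move=> hu /and3P[h1 h2 /eqP h3]; have [j [r [hj hr eu]]] := occP h1 hu.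
rewrite eu occ_mod // in h2; exists j, (r - 2); split=> //; try lia.
  by rewrite eu /occ; lia.
have <- : u = occ j (r - 2 + 2) by rewrite eu /occ; lia.
by rewrite h3; congr col; rewrite eu /occ; lia.
Qed.

Lemma vkey_bound u : u < sat_size -> vkey u < sat_size * 2.
Proof. by rewrite /vkey; case: ifP => _; lia. Qed.

Lemma vkey_inj u v : u < sat_size -> v < sat_size -> vkey u = vkey v -> u = v.
Proof.
move=> hu hv; rewrite /vkey.
case: ifP => [/and3P[h1 _ _]|_]; case: ifP => [/and3P[h2 _ _]|_]; lia.
Qed.

(** By the choice of [col], backedges between literals and occurrences, and those of the two
    separating 3-cycles, join different colours. The others close a 3-cycle of occurrences; there
    the third vertex, moved before the first, passes besides it only the middle one, whose colour
    differs because the constraint holds. *)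
Lemma vkey_arc u v : u < sat_size -> v < sat_size -> col u = col v -> vkey u < vkey v ->
  arc_of sat_back u v.
Proof.
move=> hu hv ec lk; rewrite /arc_of.
have mv2 x : moved x -> 2 <= x by case/and3P; lia.
case: (ltngtP u v) => [luv|lvu|e]; last by rewrite e ltnn in lk.
- apply/negP => hb; case: (leqP (2 * nvar + 6) v) => v6; last first.
    move: hb; rewrite /sat_back; case: (ltnP v nvar) => // v1.
    case: (ltnP v (nvar + 3)) => v2.
      move=> /andP[/eqP eu /eqP ev]; move: ec; rewrite eu ev /col.
      by repeat (case: ifP => ?); lia.
    case: (ltnP v (2 * nvar + 3)) => v3.
      move=> /eqP ev; move: ec; rewrite /col.
      have -> : u < nvar by lia.
      rewrite [v < nvar]ltnNge v1 [v < nvar + 3]ltnNge v2 v3 /= ev addnK.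
      by case: ext_al.
    rewrite v6 => /andP[/eqP eu /eqP ev]; move: ec; rewrite eu ev /col.
    by repeat (case: ifP => ?); lia.
  have [j [r [hj hr ev]]] := occP v6 hv.
  move: hb; rewrite ev sat_back_occ //; rewrite ev col_occ // in ec.
  case: ifP => u1.
    move=> /andP[p /eqP e]; move: ec; rewrite /col u1 p e.
    by case: ext_al.
  case: ifP => // u2; case: ifP => u3.
    move=> /andP[/negbTE p /eqP e]; move: ec; rewrite /col u1 u2 u3 p e addbF.
    by case: ext_al.
  move=> /andP[/eqP e2 r25]; move: lk; rewrite /vkey.
  have mv : moved v.
    rewrite /moved v6 ev occ_mod // r25 /=; apply/eqP.
    by rewrite col_occ // -ec; congr col; lia.
  have -> : moved u = false.
    have eu : u = occ j (r - 2) by move: e2; rewrite /occ; lia.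
    rewrite /moved eu occ_mod; last by lia.
    have -> : (r - 2 == 2) || (r - 2 == 5) = false by lia.
    by rewrite andbF.
  by rewrite mv; have := mv2 v mv; rewrite ev in e2 *; lia.
- move: lk; rewrite /vkey; case: ifP => mu; last by case: ifP => mw; lia.
  have [j [r [hj hr eu cE]]] := movedP hu mu; rewrite eu in hu ec lvu *.
  have [->|ne] := eqVneq v (occ j r).
    by rewrite sat_back_occ /occ; [repeat (case: ifP => ?); lia | lia].
  move=> h; have ev : v = occ j (r + 1).
    by move: h ne lvu; rewrite /occ; case: ifP => mw; [have := mv2 v mw|]; lia.
  by case: (@block_colors j r hj hr); rewrite -ev -ec cE.
Qed.

End FromAssignment.

Theorem satisfiable_three_diomega :
  three_diomega_ordering (matrix_word (14 + sat_size) (arc_of (gadget_back sat_back)))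
  <-> satisfiable.
Proof.
rewrite three_diomega_matrix; first last.
- by move=> u v _ _; apply: arc_of_tour.
- by move=> u _; apply: arc_of_irr.
split=> [[lt /order_two_coloring[c hc]]|[al hal]]; first exact: (coloring_sat hc).
have hB := @vkey_bound al; have hI := @vkey_inj al; have hA := vkey_arc hal.
by eexists; apply: (coloring_order (B := sat_size * 2) hB hI hA).
Qed.

End Sat.

(** * Tableaux of nondeterministic machines *)

Section TapeCells.
Variable G : finType.

(* The symbol in cell [x], when the head is on cell [p]. *)
Definition cell (t : tape G) (p x : nat) : tsymbol G :=
  if x < p then nth None (tleft t) (p - x.+1)
  else if x == p then thead t else nth None (tright t) (x - p.+1).

Definition shift (m : move) (p : nat) : nat :=
  match m with MoveL => p.-1 | Stay => p | MoveR => p.+1 end.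

Lemma cell_head t p : cell t p p = thead t.
Proof. by rewrite /cell ltnn eqxx. Qed.

(** [shift] truncates at 0, hence [0 < p]; a head that starts in cell [T] satisfies this at all
    times below [T]. *)
Lemma cell_act t p x a : 0 < p ->
  cell (tape_act t a) (shift a.2 p) x = if x == p then a.1 else cell t p x.
Proof.
case: t a => l h r [s m] p0; rewrite /cell /tape_act /=; case: m => /=.
- case: (ltngtP x p) => [lxp|lpx|->].
  + case: (ltngtP x p.-1) => [h1|h1|->]; last first.
    * by have -> : p - p.-1.+1 = 0 by lia; rewrite nth0.
    * by lia.
    by rewrite nth_behead; congr nth; lia.
  + have -> : (x < p.-1) = false by lia.
    have -> : (x == p.-1) = false by lia.
    by have -> : x - p.-1.+1 = (x - p.+1).+1 by lia.
  + have -> : (p < p.-1) = false by lia.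
    have -> : (p == p.-1) = false by lia.
    by have -> : p - p.-1.+1 = 0 by lia.
- by case: (ltngtP x p).
- case: (ltngtP x p) => [lxp|lpx|->].
  + have -> : x < p.+1 by lia.
    by have -> : p.+1 - x.+1 = (p - x.+1).+1 by lia.
  + have -> : (x < p.+1) = false by lia.
    case: (eqVneq x p.+1) => [->|ne]; first by rewrite subnn nth0.
    by rewrite nth_behead; congr nth; lia.
  + by rewrite ltnSn subSS subnn.
Qed.

Lemma cell_input w p x : cell (input_tape G w) p x =
  if (p <= x) && (x < p + size w) then Some (inl (nth false w (x - p))) else None.
Proof.
have E k : nth None (word_symbols G w) k =
    if k < size w then Some (inl (nth false w k)) else None.
  case: ltnP => h; first by rewrite (nth_map false).
  by rewrite nth_default // size_map.
rewrite /cell /input_tape /=; case: (ltngtP x p) => [lxp|lpx|->] /=.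
- by rewrite nth_nil.
- rewrite nth_behead E; have -> : (x - p.+1).+1 = x - p by lia.
  by have -> : (x - p < size w) = (x < p + size w) by lia.
- by rewrite -nth0 E subnn; congr (if _ then _ else _); lia.
Qed.

Lemma tape_act_stay (t : tape G) : tape_act t (thead t, Stay) = t.
Proof. by case: t. Qed.

End TapeCells.

(** * Clauses describing an accepting run *)

Section CookLevin.
Variable M : tm.
Notation Q := (tm_state M).
Notation I := 'I_(tm_k M).+1.
Notation Sy := (tsymbol (tm_work M)).
Notation scanT := {ffun I -> Sy}.
Notation actT := {ffun I -> Sy * move}.

Definition transition : finType := (Q * scanT * Q * actT)%type.
Definition tr_src (d : transition) := d.1.1.1.
Definition tr_scan (d : transition) := d.1.1.2.
Definition tr_dst (d : transition) := d.1.2.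
Definition tr_act (d : transition) := d.2.

(* Accepting halted configurations are allowed to loop. *)
Definition stutter (d : transition) : bool :=
  [&& tm_accept (tr_src d),
      [forall q, forall a, ~~ tm_delta (tr_src d) (tr_scan d) q a],
      tr_dst d == tr_src d & tr_act d == [ffun i => (tr_scan d i, Stay)]].
Definition allowed (d : transition) : bool :=
  tm_delta (tr_src d) (tr_scan d) (tr_dst d) (tr_act d) || stutter d.

(** The last summand breaks the disjunction over all transitions into clauses of three literals:
    [kZ j] is meant to say that the transition taken has rank below [j]. *)
Definition kind : finType :=
  (Q + I + (I * Sy) + transition + 'I_(#|transition|).+1)%type.
Definition kS (q : Q) : kind := inl (inl (inl (inl q))).
Definition kH (i : I) : kind := inl (inl (inl (inr i))).
Definition kC (i : I) (a : Sy) : kind := inl (inl (inr (i, a))).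
Definition kD (d : transition) : kind := inl (inr d).
Definition kZ (j : nat) : kind := inr (inord j).

(* A literal is a sign, a variable kind, a time offset and a position selector. *)
Definition tlit := (bool * kind * nat * nat)%type.
Definition tclause := (nat * tlit * tlit * tlit)%type.

Definition sel (s x y : nat) : nat :=
  if s == 0 then 0 else if s == 1 then x else if s == 2 then y
  else if s == 3 then x.+1 else x.-1.

(** The input word enters only through these side conditions. Code 0 is no condition, 1 asks for
    distinct cells; the others concern time 0: 2 any cell, 3 the start cell, 4 a cell outside the
    input, 5 and 6 an input bit 0 or 1. *)
Definition cond (w : seq bool) (T k t x y : nat) : bool :=
  if k == 0 then true else if k == 1 then ~~ (x == y) else
  (t == 0) &&
  (if k == 2 then true else if k == 3 then x == T else
   if k == 4 then ~~ ((T <= x) && (x < T + size w)) else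
   (T <= x) && (x < T + size w) && (nth false w (x - T) == (k == 6))).

Definition lit_holds (be : kind -> nat -> nat -> bool) (t x y : nat) (l : tlit) : bool :=
  be l.1.1.2 (t + l.1.2) (sel l.2 x y) == l.1.1.1.

Definition clause_holds be t x y (c : tclause) : bool :=
  [|| lit_holds be t x y c.1.1.2, lit_holds be t x y c.1.2 | lit_holds be t x y c.2].

Definition nS q : tlit := (false, kS q, 0, 0).
Definition nH i : tlit := (false, kH i, 0, 1).
Definition nC i a s : tlit := (false, kC i a, 0, s).
Definition nD d : tlit := (false, kD d, 0, 0).
Definition unit_clause k (l : tlit) : tclause := (k, l, l, l).
Definition move_sel (m : move) : nat :=
  match m with MoveL => 4 | Stay => 1 | MoveR => 3 end.

(** No clause asks for a unique state, head position or symbol: a transition taken must not conflict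
    with a true fact and has to produce the facts of the next time. Except for the last family,
    which selects a transition, all clauses are Horn. *)
Definition templates : seq tclause :=
  [:: unit_clause 2 (true, kS (tm_start M), 0, 0);
      unit_clause 4 (true, kC ord0 None, 0, 1);
      unit_clause 5 (true, kC ord0 (Some (inl false)), 0, 1);
      unit_clause 6 (true, kC ord0 (Some (inl true)), 0, 1);
      unit_clause 0 (false, kZ 0, 0, 0);
      unit_clause 0 (true, kZ #|transition|, 0, 0)]
  ++ [seq unit_clause 3 (true, kH i, 0, 1) | i <- enum I]
  ++ [seq unit_clause 2 (true, kC i None, 0, 1) | i <- enum I & i != ord0]
  ++ [seq unit_clause 0 (nD d) | d <- enum transition & ~~ allowed d]
  ++ [seq (0, nD z.1, nD z.1, nS z.2) |
       z <- enum ((transition * Q)%type : finType) & z.2 != tr_src z.1]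
  ++ [seq (0, nD z.1.1, nH z.1.2, nC z.1.2 z.2 1) |
       z <- enum ((transition * I * Sy)%type : finType) & z.2 != tr_scan z.1.1 z.1.2]
  ++ [seq (0, nD d, nD d, (true, kS (tr_dst d), 1, 0)) | d <- enum transition]
  ++ [seq (0, nD z.1, nH z.2, (true, kH z.2, 1, move_sel (tr_act z.1 z.2).2)) |
       z <- enum ((transition * I)%type : finType)]
  ++ [seq (0, nD z.1, nH z.2, (true, kC z.2 (tr_act z.1 z.2).1, 1, 1)) |
       z <- enum ((transition * I)%type : finType)]
  ++ [seq (1, nH z.1, nC z.1 z.2 2, (true, kC z.1 z.2, 1, 2)) |
       z <- enum ((I * Sy)%type : finType)]
  ++ [seq (0, (false, kZ (enum_rank d).+1, 0, 0), (true, kZ (enum_rank d), 0, 0),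
           (true, kD d, 0, 0)) | d <- enum transition].

Definition All (P : tclause -> Prop) (s : seq tclause) := forall c, c \in s -> P c.

Lemma All_cat P s1 s2 : All P (s1 ++ s2) <-> All P s1 /\ All P s2.
Proof.
split=> [h|[h1 h2] c]; last by rewrite mem_cat => /orP[/h1|/h2].
by split=> c hc; apply: h; rewrite mem_cat hc ?orbT.
Qed.

Lemma All_cons P c s : All P (c :: s) <-> P c /\ All P s.
Proof.
split=> [h|[h1 h2] c']; last by rewrite inE => /orP[/eqP->|/h2].
by split=> [|c' hc]; apply: h; rewrite inE ?eqxx // hc orbT.
Qed.

Lemma All_enum P (T : finType) (f : T -> tclause) :
  All P [seq f z | z <- enum T] <-> forall z, P (f z).
Proof.
split=> [h z|h c /mapP[z _ ->]//]; apply: h; apply: map_f; exact: mem_enum.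
Qed.

Lemma All_filter P (T : finType) (p : pred T) (f : T -> tclause) :
  All P [seq f z | z <- enum T & p z] <-> forall z, p z -> P (f z).
Proof.
split=> [h z pz|h c /mapP[z]]; last by rewrite mem_filter => /andP[pz _] ->; apply: h.
by apply: h; apply: map_f; rewrite mem_filter pz mem_enum.
Qed.

Variables (w : seq bool) (T : nat).
(** Heads start in cell [T] and make at most [T] moves, so cells 0 to [2 * T] suffice. *)
Notation X := (2 * T + 1).

Definition clause_valid (be : kind -> nat -> nat -> bool) (c : tclause) : Prop :=
  forall t x y, t < T -> x < X -> y < X -> cond w T c.1.1.1 t x y -> clause_holds be t x y c.

Definition tableau be := All (clause_valid be) templates.

Lemma unit_valid be k (l : tlit) : clause_valid be (unit_clause k l) <->
  forall t x y, t < T -> x < X -> y < X -> cond w T k t x y -> lit_holds be t x y l.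
Proof. by split=> h t x y ht hx hy hc; have := h t x y ht hx hy hc; rewrite /clause_holds /= !orbb. Qed.

Lemma tableau_facts be : tableau be <->
  (0 < T -> be (kS (tm_start M)) 0 0 /\
    (forall i, be (kH i) 0 T) /\
    (forall i x, x < X -> be (kC i (cell (input_tape (tm_work M)
        (if i == ord0 then w else [::])) T x)) 0 x)) /\
  forall t, t < T ->
   [/\ be (kZ 0) t 0 = false /\ be (kZ #|transition|) t 0,
       forall d, be (kZ (enum_rank d).+1) t 0 -> be (kZ (enum_rank d)) t 0 || be (kD d) t 0,
       forall d, be (kD d) t 0 -> allowed d /\ be (kS (tr_dst d)) t.+1 0,
       (forall d q, be (kD d) t 0 -> be (kS q) t 0 -> q = tr_src d) /\
       (forall d i a x, x < X -> be (kD d) t 0 -> be (kH i) t x -> be (kC i a) t x ->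
          a = tr_scan d i) &
       (forall d i x, x < X -> be (kD d) t 0 -> be (kH i) t x ->
          be (kH i) t.+1 (shift (tr_act d i).2 x) /\ be (kC i (tr_act d i).1) t.+1 x) /\
       (forall i a x y, x < X -> y < X -> x != y -> be (kH i) t x -> be (kC i a) t y ->
          be (kC i a) t.+1 y)].
Proof.
have selm m x y : sel (move_sel m) x y = shift m x by case: m.
rewrite /tableau /templates !(All_cat, All_cons, All_enum, All_filter) !unit_valid.
split.
  move=> [[h1 [h2 [h3 [h4 [h5 [h6 _]]]]]] [h7 [h8 [h9 [h10 [h11 [h12 [h13 [h14 [h15 h16]]]]]]]]]].
  split.
    move=> T0; split; [|split].
    - by have := h1 0 0 0 T0 ltac:(lia) ltac:(lia) isT; rewrite /lit_holds /= eqb_id.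
    - move=> i; have /unit_valid H := h7 i; have := H 0 T T T0 ltac:(lia) ltac:(lia).
      by rewrite /cond /= eqxx /lit_holds /= eqb_id; apply.
    - move=> i x hx; rewrite cell_input; case: (eqVneq i ord0) => [->|ni].
        case: ifP => hb; last first.
          have := h2 0 x x T0 hx hx; rewrite /cond /= hb /lit_holds /= eqb_id.
          exact.
        case e: (nth false w (x - T)).
          have := h4 0 x x T0 hx hx; rewrite /cond /= hb e /lit_holds /= eqb_id.
          exact.
        have := h3 0 x x T0 hx hx; rewrite /cond /= hb e /lit_holds /= eqb_id.
        exact.
      rewrite addn0 [_ && _](_ : _ = false); last by lia.
      have /unit_valid H := h8 i ni; have := H 0 x x T0 hx hx isT.
      by rewrite /lit_holds /= eqb_id.
  move=> t ht; split.
  - have := h5 t 0 0 ht ltac:(lia) ltac:(lia) isT; have := h6 t 0 0 ht ltac:(lia) ltac:(lia) isT.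
    by rewrite /lit_holds /= !addn0 eqb_id eqbF_neg => -> /negbTE.
  - move=> d bz; have := h16 d t 0 0 ht ltac:(lia) ltac:(lia) isT.
    by rewrite /clause_holds /lit_holds /= !addn0 !eqb_id bz.
  - move=> d bd; split.
      apply/negPn/negP => nd; have /unit_valid H := h9 d nd.
      by have := H t 0 0 ht ltac:(lia) ltac:(lia) isT; rewrite /lit_holds /= addn0 bd.
    have := h12 d t 0 0 ht ltac:(lia) ltac:(lia) isT.
    by rewrite /clause_holds /lit_holds /= addn0 addn1 bd eqb_id.
  - split.
      move=> d q bd bq; apply/eqP/negPn/negP => nq.
      have := h10 (d, q) nq t 0 0 ht ltac:(lia) ltac:(lia) isT.
      by rewrite /clause_holds /lit_holds /= !addn0 bd bq.
    move=> d i a x hx bd bh bc; apply/eqP/negPn/negP => na.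
    have := h11 (d, i, a) na t x x ht hx hx isT.
    by rewrite /clause_holds /lit_holds /= !addn0 bd bh bc.
  - split.
      move=> d i x hx bd bh; split.
        have := h13 (d, i) t x x ht hx hx isT.
        by rewrite /clause_holds /lit_holds /= !addn0 addn1 bd bh selm eqb_id.
      have := h14 (d, i) t x x ht hx hx isT.
      by rewrite /clause_holds /lit_holds /= !addn0 addn1 bd bh eqb_id.
    move=> i a x y hx hy nxy bh bc; have := h15 (i, a) t x y ht hx hy.
    rewrite /cond /= nxy => /(_ isT).
    by rewrite /clause_holds /lit_holds /= !addn0 addn1 bh bc eqb_id.
move=> [H0 H1].
have T_pos t : t < T -> 0 < T by lia.
have cell0 i x t : t < T -> x < X -> be (kC i (cell (input_tape (tm_work M)
        (if i == ord0 then w else [::])) T x)) 0 x.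
  by move=> /T_pos/H0[_ [_ h]]; apply: h.
split; [split; [|split; [|split; [|split; [|split; [|split]]]]]|].
- move=> t x y ht hx hy; rewrite /cond /= andbT => /eqP t0.
  by rewrite /lit_holds /= t0 eqb_id; case: (H0 (T_pos t ht)).
- move=> t x y ht hx hy; rewrite /cond /= => /andP[/eqP t0 hb].
  have := cell0 ord0 x t ht hx; rewrite cell_input ?eqxx (negbTE hb).
  by rewrite /lit_holds /= t0 eqb_id.
- move=> t x y ht hx hy; rewrite /cond /= => /andP[/eqP t0 /andP[hb /eqP e]].
  have := cell0 ord0 x t ht hx; rewrite cell_input ?eqxx hb e.
  by rewrite /lit_holds /= t0 eqb_id.
- move=> t x y ht hx hy; rewrite /cond /= => /andP[/eqP t0 /andP[hb /eqP e]].
  have := cell0 ord0 x t ht hx; rewrite cell_input ?eqxx hb e.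
  by rewrite /lit_holds /= t0 eqb_id.
- by move=> t x y ht _ _ _; rewrite /lit_holds /= addn0; case: (H1 t ht) => -[-> _].
- by move=> t x y ht _ _ _; rewrite /lit_holds /= addn0 eqb_id; case: (H1 t ht) => -[_].
- by [].
split; [|split; [|split; [|split; [|split; [|split; [|split; [|split; [|split]]]]]]]].
- move=> i; apply/unit_valid => t x y ht hx hy; rewrite /cond /= => /andP[/eqP t0 /eqP->].
  by rewrite /lit_holds /= t0 eqb_id; case: (H0 (T_pos t ht)) => _ [].
- move=> i ni; apply/unit_valid => t x y ht hx hy; rewrite /cond /= andbT => /eqP t0.
  have := cell0 i x t ht hx; rewrite cell_input (negbTE ni) /= addn0.
  have -> : (T <= x) && (x < T) = false by lia.
  by rewrite /lit_holds /= t0 eqb_id.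
- move=> d nd; apply/unit_valid => t x y ht hx hy _; rewrite /lit_holds /= addn0 eqbF_neg.
  by apply: contra nd; case: (H1 t ht) => _ _ h _ _ /h[].
- move=> [d q] /= nq t x y ht _ _ _; rewrite /clause_holds /lit_holds /= !addn0 !eqbF_neg.
  case bd: (be (kD d) t 0) => //=; apply: contra nq => bq.
  by case: (H1 t ht) => _ _ _ [h _] _; apply/eqP; apply: h.
- move=> [[d i] a] /= na t x y ht hx _ _; rewrite /clause_holds /lit_holds /= !addn0 !eqbF_neg.
  case bd: (be (kD d) t 0) => //=; case bh: (be (kH i) t (sel 1 x y)) => //=.
  apply: contra na => bc.
  by case: (H1 t ht) => _ _ _ [_ h] _; apply/eqP; apply: h bc.
- move=> d t x y ht _ _ _; rewrite /clause_holds /lit_holds /= !addn0 addn1 !eqbF_neg eqb_id.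
  case bd: (be (kD d) t 0) => //=.
  by case: (H1 t ht) => _ _ /(_ d bd)[].
- move=> [d i] /= t x y ht hx _ _; rewrite /clause_holds /lit_holds /= !addn0 addn1 !eqbF_neg eqb_id selm.
  case bd: (be (kD d) t 0) => //=; case bh: (be (kH i) t (sel 1 x y)) => //=.
  by case: (H1 t ht) => _ _ _ _ [/(_ d i x hx bd bh)[]].
- move=> [d i] /= t x y ht hx _ _; rewrite /clause_holds /lit_holds /= !addn0 addn1 !eqbF_neg eqb_id.
  case bd: (be (kD d) t 0) => //=; case bh: (be (kH i) t (sel 1 x y)) => //=.
  by case: (H1 t ht) => _ _ _ _ [/(_ d i x hx bd bh)[]].
- move=> [i a] /= t x y ht hx hy; rewrite /cond /= => nxy.
  rewrite /clause_holds /lit_holds /= !addn0 addn1 !eqbF_neg eqb_id.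
  case bh: (be (kH i) t (sel 1 x y)) => //=; case bc: (be (kC i a) t (sel 2 x y)) => //=.
  by case: (H1 t ht) => _ _ _ _ [_ h]; apply: (h i a x y).
- move=> d t x y ht _ _ _; rewrite /clause_holds /lit_holds /= !addn0 eqbF_neg !eqb_id.
  case bz: (be (kZ (enum_rank d).+1) t (sel 0 x y)) => //=.
  by case: (H1 t ht) => _ h _ _ _; apply: h.
Qed.

(** On the way down from the true [kZ #|transition|] to the false [kZ 0], some step requires a true
    [kD d]. *)
Lemma kZ_chain be t : t < T -> be (kZ 0) t 0 = false -> be (kZ #|transition|) t 0 ->
  (forall d, be (kZ (enum_rank d).+1) t 0 -> be (kZ (enum_rank d)) t 0 || be (kD d) t 0) ->
  exists d, be (kD d) t 0.
Proof.
move=> ht z0 zn hz.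
suff H j : j <= #|transition| -> be (kZ j) t 0 -> exists d, be (kD d) t 0 by apply: (H _ _ zn).
elim: j => [|j IH]; first by rewrite z0.
move=> lt_j; pose d := enum_val (Ordinal lt_j).
have ed : enum_rank d = j :> nat by rewrite enum_valK.
by have := hz d; rewrite ed => h /h/orP[/IH|bd]; [apply; lia | exists d].
Qed.

(** One-sided: the facts of [c] hold at time [t], while further states, head positions or symbols
    may be true as well. *)
Definition config_true be t (c : config M) :=
  be (kS (cstate c)) t 0 /\
  forall i, exists p, [/\ T - t <= p <= T + t, be (kH i) t p &
    forall x, x < X -> be (kC i (cell (ctapes c i) p x)) t x].

Lemma tableau_step be t c : tableau be -> t < T -> config_true be t c ->
  exists2 c', config_true be t.+1 c' &
    step c c' \/ [/\ c' = c, halted c & tm_accept (cstate c)].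
Proof.
move=> /tableau_facts[_ H] ht [bS bT].
have [[z0 zn] hz hD [hS hC] [hH hK]] := H t ht.
have [d bd] := kZ_chain ht z0 zn hz.
have [ad bdst] := hD d bd; have esrc := hS d _ bd bS.
have escan : tr_scan d = scanned c.
  apply/ffunP => i; rewrite ffunE; have [p [hp bh bc]] := bT i.
  by symmetry; apply: (hC d i _ p) => //; [lia | rewrite -(cell_head (ctapes c i) p); apply: bc; lia].
pose c' : config M := @Config M (tr_dst d) [ffun i => tape_act (ctapes c i) (tr_act d i)].
have true' : config_true be t.+1 c'.
  split=> // i; have [p [hp bh bc]] := bT i; have p0 : 0 < p by lia.
  have hpX : p < X by lia.
  have [bh' bk'] := hH d i p hpX bd bh.
  exists (shift (tr_act d i).2 p); split=> //.
    by case: (tr_act d i).2 => /=; lia.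
  move=> x hx; rewrite /c' /= ffunE cell_act //; case: (eqVneq x p) => [->//|nxp].
  by apply: (hK i _ p x) => //; [rewrite eq_sym | apply: bc].
exists c' => //; case/orP: ad => [dl|/and4P[acc /forallP nd /eqP edst /eqP eact]].
  left; exists (tr_act d) => //=.
  by rewrite esrc -escan.
right; split.
- rewrite /c' edst -esrc; case: (c) escan => q tp escan; congr Config.
  apply/ffunP => i; rewrite ffunE eact ffunE escan ffunE /=; exact: tape_act_stay.
- move=> c1 [a /=]; rewrite esrc -escan => h.
  by move/forallP: (nd (cstate c1)) => /(_ a); rewrite h.
- by rewrite esrc.
Qed.

Lemma init_config_true be : 0 < T -> tableau be -> config_true be 0 (init_config M w).
Proof.
move=> T0 /tableau_facts[/(_ T0)[b1 [b2 b3]] _]; split=> // i.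
exists T; split=> //; first by rewrite subn0 addn0 leqnn.
by move=> x hx; rewrite /= ffunE; apply: b3.
Qed.

(** A tableau follows a run until it loops. A run of [T] steps is excluded by the time bound, so the
    loop is reached, and only accepting halted configurations loop. *)
Lemma tableau_accepts be : (forall n c, nsteps n (init_config M w) c -> n < T) ->
  tableau be -> accepts M w.
Proof.
move=> bound tb; have T0 : 0 < T by apply: (bound 0 (init_config M w)).
suff H t : t <= T -> exists2 c, config_true be t c & exists2 k, nsteps k (init_config M w) c &
    k = t \/ halted c /\ tm_accept (cstate c).
  have [c _ [k nk [ek|[hc ac]]]] := H T (leqnn T); last by exists k, c.
  by have := bound _ _ nk; rewrite ek ltnn.
elim: t => [|t IH] ht.
  exists (init_config M w); first exact: init_config_true.
  by exists 0 => //; left.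
have [c tc [k nk hk]] := IH (ltnW ht).
have [c' tc' hs] := tableau_step tb ht tc; exists c' => //.
case: hs => [st|[-> hc ac]]; last by exists k => //; right.
case: hk => [ek|[hc _]]; last by case: (hc c').
exists t.+1; last by left.
by rewrite -addn1 -ek; apply: nsteps_trans nk _; exists c'.
Qed.

Definition linked (c : config M) (d : transition) (c' : config M) :=
  [/\ tr_src d = cstate c, tr_scan d = scanned c, tr_dst d = cstate c' &
      ctapes c' = [ffun i => tape_act (ctapes c i) (tr_act d i)]].

(** The run is prolonged to an infinite one by looping at its end, so that every time of the tableau
    has a transition. *)
Lemma accepting_path n c c' : nsteps n c c' -> halted c' -> tm_accept (cstate c') ->
  exists (f : nat -> config M) (d : nat -> transition),
  f 0 = c /\ forall k, allowed (d k) /\ linked (f k) (d k) (f k.+1).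
Proof.
move=> + hc ac; elim: n c => [|n IH] c /=.
  move=> ->; pose d : transition :=
    (cstate c', scanned c', cstate c', [ffun i => (scanned c' i, Stay)]).
  exists (fun=> c'), (fun=> d); split=> // _; split.
    apply/orP; right; apply/and4P; split=> //.
    apply/forallP => q; apply/forallP => a; apply/negP => h.
    by case: (hc (@Config M q [ffun i => tape_act (ctapes c' i) (a i)])); exists a.
  split=> //; apply/ffunP => i; rewrite !ffunE; by rewrite tape_act_stay.
case=> x [a da ex] /IH[f [d [f0 hf]]].
exists (fun k => if k is k'.+1 then f k' else c).
exists (fun k => if k is k'.+1 then d k' else (cstate c, scanned c, cstate x, a)).
split=> // -[|k] //; split; first by rewrite /allowed /= da.
by rewrite f0; split.
Qed.

Lemma accepts_tableau : accepts M w -> exists be, tableau be.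
Proof.
move=> [n [c [nc hc ac]]]; have [f [d [f0 hf]]] := accepting_path nc hc ac.
pose pos := fix pos (i : I) (t : nat) : nat :=
  if t is t'.+1 then shift (tr_act (d t') i).2 (pos i t') else T.
have pos_bound i t : T - t <= pos i t <= T + t.
  elim: t => [|t IH] /=; first by lia.
  by case: (tr_act (d t) i).2 => /=; lia.
pose be (k : kind) (t x : nat) : bool :=
  match k with
  | inl (inl (inl (inl q))) => q == cstate (f t)
  | inl (inl (inl (inr i))) => x == pos i t
  | inl (inl (inr (i, a))) => a == cell (ctapes (f t) i) (pos i t) x
  | inl (inr e) => e == d t
  | inr j => enum_rank (d t) < j
  end.
have beZ j t x : j <= #|transition| -> be (kZ j) t x = (enum_rank (d t) < j).
  by move=> hj; rewrite /be /kZ inordK.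
exists be; apply/tableau_facts; split.
  move=> T0; rewrite /be /= f0; split; [by [] | split; first by move=> i; rewrite eqxx].
  by move=> i x hx; rewrite ffunE.
move=> t ht; have [al [lsrc lscan ldst ltap]] := hf t; split.
- by rewrite !beZ // ltn_ord.
- move=> e; have he : enum_rank e < #|transition| := ltn_ord _.
  rewrite (beZ _ _ _ he) (beZ _ _ _ (ltnW he)) ltnS leq_eqVlt => /orP[/eqP h|->//].
  by apply/orP; right; apply/eqP/enum_rank_inj/ord_inj.
- by move=> e /eqP->; split=> //; rewrite /be /= ldst.
- split=> [e q /eqP-> /eqP->//|e i a x hx /eqP-> /= /eqP-> /eqP->].
  by rewrite lscan ffunE cell_head.
- have upd i x : cell (ctapes (f t.+1) i) (pos i t.+1) x =
      if x == pos i t then (tr_act (d t) i).1 else cell (ctapes (f t) i) (pos i t) x.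
    by rewrite ltap ffunE /= cell_act //; have := pos_bound i t; lia.
  split=> [e i x hx /eqP-> /eqP->|i a x y hx hy nxy /eqP ex /eqP ea].
    by split; rewrite [be _ _ _]/= ?upd eqxx.
  have ny : (y == pos i t) = false by rewrite -ex eq_sym (negbTE nxy).
  by rewrite [be _ _ _]/= upd ny -ea eqxx.
Qed.

End CookLevin.

(** * The reduction *)

Lemma mixed_div a b x : x < b -> (a * b + x) %/ b = a.
Proof. by move=> h; rewrite divnMDl ?divn_small ?addn0 //; lia. Qed.

Lemma mixed_mod a b x : x < b -> (a * b + x) %% b = x.
Proof. by move=> h; rewrite modnMDl modn_small. Qed.

Section Coding.
Variable M : tm.
Notation kindM := (kind M).

Definition tlit_of (c : tclause M) (i : nat) : tlit M :=
  if i == 0 then c.1.1.2 else if i == 1 then c.1.2 else c.2.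
Definition default_clause : tclause M := unit_clause 0 (nS (tm_start M)).
Definition template (k : nat) : tclause M := nth default_clause (templates M) k.
Definition ntemplate := size (templates M).

Definition tab (f : tclause M -> nat) (k : nat) : nat :=
  if k < ntemplate then f (template k) else 0.
Definition code_kind (i : nat) (c : tclause M) : nat := enum_rank (tlit_of c i).1.1.2.

Lemma time_offset_le1 c i : c \in templates M -> (tlit_of c i).1.2 <= 1.
Proof.
move: c; suff : All (fun c : tclause M => [/\ c.1.1.2.1.2 <= 1, c.1.2.1.2 <= 1 & c.2.1.2 <= 1])
    (templates M).
  by move=> h c /h[h0 h1 h2]; rewrite /tlit_of; do !case: ifP.
by rewrite /templates !(All_cat, All_cons, All_enum, All_filter) /=; do !split.
Qed.

Variable w : seq bool.
Variable T : nat.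
Hypothesis T0 : 0 < T.
Notation X := (2 * T + 1).

Definition nclause := ntemplate * T * X * X.
(** A literal may refer to one time and one cell beyond the ranges of [t] and [x], hence [T + 1] and
    [X + 1]. *)
Definition nbase := #|kindM| * (T + 1) * (X + 1).

Definition cl_y j := j %% X.
Definition cl_x j := j %/ X %% X.
Definition cl_t j := j %/ X %/ X %% T.
Definition cl_k j := j %/ X %/ X %/ T.

Definition cl_ok j :=
  cond w T (tab (fun c => c.1.1.1) (cl_k j)) (cl_t j) (cl_x j) (cl_y j).
(* Indices of unused clauses denote the tautology [v \/ ~ v \/ v]. *)
Definition cl_sign j i : bool :=
  if cl_ok j then 0 < tab (fun c => (tlit_of c i).1.1.1) (cl_k j) else ~~ (i == 1).
Definition cl_var j i : nat :=
  if cl_ok j then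
    (tab (code_kind i) (cl_k j) * (T + 1)
      + (cl_t j + tab (fun c => (tlit_of c i).1.2) (cl_k j))) * (X + 1)
    + sel (tab (fun c => (tlit_of c i).2) (cl_k j)) (cl_x j) (cl_y j)
  else 0.

Lemma sel_le s x y : x < X -> y < X -> sel s x y < X + 1.
Proof. by rewrite /sel; do !case: ifP => _; lia. Qed.

Lemma kind_lt (k : kindM) : enum_rank k < #|kindM|.
Proof. exact: ltn_ord. Qed.

Lemma cl_decode j : j < nclause ->
  [/\ cl_k j < ntemplate, cl_t j < T, cl_x j < X & cl_y j < X].
Proof.
move=> hj; rewrite /cl_t /cl_x /cl_y !ltn_mod; split=> //; try lia.
by rewrite /cl_k !ltn_divLR //; lia.
Qed.

Lemma cl_encode k t x y : k < ntemplate -> t < T -> x < X -> y < X ->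
  let j := ((k * T + t) * X + x) * X + y in
  [/\ j < nclause, cl_k j = k, cl_t j = t, cl_x j = x & cl_y j = y].
Proof.
move=> hk ht hx hy j; rewrite /cl_k /cl_t /cl_x /cl_y !mixed_div // !mixed_mod //; split=> //.
have lt a b c d : a < b -> c < d -> a * d + c < b * d by nia.
by rewrite /j /nclause; apply: (lt) => //; apply: (lt) => //; apply: lt.
Qed.

Lemma cl_var_lt j i : j < nclause -> i < 3 -> cl_var j i < nbase.
Proof.
move=> hj _; have [hk ht hx hy] := cl_decode hj.
have pos : 0 < #|kindM| by apply: leq_ltn_trans (kind_lt (kS (tm_start M))).
rewrite /cl_var; case: ifP => _; last by rewrite /nbase; nia.
have hs := sel_le (tab (fun c => (tlit_of c i).2) (cl_k j)) hx hy.
have hd : tab (fun c => (tlit_of c i).1.2) (cl_k j) <= 1.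
  by rewrite /tab hk; apply/time_offset_le1/mem_nth.
have hn : tab (code_kind i) (cl_k j) < #|kindM| by rewrite /tab hk; apply: kind_lt.
have lt a b c d : a < b -> c < d -> a * d + c < b * d by nia.
by rewrite /nbase; apply: (lt) hs; apply: (lt) hn _; lia.
Qed.

Lemma satisfiable_tableau :
  satisfiable nclause cl_sign cl_var <-> exists be, tableau (M := M) w T be.
Proof.
pose enc k t x := (k * (T + 1) + t) * (X + 1) + x.
split=> [[al hal]|[be tb]].
  exists (fun k t x => al (enc (enum_rank k) t x)) => c hc t x y ht hx hy cnd.
  have hk : index c (templates M) < ntemplate by rewrite index_mem.
  have [hj ek et ex ey] := cl_encode hk ht hx hy.
  set j := (_ * X + y) in hj ek et ex ey.
  have [i hi] := hal j hj.
  have tE f : tab f (cl_k j) = f c by rewrite /tab ek hk /template nth_index.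
  have ok : cl_ok j by rewrite /cl_ok tE et ex ey.
  rewrite /cl_var /cl_sign ok !tE et ex ey lt0b => h.
  rewrite /clause_holds; move: i hi h => [|[|[|//]]] _; rewrite /tlit_of /= /lit_holds => ->;
    by rewrite eqxx ?orbT.
pose kd n : kindM := nth (kS (tm_start M)) (enum kindM) n.
pose al v := be (kd (v %/ (X + 1) %/ (T + 1))) (v %/ (X + 1) %% (T + 1)) (v %% (X + 1)).
have alE k t x : t < T + 1 -> x < X + 1 -> al (enc (enum_rank k) t x) = be k t x.
  move=> ht hx; rewrite /al /enc (mixed_div _ hx) (mixed_mod _ hx).
  rewrite (mixed_div _ ht) (mixed_mod _ ht) /kd; congr (be _ t x).
  exact: nth_enum_rank.
exists al => j hj; have [hk ht hx hy] := cl_decode hj.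
have tE f : tab f (cl_k j) = f (template (cl_k j)) by rewrite /tab hk.
rewrite /cl_sign /cl_var; case ok: (cl_ok j); last first.
  by case e: (al 0); [exists 0 | exists 1].
have mem : template (cl_k j) \in templates M by apply: mem_nth.
rewrite /cl_ok tE in ok; have := tb _ mem _ _ _ ht hx hy ok.
have H i : lit_holds be (cl_t j) (cl_x j) (cl_y j) (tlit_of (template (cl_k j)) i) ->
    al (enc (tab (code_kind i) (cl_k j)) (cl_t j + tab (fun c => (tlit_of c i).1.2) (cl_k j))
      (sel (tab (fun c => (tlit_of c i).2) (cl_k j)) (cl_x j) (cl_y j))) =
    (0 < tab (fun c => (tlit_of c i).1.1.1) (cl_k j)).
  move=> /eqP h; rewrite !tE /code_kind alE ?lt0b ?sel_le //.
  by have := time_offset_le1 i mem; lia.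
by case/or3P=> h; [exists 0 | exists 1 | exists 2] => //; apply: H.
Qed.

End Coding.

Lemma numeric_sel s x y : numeric s -> numeric x -> numeric y ->
  numeric (fun w g e => sel (s w g e) (x w g e) (y w g e)).
Proof.
move=> hs hx hy; rewrite /sel; numeric.
apply: numeric_ext (numeric_sub hx (numeric_const 1)) _ => w g e; exact: subn1.
Qed.

Lemma definable_cond T k t x y : numeric (fun w _ _ => T w) -> numeric k -> numeric t ->
  numeric x -> numeric y ->
  definable (fun w g e => cond w (T w) (k w g e) (t w g e) (x w g e) (y w g e)).
Proof. move=> hT hk ht hx hy; rewrite /cond; numeric. Qed.

(** * Definability of the reduction *)

Section Reduction.
Variables (M : tm) (T : seq bool -> nat).
Hypothesis hT : numeric (fun w _ _ => T w).

Lemma numeric_tab f F : numeric F -> numeric (fun w g e => tab (M := M) f (F w g e)).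
Proof. move=> hF; exact: (numeric_table (fun k => f (template M k)) (ntemplate M) hF). Qed.

Section Clause.
Variable F : seq bool -> seq bool -> (nat -> nat) -> nat.
Hypothesis hF : numeric F.

Lemma numeric_cl : [/\ numeric (fun w g e => cl_k (T w) (F w g e)),
  numeric (fun w g e => cl_t (T w) (F w g e)), numeric (fun w g e => cl_x (T w) (F w g e)) &
  numeric (fun w g e => cl_y (T w) (F w g e))].
Proof. by split; rewrite /cl_k /cl_t /cl_x /cl_y; numeric. Qed.

Lemma definable_cl_ok : definable (fun w g e => cl_ok M w (T w) (F w g e)).
Proof.
have [hk ht hx hy] := numeric_cl; rewrite /cl_ok.
exact: (definable_cond hT (numeric_tab _ hk) ht hx hy).
Qed.

Lemma definable_cl_sign i : definable (fun w g e => cl_sign M w (T w) (F w g e) i).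
Proof.
have [hk _ _ _] := numeric_cl; rewrite /cl_sign.
apply: (definable_if definable_cl_ok); last exact: definable_const.
by apply: definable_leq; [numeric | apply: numeric_tab].
Qed.

Lemma numeric_cl_var i : numeric (fun w g e => cl_var M w (T w) (F w g e) i).
Proof.
have [hk ht hx hy] := numeric_cl; rewrite /cl_var.
apply: (numeric_if definable_cl_ok); last exact: numeric_const.
have h1 := numeric_tab (code_kind i) hk.
have h2 := numeric_tab (fun c => (tlit_of c i).1.2) hk.
have h3 := numeric_sel (numeric_tab (fun c => (tlit_of c i).2) hk) hx hy.
by numeric.
Qed.
End Clause.

Notation Jn w := (nclause M (T w)).
Notation Vn w := (nbase M (T w)).
Notation cs w := (cl_sign M w (T w)).
Notation cv w := (cl_var M w (T w)).

Lemma numeric_J : numeric (fun w _ _ => Jn w).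
Proof. rewrite /nclause; numeric. Qed.

Lemma numeric_V : numeric (fun w _ _ => Vn w).
Proof. rewrite /nbase; numeric. Qed.

Lemma numeric_nvar : numeric (fun w _ _ => nvar (Vn w) (Jn w)).
Proof. have hJ := numeric_J; have hV := numeric_V; rewrite /nvar; numeric. Qed.

Lemma definable_opol j r : numeric j -> numeric r ->
  definable (fun w g e => opol (cs w) (j w g e) (r w g e)).
Proof.
move=> hj hr; have h i := definable_cl_sign hj i.
by have h0 := h 0; have h1 := h 1; have h2 := h 2; rewrite /opol; numeric.
Qed.

Lemma numeric_ovar j r : numeric j -> numeric r ->
  numeric (fun w g e => ovar (Vn w) (Jn w) (cv w) (j w g e) (r w g e)).
Proof.
move=> hj hr; have h i := numeric_cl_var hj i; have hJ := numeric_J; have hV := numeric_V.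
by have h0 := h 0; have h1 := h 1; have h2 := h 2; rewrite /ovar; numeric.
Qed.

Notation sb w := (sat_back (Vn w) (Jn w) (cs w) (cv w)).

Lemma definable_sat_back u v : numeric u -> numeric v ->
  definable (fun w g e => sb w (u w g e) (v w g e)).
Proof.
move=> hu hv; have hn := numeric_nvar.
have hj : numeric (fun w g e => (v w g e - (2 * nvar (Vn w) (Jn w) + 6)) %/ 6) by numeric.
have hr : numeric (fun w g e => (v w g e - (2 * nvar (Vn w) (Jn w) + 6)) %% 6) by numeric.
have hp := definable_opol hj hr; have ho := numeric_ovar hj hr.
by rewrite /sat_back; numeric.
Qed.

Lemma definable_r7 u v : numeric u -> numeric v ->
  definable (fun w g e => r7_back (u w g e) (v w g e)).
Proof.
move=> hu hv; have hc : numeric (fun w g e => u w g e * 7 + v w g e) by numeric.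
have ht := definable_table (fun k => r7_back (k %/ 7) (k %% 7)) 49 hc.
(* This guard makes the code [u * 7 + v] unambiguous; larger [v] never give a backedge. *)
have hl : definable (fun w g e => v w g e < 7) by numeric.
apply: numeric_ext (definable_and hl ht) _ => w g e; congr nat_of_bool.
have far x y : 7 <= y -> r7_back x y = false.
  rewrite /r7_back => hy; move: x => [|[|[|[|[|[|[|x]]]]]]] /=; rewrite ?inE ?nth_nil //; try lia.
case: ltnP => [h|/far->//] /=; rewrite mixed_div // mixed_mod //.
case: (ltnP (u w g e) 7) => hu7; first by have -> : u w g e * 7 + v w g e < 49 by lia.
have -> : (u w g e * 7 + v w g e < 49) = false by lia.
by rewrite /r7_back nth_default.
Qed.

Lemma definable_gadget u v : numeric u -> numeric v ->
  definable (fun w g e => gadget_back (sb w) (u w g e) (v w g e)).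
Proof.
move=> hu hv; have h1 := definable_r7 hu hv.
have hu7 : numeric (fun w g e => u w g e - 7) by numeric.
have hv7 : numeric (fun w g e => v w g e - 7) by numeric.
have hu14 : numeric (fun w g e => u w g e - 14) by numeric.
have hv14 : numeric (fun w g e => v w g e - 14) by numeric.
have h2 := definable_r7 hu7 hv7; have h3 := definable_sat_back hu14 hv14.
by rewrite /gadget_back; numeric.
Qed.

Lemma polytime_reduction : polytime_computable (fun w =>
  matrix_word (14 + sat_size (Vn w) (Jn w)) (arc_of (gadget_back (sb w)))).
Proof.
apply: polytime_matrix.
  by have hn := numeric_nvar; have hJ := numeric_J; rewrite /sat_size; numeric.
have h1 := definable_gadget (numeric_var 1) (numeric_var 0).
have h2 := definable_gadget (numeric_var 0) (numeric_var 1).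
by rewrite /arc_of; numeric.
Qed.

End Reduction.

Lemma three_diomega_NP_hard : NP_hard three_diomega_ordering.
Proof.
(* The added 1 makes the tableau longer than every run: the bound on the number of steps becomes
   strict, and [T] is positive. *)
move=> L [M [[p rt] LM]]; pose T (w : seq bool) := p.[size w]%R + 1.
have hT : numeric (fun w _ _ => T w).
  by rewrite /T; apply: numeric_add (numeric_const 1); apply: numeric_horner numeric_size.
exists (fun w => matrix_word (14 + sat_size (nbase M (T w)) (nclause M (T w)))
  (arc_of (gadget_back (sat_back (nbase M (T w)) (nclause M (T w))
     (cl_sign M w (T w)) (cl_var M w (T w)))))).
split; first exact: polytime_reduction.
move=> w; have T0 : 0 < T w by rewrite /T addn1.
rewrite LM satisfiable_three_diomega; last by move=> j i; apply: cl_var_lt.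
rewrite satisfiable_tableau //; split=> [|[be tb]]; first exact: accepts_tableau.
apply: tableau_accepts tb => n c /rt; rewrite /T addn1 ltnS; exact.
Qed.

Theorem theorem3p9 : NP_complete three_diomega_ordering.
Proof. exact: (conj three_diomega_in_NP three_diomega_NP_hard). Qed.
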